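(* Tree-Contractibility can be solved by a deterministic algorithm in time $4.88^k\, n^{O(1)}$, where $n$ is the number of vertices of the input graph.
   Context: All graphs are finite, undirected and simple. Contracting an edge $xy$ removes $x$ and $y$ and replaces them by a new vertex adjacent to exactly the vertices adjacent to at least one of $x,y$. A graph $G$ is $k$-contractible to $H$ if $H$ can be obtained from $G$ by at most $k$ edge contractions. Tree-Contractibility: given a graph $G$ and an integer $k$, decide whether $G$ is $k$-contractible to a tree. *)

(* Defs.v *)
From HB Require Import structures.
From mathcomp Require Import all_boot all_order all_algebra.

Set Implicit Arguments.
Unset Strict Implicit.
Unset Printing Implicit Defensive.

(** * Graphs and contractions *)

Record sgraph := SGraph {
  vertex :> finType;
  adj : rel vertex;
  adj_sym : symmetric adj;
  adj_irrefl : irreflexive adj }.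

Definition isomorphic (G H : sgraph) : Prop :=
  exists2 f : G -> H, bijective f & forall u v : G, adj (f u) (f v) = adj u v.

(* Trees are nonempty. *)
Definition is_tree (T : sgraph) : Prop :=
  [/\ 0 < #|T|,
      forall u v : T, connect (@adj T) u v
    & forall c : seq T, 2 < size c -> ~ ucycle (@adj T) c].

Section Contract.
Variables (G : sgraph) (x y : G).

(* [None] is the new vertex, [Some v] an old vertex other than x and y. *)
Definition contract_vertex : finType := option {v : G | (v != x) && (v != y)}.

Definition contract_adj : rel contract_vertex := fun u v =>
  match u, v with
  | Some u, Some v => adj (val u) (val v)
  | Some u, None => adj x (val u) || adj y (val u)
  | None, Some v => adj x (val v) || adj y (val v)
  | None, None => false
  end.

Fact contract_adj_sym : symmetric contract_adj.
Proof. by move=> [u|] [v|] //=; rewrite adj_sym. Qed.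

Fact contract_adj_irrefl : irreflexive contract_adj.
Proof. by move=> [u|] //=; rewrite adj_irrefl. Qed.

Definition contract : sgraph := SGraph contract_adj_sym contract_adj_irrefl.

End Contract.

(* [contracts_to H m G]: H is obtained from G by exactly m edge contractions. *)
Inductive contracts_to (H : sgraph) : nat -> sgraph -> Prop :=
| contracts_to0 (G : sgraph) : isomorphic G H -> contracts_to H 0 G
| contracts_toS m (G : sgraph) (x y : G) :
    adj x y -> contracts_to H m (contract x y) -> contracts_to H m.+1 G.

Definition contractible (k : nat) (G H : sgraph) : Prop :=
  exists2 m, m <= k & contracts_to H m G.

Definition tree_contractible (G : sgraph) (k : nat) : Prop :=
  exists2 T : sgraph, is_tree T & contractible k G T.

(** * Random access machines with logarithmic cost

    The machine has countably many cells holding natural numbers, indirect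
    addressing, and the usual arithmetic instructions. Programs are written
    with structured control flow instead of jumps; compiling either form into
    the other costs a constant factor (depending only on the program). *)

Definition memory := nat -> nat.

Definition update (s : memory) (a v : nat) : memory :=
  fun b => if b == a then v else s b.

Inductive expr :=
| Const of nat
| Fetch of expr            (* content of the cell whose address is given *)
| Add of expr & expr
| Sub of expr & expr       (* truncated *)
| Mul of expr & expr
| Div of expr & expr.      (* Euclidean quotient, 0 if the divisor is 0 *)

Inductive program :=
| Skip
| Store of expr & expr     (* address, value *)
| Seq of program & program
| If of expr & program & program
| While of expr & program.

Fixpoint eval (s : memory) (e : expr) : nat :=
  match e with
  | Const c => c
  | Fetch a => s (eval s a)
  | Add e1 e2 => eval s e1 + eval s e2
  | Sub e1 e2 => eval s e1 - eval s e2
  | Mul e1 e2 => eval s e1 * eval s e2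
  | Div e1 e2 => eval s e1 %/ eval s e2
  end.

Definition bitlength (v : nat) : nat := (trunc_log 2 v).+1.

(* Every value occurring in the evaluation, addresses included, is charged its
   length in binary. *)
Fixpoint eval_cost (s : memory) (e : expr) : nat :=
  bitlength (eval s e) +
  match e with
  | Const _ => 0
  | Fetch a => eval_cost s a
  | Add e1 e2 | Sub e1 e2 | Mul e1 e2 | Div e1 e2 =>
      eval_cost s e1 + eval_cost s e2
  end.

(* [exec p s s' t]: started in memory s, the program p halts with memory s'
   after time t. *)
Inductive exec : program -> memory -> memory -> nat -> Prop :=
| exec_skip s : exec Skip s s 1
| exec_store s a e :
    exec (Store a e) s (update s (eval s a) (eval s e))
      (eval_cost s a + eval_cost s e).+1
| exec_seq p q s s1 s2 t1 t2 :
    exec p s s1 t1 -> exec q s1 s2 t2 -> exec (Seq p q) s s2 (t1 + t2)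
| exec_if_true e p q s s' t :
    eval s e != 0 -> exec p s s' t ->
    exec (If e p q) s s' (eval_cost s e + t)
| exec_if_false e p q s s' t :
    eval s e = 0 -> exec q s s' t ->
    exec (If e p q) s s' (eval_cost s e + t)
| exec_while_true e p s s1 s2 t1 t2 :
    eval s e != 0 -> exec p s s1 t1 -> exec (While e p) s1 s2 t2 ->
    exec (While e p) s s2 (eval_cost s e + t1 + t2)
| exec_while_false e p s :
    eval s e = 0 -> exec (While e p) s s (eval_cost s e).

Lemma exec_deterministic p s s1 s2 t1 t2 :
  exec p s s1 t1 -> exec p s s2 t2 -> s1 = s2 /\ t1 = t2.
Proof.
move=> E; elim: E s2 t2 => {p s s1 t1}
  [s|s a e|p q s s1 s1' t t' _ IH1 _ IH2|e p q s s1 t e0 _ IH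
  |e p q s s1 t e0 _ IH|e p s s1 s1' t t' e0 _ IH1 _ IH2|e p s e0] s2 t2 E;
  inversion E; subst => //;
  try by [match goal with H : is_true (eval _ _ != 0), H0 : eval _ _ = 0 |- _ =>
            rewrite H0 in H end].
- match goal with H : exec p _ _ _ |- _ => case: (IH1 _ _ H) => ? ? end; subst.
  by match goal with H : exec q _ _ _ |- _ => case: (IH2 _ _ H) => -> -> end.
- by match goal with H : exec p _ _ _ |- _ => case: (IH _ _ H) => -> -> end.
- by match goal with H : exec q _ _ _ |- _ => case: (IH _ _ H) => -> -> end.
- match goal with H : exec p _ _ _ |- _ => case: (IH1 _ _ H) => ? ? end; subst.
  by match goal with H : exec (While _ _) _ _ _ |- _ =>
    case: (IH2 _ _ H) => -> -> end.
Qed.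

(* Cell 0 contains the number n of vertices, cell 1 the parameter, and cell
   2 + i * n + j the (i, j) entry of the adjacency matrix; all other cells
   contain 0. *)
Definition encode (G : sgraph) (k : nat) : memory := fun a =>
  if a == 0 then #|G|
  else if a == 1 then k
  else [exists i : 'I_#|G|, exists j : 'I_#|G|,
          (a == 2 + i * #|G| + j) && adj (enum_val i) (enum_val j)].

Definition accepting (s : memory) : Prop := s 0 != 0.

(* Main.v *)
(** A graph is contractible to a tree with [k] contractions iff it is connected
    and its vertices have a 2-colouring whose monochromatic components (blocks)
    number at least [n - k] and yield an acyclic graph when contracted: trees are
    bipartite.  This condition can be treated separately on the two sides of a
    cut vertex, so let the graph be 2-connected.  Then a block with one vertex is
    a leaf of the tree: all its neighbours lie in one block.  It suffices to
    colour enough vertices of the other, "busy" blocks: once every uncoloured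
    vertex has neighbours of exactly one colour, all blocks of the tree are
    determined up to the choice of the uncoloured vertices that join a block, and
    these only have to connect the coloured components of each block.  A search
    over the sets of components connected so far finds them.

    To colour vertices, pick an uncoloured [v] with a coloured neighbour and
    guess: [v] is busy, of either colour; or [v] is a leaf, and all its neighbours
    are busy of the colour seen.  If the guessed colour is not seen by [v] and [v]
    has at most two uncoloured neighbours, then guess also a busy neighbour in the
    same block.  Guesses have weight 10 (colour seen), 6 (colour not seen), 16
    (colour not seen, with a neighbour) and 9 per neighbour (leaf).  After the
    initial guess of one busy vertex, a solution with [k] contractions is reached
    by guesses of total weight at most [16 k - 6], leaving [7 c] for the final
    search over the subsets of [c] components.  Let [z = 1.1041].  At each [v], the
    sum of [z ^ (- weight)] over all guesses is less than 1, and [2 <= z ^ 7], so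
    that up to polynomial factors there are at most [z ^ (16 k)] states; finally,
    [z ^ 16 <= 4.88]. *)

Require Import Defs.
From HB Require Import structures.
From mathcomp Require Import all_boot all_order all_algebra.
From mathcomp Require Import zify ring lra.

Set Implicit Arguments.
Unset Strict Implicit.
Unset Printing Implicit Defensive.

(** * Polynomial time on the RAM *)

(** The weights come from a potential. A block of [w] vertices costs [w - 1] contractions, worth 16
    units each. Each coloured vertex is charged 10 units; 1 is refunded for each anchor, a vertex
    kept as witness of a coloured component, and 3 for each block met. So the weight is 10 for a
    vertex attached to a coloured neighbour, 10 - 1 - 3 = 6 for one that may open a block, 20 - 1 -
    3 = 16 for such a vertex with a neighbour, and 10 - 1 = 9 for one that may open a component of a
    known block. The charge of a block never exceeds [16 (w - 1)], with equality for a coloured pair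
    with one anchor, and what is left over pays 7 units for each component that still has to be
    connected to the leader of its block.

    The weights bound the number of distinct states, not of branches: the program keeps a table of
    visited states, so branches that meet are pursued once. When a 2-connected part is finished,
    only the number of contractions left and the rest of the graph are remembered. Hence the numbers
    of states add up over the parts, instead of their polynomial factors multiplying. *)

Lemma ltn_bitlength v : v < 2 ^ bitlength v.
Proof. exact: trunc_log_ltn. Qed.

Lemma bitlength_leq v m : 0 < m -> v < 2 ^ m -> bitlength v <= m.
Proof.
move=> m0 vm; case: (posnP v) => [->|v0]; first by rewrite /bitlength trunc_log0.
rewrite /bitlength -(ltn_exp2l (m := 2)) //.
by apply: leq_ltn_trans vm; apply: trunc_logP.
Qed.

Lemma bitlength_leqS v : bitlength v <= v.+1.
Proof. by apply: bitlength_leq => //; apply: ltn_trans (ltn_expl _ _). Qed.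

Lemma leq_bitlength v w : v <= w -> bitlength v <= bitlength w.
Proof. by move=> vw; apply: bitlength_leq => //; apply: leq_ltn_trans (ltn_bitlength w). Qed.

Lemma bitlengthM v w : bitlength (v * w) <= bitlength v + bitlength w.
Proof.
apply: bitlength_leq => //; rewrite expnD.
by apply: ltn_mul; apply: ltn_bitlength.
Qed.

Lemma bitlengthD v w : bitlength (v + w) <= bitlength v + bitlength w.
Proof.
apply: bitlength_leq => //; rewrite expnD.
have := ltn_bitlength v; have := ltn_bitlength w.
have: 1 < 2 ^ bitlength v by rewrite /bitlength expnS; have := expn_gt0 2 (trunc_log 2 v); lia.
have: 1 < 2 ^ bitlength w by rewrite /bitlength expnS; have := expn_gt0 2 (trunc_log 2 w); lia.
nia.
Qed.

Lemma leq_expl e m1 m2 : m1 <= m2 -> m1 ^ e <= m2 ^ e.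
Proof. by case: e => // e le12; rewrite leq_exp2r. Qed.

(** No leading coefficient is needed: for [1 < L] a constant [m] is at most [L ^ m]. *)
Definition poly_bounded (T : nat -> nat) := exists e, forall L, 1 < L -> T L <= L ^ e.

Lemma poly_const m : poly_bounded (fun=> m).
Proof.
exists m => L L1; apply: leq_trans (_ : 2 ^ m <= _); first exact/ltnW/ltn_expl.
exact: leq_expl.
Qed.

Lemma poly_id : poly_bounded id.
Proof. by exists 1. Qed.

Lemma polyM T1 T2 : poly_bounded T1 -> poly_bounded T2 ->
  poly_bounded (fun L => T1 L * T2 L).
Proof.
move=> [e1 H1] [e2 H2]; exists (e1 + e2) => L L1.
by rewrite expnD; apply: leq_mul; [apply: H1|apply: H2].
Qed.

Lemma polyD T1 T2 : poly_bounded T1 -> poly_bounded T2 ->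
  poly_bounded (fun L => T1 L + T2 L).
Proof.
move=> [e1 H1] [e2 H2]; exists (e1 + e2).+1 => L L1.
have := H1 L L1; have := H2 L L1; rewrite expnS expnD.
have: 0 < L ^ e1 by rewrite expn_gt0; lia.
have: 0 < L ^ e2 by rewrite expn_gt0; lia.
set a := L ^ e1; set b := L ^ e2 => b0 a0 Hb Ha.
apply: leq_trans (_ : 2 * (a * b) <= _); [nia|exact: leq_mul].
Qed.

(** The summand [L] keeps the argument of [T2] above 1, where its polynomial bound applies. *)
Lemma poly_comp T1 T2 : poly_bounded T1 -> poly_bounded T2 ->
  poly_bounded (fun L => T2 (L + T1 L)).
Proof.
move=> p1 [e2 H2]; have [e1 H1] := polyD poly_id p1.
exists (e1 * e2) => L L1; apply: leq_trans (H2 _ _) _; first lia.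
by rewrite expnM; apply: leq_expl; apply: H1.
Qed.

Ltac poly := repeat first
  [ assumption | apply: poly_const | apply: poly_id | apply: polyD | apply: polyM
  | apply: poly_comp ].

(* A context describes the data available to a computation: the read-only input
   cells and the values held in registers.  Register [r] is the cell
   [base + r], just above the input. *)
Record context := Context {
  env :> Type;
  inp : env -> memory;
  vars : seq (env -> nat) }.

Definition var (c : context) i : c -> nat := nth (fun=> 0) (vars c) i.

Definition extend (c : context) : context :=
  @Context (c * nat) (fun x => inp x.1) (snd :: [seq (fun x => v x.1) | v <- vars c]).

Definition base (m : memory) := 2 + m 0 * m 0.

Definition agree (m s : memory) := forall a, a < base m -> s a = m a.

Definition fits (c : context) L (x : c) :=
  [/\ 1 < L, inp x 0 <= L, forall a, a < base (inp x) -> bitlength (inp x a) <= L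
    & forall i, i < size (vars c) -> bitlength (var i x) <= L].

Definition holds (c : context) (rho : seq nat) (x : c) (s : memory) :=
  agree (inp x) s /\
  forall i, i < size (vars c) -> s (base (inp x) + nth 0 rho i) = var i x.

(** Writes are confined to the [w] registers from [r] on. This is what lets programs be composed:
    the input, the lower registers and the tables above survive. *)
Definition framed (m s s' : memory) r w :=
  forall a, (a < base m + r) || (base m + r + w <= a) -> s' a = s a.

(* [f] is computed in time polynomial in the number of vertices and the length
   of the data, into any register [r] above those in use. *)
Definition computable (c : context) (f : c -> nat) := forall rho r,
  size rho = size (vars c) -> all (fun i => i < r) rho ->
  exists p w T, poly_bounded T /\ forall x L, fits L x ->
    [/\ bitlength (f x) <= T L, 0 < w & forall s, holds rho x s ->
      exists s' t, [/\ exec p s s' t, s' (base (inp x) + r) = f x,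
                       framed (inp x) s s' r w & t <= T L]].

Definition computable_pred (c : context) (b : c -> bool) :=
  computable (fun x => b x : nat).

(** One fixed program serves all inputs, so the first cell after the input has to be computed at run
    time from [n] in cell 0. *)
Definition addr r := Add (Const (2 + r)) (Mul (Fetch (Const 0)) (Fetch (Const 0))).
Definition reg r := Fetch (addr r).

Lemma eval_addr m s r : agree m s -> eval s (addr r) = base m + r.
Proof. by move=> ag /=; rewrite ag // /base; lia. Qed.

Lemma eval_reg m s r : agree m s -> eval s (reg r) = s (base m + r).
Proof. by move=> ag; rewrite -(eval_addr r ag). Qed.

Definition addr_time r L := 2 * L * L + 2 * L + 2 * r + 20.

Lemma poly_addr r : poly_bounded (addr_time r).
Proof. rewrite /addr_time; poly. Qed.

Lemma cost_addr m s r L : agree m s -> m 0 <= L -> eval_cost s (addr r) <= addr_time r L.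
Proof.
move=> ag nL; rewrite /= ag // /addr_time.
have := bitlength_leqS (2 + r + m 0 * m 0); have := bitlength_leqS (2 + r).
have := bitlength_leqS (m 0 * m 0); have := bitlength_leqS (m 0); have := bitlength_leqS 0.
nia.
Qed.

Lemma cost_reg m s r L : agree m s -> m 0 <= L ->
  eval_cost s (reg r) <= bitlength (s (base m + r)) + addr_time r L.
Proof.
move=> ag nL; have := cost_addr r ag nL.
by rewrite -(eval_addr r ag) /=; lia.
Qed.

Lemma exec_reg m s r e : agree m s ->
  exec (Store (addr r) e) s (update s (base m + r) (eval s e))
    (eval_cost s (addr r) + eval_cost s e).+1.
Proof. by move=> ag; rewrite -(eval_addr r ag); apply: exec_store. Qed.

Lemma update_eq s a v : update s a v a = v.
Proof. by rewrite /update eqxx. Qed.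

Lemma update_neq s a v b : b <> a -> update s a v b = s b.
Proof. by rewrite /update; case: eqP. Qed.

Lemma agree_framed m s s' r w : agree m s -> framed m s s' r w -> agree m s'.
Proof. by move=> ag fr a am; rewrite fr ?ag //; apply/orP; left; lia. Qed.

Lemma holds_framed (c : context) rho r w (x : c) s s' :
  size rho = size (vars c) -> all (fun i => i < r) rho ->
  holds rho x s -> framed (inp x) s s' r w -> holds rho x s'.
Proof.
move=> sz lt_r [ag h] fr; split; first exact: agree_framed ag fr.
move=> i ic; rewrite fr ?h //; apply/orP; left; rewrite ltn_add2l.
by apply: (allP lt_r); rewrite mem_nth // sz.
Qed.

Lemma framedW m s s' r w r' w' : framed m s s' r w -> r' <= r -> r + w <= r' + w' ->
  framed m s s' r' w'.
Proof. by move=> fr h1 h2 a ha; apply: fr; lia. Qed.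

Lemma framed_trans m s1 s2 s3 r w :
  framed m s1 s2 r w -> framed m s2 s3 r w -> framed m s1 s3 r w.
Proof. by move=> h1 h2 a ha; rewrite h2 // h1. Qed.

Lemma framed_update m s r v w : 0 < w -> framed m s (update s (base m + r) v) r w.
Proof. by move=> w0 a ha; apply: update_neq; lia. Qed.

Lemma all_ltW (rho : seq nat) r r' : r <= r' ->
  all (fun i => i < r) rho -> all (fun i => i < r') rho.
Proof. by move=> rr'; apply: sub_all => i ir; apply: leq_trans rr'. Qed.

Lemma computable_ext (c : context) (f g : c -> nat) :
  computable f -> f =1 g -> computable g.
Proof.
move=> cf fg rho r sz lt_r; have [p [w [T [pT H]]]] := cf rho r sz lt_r.
by exists p, w, T; split=> // x L okx; rewrite -fg; apply: H.
Qed.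

Lemma computable_store (c : context) (f : c -> nat) :
  (forall rho r, size rho = size (vars c) -> all (fun i => i < r) rho ->
   exists e T, poly_bounded T /\ forall x L, fits L x -> bitlength (f x) <= T L /\
     forall s, holds rho x s -> eval s e = f x /\ eval_cost s e <= T L) ->
  computable f.
Proof.
move=> H rho r sz lt_r; have [e [T [pT He]]] := H rho r sz lt_r.
exists (Store (addr r) e), 1, (fun L => T L + addr_time r L + 1); split.
  by poly; apply: poly_addr.
move=> x L okx; have [b1 He'] := He _ _ okx.
split=> // [|s hx]; first lia; have [b2 b3] := He' s hx; case: hx => ag _.
exists (update s (base (inp x) + r) (f x)), (eval_cost s (addr r) + eval_cost s e).+1.
split; first by rewrite -b2; apply: exec_reg.
- by rewrite update_eq.
- exact: framed_update.
- by case: okx => _ nL _ _; have := cost_addr r ag nL; lia.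
Qed.

Lemma computable_const (c : context) m : computable (fun _ : c => m).
Proof.
apply: computable_store => rho r _ _; exists (Const m), (fun=> bitlength m); split.
  exact: poly_const.
by move=> x L _; split=> // s _ /=; rewrite addn0.
Qed.

Lemma computable_var (c : context) i : i < size (vars c) -> computable (@var c i).
Proof.
move=> ic; apply: computable_store => rho r sz lt_r.
exists (reg (nth 0 rho i)), (fun L => L + addr_time (nth 0 rho i) L); split.
  by poly; apply: poly_addr.
move=> x L [L1 nL iL vL]; split; first by have := vL i ic; lia.
move=> s [ag h]; rewrite (eval_reg _ ag) h //; split=> //.
apply: leq_trans (cost_reg _ ag nL) _.
by rewrite h // leq_add2r; apply: vL.
Qed.

Lemma fits_weak (c : context) L L' (x : c) : L <= L' -> fits L x -> fits L' x.
Proof.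
move=> LL [L1 nL iL vL]; split; try lia.
- by move=> a aM; apply: leq_trans LL; apply: iL.
- by move=> i ic; apply: leq_trans LL; apply: vL.
Qed.

Lemma var_extendS (c : context) i (x : extend c) : i < size (vars c) ->
  var i.+1 x = var i x.1.
Proof. by move=> ic; rewrite /var /= (nth_map (fun=> 0)). Qed.

Lemma fits_extend (c : context) L (x : c) v :
  fits L x -> bitlength v <= L -> @fits (extend c) L (x, v).
Proof.
move=> [L1 nL iL vL] bv; split=> // -[|i] //= ic.
by rewrite var_extendS ?vL; rewrite size_map ltnS in ic.
Qed.

Lemma holds_extend (c : context) rho r (x : c) v s :
  holds rho x s -> s (base (inp x) + r) = v -> @holds (extend c) (r :: rho) (x, v) s.
Proof.
move=> [ag h] hv; split=> // -[|i] //= ic.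
by rewrite var_extendS ?h; rewrite size_map ltnS in ic.
Qed.

(** Renaming costs nothing at run time: the program for [f] is taken for the register list [rho]
    read through [s]. This is why [computable] quantifies over all lists of registers. *)
Lemma computable_rename (c c' : context) (h : c' -> c) (s : seq nat) (f : c -> nat) :
  (forall x, inp (h x) = inp x) -> size s = size (vars c) ->
  all (fun i => i < size (vars c')) s ->
  (forall x i, i < size (vars c) -> var i (h x) = var (nth 0 s i) x) ->
  computable f -> computable (fun x => f (h x)).
Proof.
move=> hi sz lt_s hv cf rho r szr lt_r.
have lt_nth i : i < size s -> nth 0 s i < size (vars c').
  by move=> i_s; apply: (allP lt_s); apply: mem_nth.
have [||p [w [T [pT H]]]] := cf [seq nth 0 rho j | j <- s] r.
- by rewrite size_map.
- apply/allP => _ /mapP[j js ->]; apply: (allP lt_r).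
  by rewrite mem_nth // szr (allP lt_s).
exists p, w, T; split=> // x L okx.
have okh : fits L (h x).
  case: okx => L1 nL iL vL; split; rewrite ?hi // => i ic.
  by rewrite hv // vL // lt_nth // sz.
have [h1 h2 h3] := H _ _ okh; split=> // m [ag hx].
rewrite -!hi; apply: h3; rewrite /holds hi; split=> // i ic.
by rewrite hv // (nth_map 0) ?sz // hx // lt_nth ?sz.
Qed.

Lemma computable_fst (c : context) (f : c -> nat) :
  computable f -> computable (fun x : extend c => f x.1).
Proof.
apply: (@computable_rename c (extend c) fst (iota 1 (size (vars c)))) => //.
- by rewrite size_iota.
- by apply/allP => i; rewrite mem_iota /= size_map; lia.
- by move=> x i ic; rewrite nth_iota // -var_extendS.
Qed.

Lemma computable_skip (c : context) (f : extend c -> nat) :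
  computable f -> computable (fun x : extend (extend c) => f (x.1.1, x.2)).
Proof.
apply: (@computable_rename (extend c) (extend (extend c)) (fun x => (x.1.1, x.2))
  (0 :: iota 2 (size (vars c)))) => //.
- by rewrite /= size_iota size_map.
- by apply/allP => i; rewrite inE mem_iota /= !size_map; lia.
- move=> x [|i] //= ic; rewrite size_map in ic.
  have ic' : i < size (vars c) by lia.
  rewrite nth_iota // !var_extendS //= ?size_map //; lia.
Qed.

Lemma computable_snd (c : context) : computable (fun x : extend c => x.2).
Proof. exact: (@computable_var (extend c) 0). Qed.

(** The value of [f] waits in register [r] while [g] is computed into [r.+1], whose frame leaves [r]
    untouched. *)
Lemma computable_op (c : context) op E (f g : c -> nat) :
  (forall s e1 e2, eval s (E e1 e2) = op (eval s e1) (eval s e2)) ->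
  (forall s e1 e2, eval_cost s (E e1 e2) =
     bitlength (eval s (E e1 e2)) + (eval_cost s e1 + eval_cost s e2)) ->
  (forall v w, bitlength (op v w) <= bitlength v + bitlength w) ->
  computable f -> computable g -> computable (fun x => op (f x) (g x)).
Proof.
move=> ev co bl cf cg rho r sz lt_r.
have [p1 [w1 [T1 [pT1 H1]]]] := cf rho r sz lt_r.
have [p2 [w2 [T2 [pT2 H2]]]] := cg rho r.+1 sz (all_ltW (leqnSn r) lt_r).
exists (Seq p1 (Seq p2 (Store (addr r) (E (reg r) (reg r.+1))))), (w1 + w2.+1).
exists (fun L => 3 * T1 L + 3 * T2 L + 2 * addr_time r L + addr_time r.+1 L + 1).
split; first by poly; apply: poly_addr.
move=> x L okx; have nL : inp x 0 <= L by case: okx.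
have [b1 w10 H1'] := H1 x L okx; have [b2 w20 H2'] := H2 x L okx.
have bb := bl (f x) (g x); split; [lia|lia|move=> s hx].
have [s1 [t1 [e1 v1 fr1 c1]]] := H1' s hx.
have hx1 := holds_framed sz lt_r hx fr1.
have [s2 [t2 [e2 v2 fr2 c2]]] := H2' s1 hx1.
have ag2 : agree (inp x) s2 by apply: agree_framed fr2; case: hx1.
have v12 : s2 (base (inp x) + r) = f x by rewrite fr2 //; apply/orP; left; lia.
exists (update s2 (base (inp x) + r) (op (f x) (g x))).
exists (t1 + (t2 + (eval_cost s2 (addr r) + eval_cost s2 (E (reg r) (reg r.+1))).+1)).
split.
- apply: exec_seq e1 _; apply: exec_seq e2 _.
  by rewrite -v12 -v2 -!(eval_reg _ ag2) -ev; apply: exec_reg.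
- by rewrite update_eq.
- apply: framed_trans (framedW fr1 _ _) _; [lia|lia|].
  apply: framed_trans (framedW fr2 _ _) _; [lia|lia|].
  by apply: framed_update; lia.
- rewrite co ev !(eval_reg _ ag2) v12 v2.
  have := cost_addr r ag2 nL; have := cost_reg r ag2 nL; have := cost_reg r.+1 ag2 nL.
  by rewrite v12 v2; lia.
Qed.

Lemma computableD (c : context) (f g : c -> nat) :
  computable f -> computable g -> computable (fun x => f x + g x).
Proof. by apply: (@computable_op c addn Add) => //; apply: bitlengthD. Qed.

Lemma computableM (c : context) (f g : c -> nat) :
  computable f -> computable g -> computable (fun x => f x * g x).
Proof. by apply: (@computable_op c muln Mul) => //; apply: bitlengthM. Qed.

Lemma computableB (c : context) (f g : c -> nat) :
  computable f -> computable g -> computable (fun x => f x - g x).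
Proof.
move=> cf cg; apply: (@computable_op c subn Defs.Sub f g) => // v w.
by apply: leq_trans (leq_bitlength (leq_subr w v)) _; apply: leq_addr.
Qed.

Lemma computable_div (c : context) (f g : c -> nat) :
  computable f -> computable g -> computable (fun x => f x %/ g x).
Proof.
move=> cf cg; apply: (@computable_op c divn Div f g) => // v w.
by apply: leq_trans (leq_bitlength (leq_div v w)) _; apply: leq_addr.
Qed.

Lemma computable_if (c : context) (b : c -> bool) (f g : c -> nat) :
  computable_pred b -> computable f -> computable g ->
  computable (fun x => if b x then f x else g x).
Proof.
move=> cb cf cg rho r sz lt_r.
have [p0 [w0 [T0 [pT0 H0]]]] := cb rho r sz lt_r.
have [p1 [w1 [T1 [pT1 H1]]]] := cf rho r sz lt_r.
have [p2 [w2 [T2 [pT2 H2]]]] := cg rho r sz lt_r.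
exists (Seq p0 (If (reg r) p1 p2)), (w0 + w1 + w2).
exists (fun L => 2 * T0 L + T1 L + T2 L + addr_time r L).
split; first by poly; apply: poly_addr.
move=> x L okx; have nL : inp x 0 <= L by case: okx.
have [b0 w00 H0'] := H0 x L okx; have [b1 w10 H1'] := H1 x L okx.
have [b2 w20 H2'] := H2 x L okx; split; [by case: (b x); lia|lia|move=> s hx].
have [s1 [t0 [e0 v0 fr0 c0]]] := H0' s hx.
have hx1 := holds_framed sz lt_r hx fr0.
have ag1 : agree (inp x) s1 by case: hx1.
have cr := cost_reg r ag1 nL; rewrite v0 in cr.
have [s2 [t1 [e1 v1 fr1 c1]]] := H1' s1 hx1.
have [s3 [t2 [e2 v2 fr2 c2]]] := H2' s1 hx1.
case bx: (b x) in v0 cr b0 *.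
- exists s2, (t0 + (eval_cost s1 (reg r) + t1)); split=> //; last lia.
  + apply: exec_seq e0 _; apply: exec_if_true e1.
    by rewrite (eval_reg _ ag1) v0.
  + apply: framed_trans (framedW fr0 _ _) (framedW fr1 _ _); lia.
- exists s3, (t0 + (eval_cost s1 (reg r) + t2)); split=> //; last lia.
  + apply: exec_seq e0 _; apply: exec_if_false e2.
    by rewrite (eval_reg _ ag1) v0.
  + apply: framed_trans (framedW fr0 _ _) (framedW fr2 _ _); lia.
Qed.

Lemma computable_order (c : context) : computable (fun x : c => inp x 0).
Proof.
apply: computable_store => rho r _ _; exists (Fetch (Const 0)), (fun L => L + 3).
split; first by poly.
move=> x L [L1 nL iL _]; have b0 := iL 0 isT; split=> [|s [ag _] /=]; first lia.
by rewrite ag //; have := bitlength_leqS 0; split=> //; lia.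
Qed.

(** Cells beyond the input are scratch space during a computation; replacing their content by 0
    makes reading a function of the input alone. *)
Definition read (m : memory) a := if a < base m then m a else 0.

Lemma computable_read (c : context) (f : c -> nat) :
  computable f -> computable (fun x => read (inp x) (f x)).
Proof.
move=> cf rho r sz lt_r.
have [p [w [T [pT H]]]] := cf rho r sz lt_r.
exists (Seq p (If (Defs.Sub (addr 0) (reg r)) (Store (addr r) (Fetch (reg r)))
  (Store (addr r) (Const 0)))), w.
exists (fun L => 4 * T L + 5 * addr_time r L + addr_time 0 L + 3 * (L * L) + L + 20).
split; first by poly; apply: poly_addr.
move=> x L okx; have [L1 nL iL _] := okx; have [b0 w0 H'] := H x L okx.
have bz : bitlength 0 = 1 by [].
split; [|lia|move=> s hx].
  by rewrite /read; case: ltnP => fb; [have := iL _ fb|]; lia.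
have [s1 [t1 [e1 v1 fr1 c1]]] := H' s hx.
have ag1 : agree (inp x) s1 by apply: agree_framed fr1; case: hx.
have cd : eval_cost s1 (Defs.Sub (addr 0) (reg r)) <=
    T L + addr_time 0 L + addr_time r L + (base (inp x)).+1.
  have := cost_addr 0 ag1 nL; have := cost_reg r ag1 nL; rewrite v1 => h1 h2.
  have -> : eval_cost s1 (Defs.Sub (addr 0) (reg r)) =
    bitlength (eval s1 (addr 0) - eval s1 (reg r)) +
    (eval_cost s1 (addr 0) + eval_cost s1 (reg r)) by [].
  rewrite (eval_addr _ ag1) (eval_reg _ ag1) v1 addn0.
  have := bitlength_leqS (base (inp x) - f x); lia.
have bL : base (inp x) <= L * L + 2 by rewrite /base; nia.
have ev : eval s1 (Defs.Sub (addr 0) (reg r)) = base (inp x) - f x.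
  have -> : eval s1 (Defs.Sub (addr 0) (reg r)) =
    eval s1 (addr 0) - eval s1 (reg r) by [].
  by rewrite (eval_addr _ ag1) (eval_reg _ ag1) v1 addn0.
have ca := cost_addr r ag1 nL; have cr := cost_reg r ag1 nL.
rewrite v1 in cr.
rewrite /read; case: ltnP => fb.
- have bf := iL _ fb.
  exists (update s1 (base (inp x) + r) (inp x (f x))); eexists; split.
  + apply: exec_seq e1 _; apply: exec_if_true; first by rewrite ev; lia.
    have := exec_reg r (Fetch (reg r)) ag1.
    have -> : eval s1 (Fetch (reg r)) = s1 (eval s1 (reg r)) by [].
    by rewrite (eval_reg _ ag1) v1 (ag1 _ fb); apply.
  + by rewrite update_eq.
  + by apply: framed_trans fr1 _; apply: framed_update; lia.
  + have -> : eval_cost s1 (Fetch (reg r)) =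
      bitlength (s1 (eval s1 (reg r))) + eval_cost s1 (reg r) by [].
    rewrite (eval_reg _ ag1) v1 ag1 //.
    move: cd ca cr bf c1 bL; move: (eval_cost _ _) (eval_cost _ _) (eval_cost _ _) => u1 u2 u3.
    by move: (L * L); lia.
- exists (update s1 (base (inp x) + r) 0); eexists; split.
  + apply: exec_seq e1 _; apply: exec_if_false; first by rewrite ev; lia.
    exact: exec_reg.
  + by rewrite update_eq.
  + by apply: framed_trans fr1 _; apply: framed_update; lia.
  + have -> : eval_cost s1 (Const 0) = 1 by [].
    move: cd ca c1 bL; move: (eval_cost _ _) (eval_cost _ _) => u1 u2.
    by move: (L * L); lia.
Qed.

(** The accumulator is kept in register [r], the counter in [r.+1], and the body runs from [r.+2]
    on. The last hypothesis does not follow from the others: lengths that grow polynomially in each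
    of [n] rounds need not stay polynomial. *)
Lemma computable_iter (c : context) (init : c -> nat) (body : extend (extend c) -> nat) :
  computable init -> computable body ->
  (exists T, poly_bounded T /\ forall x L, fits L x -> forall j, j <= inp x 0 ->
     bitlength (iteri j (fun i acc => body ((x, i), acc)) (init x)) <= T L) ->
  computable (fun x => iteri (inp x 0) (fun i acc => body ((x, i), acc)) (init x)).
Proof.
move=> ci cb [Tb [pTb Hb]] rho r sz lt_r.
have [p1 [w1 [T1 [pT1 H1]]]] := ci rho r sz lt_r.
have lt_r2 : all (fun i => i < r.+2) (r :: r.+1 :: rho).
  by rewrite /= ltnSn (all_ltW _ lt_r) ?andbT; lia.
have sz2 : size (r :: r.+1 :: rho) = size (vars (extend (extend c))).
  by rewrite /= !size_map sz.
have [p2 [w2 [T2 [pT2 H2]]]] := cb (r :: r.+1 :: rho) r.+2 sz2 lt_r2.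
(* [U L] bounds the data of the body, which include counter and accumulator; [D L] bounds, up to a
   factor, the time of one round. *)
pose U L := L + (Tb L + L + 10).
pose D L := T2 (U L) + Tb L + 4 * addr_time r L + 10 * addr_time r.+1 L
              + addr_time r.+2 L + 10 * L + T1 L + 30.
have pD : poly_bounded D by rewrite /D /U; poly; apply: poly_addr.
exists (Seq p1 (Seq (Store (addr r.+1) (Const 0))
  (While (Defs.Sub (Fetch (Const 0)) (reg r.+1))
     (Seq p2 (Seq (Store (addr r) (reg r.+2))
        (Store (addr r.+1) (Add (reg r.+1) (Const 1)))))))), (w1 + w2 + 3).
exists (fun L => 10 * (L + 1) * D L + 10 * D L); split; first by poly.
move=> x L okx; have [L1 nL iL _] := okx; have [b0 w10 H1'] := H1 x L okx.
pose it j := iteri j (fun i acc => body ((x, i), acc)) (init x).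
split; [|lia|move=> s hx].
  by apply: leq_trans (Hb x L okx (inp x 0) (leqnn _)) _; rewrite /D; lia.
have [s1 [t1 [e1 v1 fr1 c1]]] := H1' s hx.
have hold1 := holds_framed sz lt_r hx fr1.
have test s' j : j <= inp x 0 -> agree (inp x) s' -> s' (base (inp x) + r.+1) = j ->
    eval s' (Defs.Sub (Fetch (Const 0)) (reg r.+1)) = inp x 0 - j /\
    eval_cost s' (Defs.Sub (Fetch (Const 0)) (reg r.+1)) <= 4 * L + 10 + addr_time r.+1 L.
  move=> jn ag' vj.
  have ev0 : eval s' (Defs.Sub (Fetch (Const 0)) (reg r.+1)) = inp x 0 - j.
    have -> : eval s' (Defs.Sub (Fetch (Const 0)) (reg r.+1)) =
      s' 0 - eval s' (reg r.+1) by [].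
    by rewrite (eval_reg _ ag') vj ag'.
  split=> //; have -> : eval_cost s' (Defs.Sub (Fetch (Const 0)) (reg r.+1)) =
    bitlength (eval s' (Defs.Sub (Fetch (Const 0)) (reg r.+1))) +
    (bitlength (s' 0) + bitlength 0 + eval_cost s' (reg r.+1)).
    by rewrite /= addn0.
  rewrite ev0 ag' //; have := cost_reg r.+1 ag' nL; rewrite vj.
  have := bitlength_leqS (inp x 0 - j); have := bitlength_leqS (inp x 0).
  by have := bitlength_leqS j; have := bitlength_leqS 0; lia.
have loop : forall d j s', d + j = inp x 0 -> holds rho x s' ->
    s' (base (inp x) + r) = it j -> s' (base (inp x) + r.+1) = j ->
  exists s'' t, [/\ exec (While (Defs.Sub (Fetch (Const 0)) (reg r.+1))
     (Seq p2 (Seq (Store (addr r) (reg r.+2))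
        (Store (addr r.+1) (Add (reg r.+1) (Const 1)))))) s' s'' t,
     s'' (base (inp x) + r) = it (inp x 0), framed (inp x) s' s'' r (w1 + w2 + 3) &
     t <= (2 * d).+1 * D L].
  elim=> [|d IH] j s' dj hs' va vj; have ag' : agree (inp x) s' by case: hs'.
  - have jn : j = inp x 0 by lia.
    have [ev0 c0] := test s' j (leq_trans (eq_leq jn) (leqnn _)) ag' vj.
    exists s', (eval_cost s' (Defs.Sub (Fetch (Const 0)) (reg r.+1))); split=> //.
    + by apply: exec_while_false; rewrite ev0; lia.
    + by rewrite va jn.
    + by move: c0; rewrite /D; lia.
  - have jn : j <= inp x 0 by lia.
    have fitj : @fits (extend (extend c)) (U L) ((x, j), it j).
      apply: fits_extend; last by rewrite /U; have := Hb x L okx j jn; rewrite /it; lia.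
      apply: fits_extend; last by rewrite /U; have := bitlength_leqS j; lia.
      by apply: fits_weak okx; rewrite /U; lia.
    have holdj : @holds (extend (extend c)) (r :: r.+1 :: rho) ((x, j), it j) s'.
      by apply: holds_extend => //; apply: holds_extend.
    have [bb w20 H2'] := H2 _ _ fitj; have [s2 [t2 [e2 v2 fr2 c2]]] := H2' s' holdj.
    have ag2 : agree (inp x) s2 by apply: agree_framed ag' fr2.
    have vj2 : s2 (base (inp x) + r.+1) = j by rewrite fr2 //; apply/orP; left => /=; lia.
    pose s3 := update s2 (base (inp x) + r) (it j.+1).
    have fr3 : framed (inp x) s' s3 r (w1 + w2 + 3).
      apply: framed_trans (framedW fr2 _ _) _; [lia|lia|].
      by apply: framed_update; lia.
    have ag3 : agree (inp x) s3 by apply: agree_framed fr3.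
    have vj3 : s3 (base (inp x) + r.+1) = j by rewrite /s3 update_neq //; lia.
    pose s4 := update s3 (base (inp x) + r.+1) j.+1.
    have fr4 : framed (inp x) s' s4 r (w1 + w2 + 3).
      by apply: framed_trans fr3 _; move=> a ha; apply: update_neq; lia.
    have va4 : s4 (base (inp x) + r) = it j.+1.
      by rewrite /s4 update_neq ?/s3 ?update_eq //; lia.
    have vj4 : s4 (base (inp x) + r.+1) = j.+1 by rewrite /s4 update_eq.
    have hs4 : holds rho x s4.
      by apply: (holds_framed sz lt_r hs'); apply: fr4.
    have dj' : d + j.+1 = inp x 0 by lia.
    have [s5 [t5 [e5 v5 fr5 c5]]] := IH j.+1 s4 dj' hs4 va4 vj4.
    have [ev0 c0] := test s' j jn ag' vj.
    exists s5; eexists; split.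
    + apply: exec_while_true e5; first by rewrite ev0; lia.
      apply: exec_seq e2 _; apply: exec_seq.
        by have := exec_reg r (reg r.+2) ag2; rewrite (eval_reg _ ag2) v2; apply.
      have := exec_reg r.+1 (Add (reg r.+1) (Const 1)) ag3.
      have -> : eval s3 (Add (reg r.+1) (Const 1)) = j.+1.
        have -> : eval s3 (Add (reg r.+1) (Const 1)) = eval s3 (reg r.+1) + 1 by [].
        by rewrite (eval_reg _ ag3) vj3 addn1.
      by apply.
    + by [].
    + by apply: framed_trans fr4 fr5.
    + have -> : eval_cost s3 (Add (reg r.+1) (Const 1)) =
        bitlength (eval s3 (reg r.+1) + 1) + (eval_cost s3 (reg r.+1) + bitlength 1).
        by rewrite /= addn0.
      rewrite (eval_reg _ ag3) vj3.
      have := cost_addr r ag2 nL; have := cost_reg r.+2 ag2 nL; rewrite v2.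
      have := cost_addr r.+1 ag3 nL; have := cost_reg r.+1 ag3 nL; rewrite vj3.
      have := bitlength_leqS (j + 1); have := bitlength_leqS j; have := bitlength_leqS 1.
      have -> : (2 * d.+1).+1 * D L = (2 * d).+1 * D L + 2 * D L by nia.
      move: c5 c0 c2 bb; rewrite /D; lia.
have c2 : exists t2, exec (Store (addr r.+1) (Const 0)) s1
    (update s1 (base (inp x) + r.+1) 0) t2 /\ t2 <= D L.
  have ag1 : agree (inp x) s1 by case: hold1.
  eexists; split; first by apply: (exec_reg _ (Const 0) ag1).
  have := cost_addr r.+1 ag1 nL; rewrite /D.
  have -> : eval_cost s1 (Const 0) = 1 by []; lia.
have [t2 [e2 c2']] := c2.
pose s2 := update s1 (base (inp x) + r.+1) 0.
have fr2 : framed (inp x) s s2 r (w1 + w2 + 3).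
  apply: framed_trans (framedW fr1 _ _) _; [lia|lia|].
  by move=> a ha; apply: update_neq; lia.
have [||s3 [t3 [e3 v3 fr3 c3]]] := loop (inp x 0) 0 s2 (addn0 _) (holds_framed sz lt_r hx fr2).
- by rewrite /s2 update_neq ?v1 //; lia.
- by rewrite /s2 update_eq.
exists s3, (t1 + (t2 + t3)); split=> //.
- by apply: exec_seq e1 _; apply: exec_seq e2 e3.
- by apply: framed_trans fr2 fr3.
- have : T1 L <= D L by rewrite /D; lia.
  nia.
Qed.

Lemma computable_sum (c : context) (F : extend c -> nat) :
  computable F -> computable (fun x => \sum_(i < inp x 0) F (x, i : nat)).
Proof.
move=> cF.
pose body (y : extend (extend c)) := y.2 + F y.1.
have cb : computable body.
  by apply: computableD; [apply: computable_snd|apply: computable_fst].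
have E x n : \sum_(i < n) F (x, i : nat) = iteri n (fun i acc => body ((x, i), acc)) 0.
  by elim: n => [|n IH]; rewrite ?big_ord0 // big_ord_recr /= IH.
suff ci : computable (fun x : c => iteri (inp x 0) (fun i acc => body ((x, i), acc)) 0).
  by apply: computable_ext ci _ => x; rewrite E.
apply: (@computable_iter c (fun=> 0)) => //; first exact: computable_const.
(* The length of the values of [F] is bounded only inside [computable F]; an arbitrary choice of
   registers gives access to that bound. *)
have rho_ok : exists rho r, size rho = size (vars (extend c)) /\ all (fun i => i < r) rho.
  exists (nseq (size (vars (extend c))) 0), 1; rewrite size_nseq; split=> //.
  by apply/allP => i /nseqP[->].
have [rho [r [sz lt_r]]] := rho_ok.
have [p [w [T [pT H]]]] := cF rho r sz lt_r.
exists (fun L => L + T (L + (L + 1)) + 1); split; first by poly.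
move=> x L okx j jn; rewrite -E; have [L1 nL _ _] := okx.
have bF i : i < j -> bitlength (F (x, i)) <= T (L + (L + 1)).
  move=> ij; have fi : @fits (extend c) (L + (L + 1)) (x, i).
    apply: fits_extend; first by apply: fits_weak okx; lia.
    by have := bitlength_leqS i; lia.
  by have [] := H (x, i) _ fi.
have : \sum_(i < j) F (x, i : nat) <= j * 2 ^ T (L + (L + 1)).
  have <- : \sum_(i < j) 2 ^ T (L + (L + 1)) = j * 2 ^ T (L + (L + 1)).
    by rewrite sum_nat_const card_ord.
  apply: leq_sum => i _; apply/ltnW/(leq_trans (ltn_bitlength _)).
  by rewrite leq_exp2l // bF.
move=> le_s; apply: bitlength_leq; first lia.
apply: leq_ltn_trans le_s _; rewrite addnAC expnD.
rewrite ltn_pmul2r ?expn_gt0 //; apply: leq_trans (ltn_expl j (ltnSn 1)) _.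
by rewrite leq_exp2l //; lia.
Qed.

Section Connectives.
Variable c : context.
Implicit Types (f g : c -> nat) (a b : c -> bool).

Lemma computable_pred_ext f b :
  computable f -> (forall x, f x = b x) -> computable_pred b.
Proof. exact: computable_ext. Qed.

Lemma computable_leq f g : computable f -> computable g ->
  computable_pred (fun x => f x <= g x).
Proof.
(* With truncated subtraction, [1 - (f - g)] is the truth value of [f <= g]. *)
move=> cf cg; apply: (computable_pred_ext (computableB (@computable_const c 1) (computableB cf cg))).
by move=> x; case: (leqP (f x)); lia.
Qed.

Lemma computable_ltn f g : computable f -> computable g ->
  computable_pred (fun x => f x < g x).
Proof. by move=> cf cg; apply: computable_leq => //; apply: (computableD (@computable_const c 1)). Qed.

Lemma computable_not b : computable_pred b -> computable_pred (fun x => ~~ b x).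
Proof.
move=> cb; apply: (computable_pred_ext (computableB (@computable_const c 1) cb)).
by move=> x; case: (b x).
Qed.

Lemma computable_and a b : computable_pred a -> computable_pred b ->
  computable_pred (fun x => a x && b x).
Proof. by move=> ca cb; apply: (computable_pred_ext (computableM ca cb)) => x; rewrite mulnb. Qed.

Lemma computable_or a b : computable_pred a -> computable_pred b ->
  computable_pred (fun x => a x || b x).
Proof.
move=> ca cb; apply: (computable_pred_ext (computable_not (computable_and (computable_not ca) (computable_not cb)))) => x.
by rewrite negb_and !negbK.
Qed.

Lemma computable_eqn f g : computable f -> computable g ->
  computable_pred (fun x => f x == g x).
Proof.
move=> cf cg; apply: (computable_pred_ext (computable_and (computable_leq cf cg) (computable_leq cg cf))).
by move=> x; rewrite eqn_leq.
Qed.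

Lemma computable_addb a b : computable_pred a -> computable_pred b ->
  computable_pred (fun x => a x (+) b x).
Proof.
move=> ca cb; apply: (computable_pred_ext (computable_not (computable_eqn ca cb))) => x.
by case: (a x) (b x) => [] [].
Qed.

Lemma computable_eqb a b : computable_pred a -> computable_pred b ->
  computable_pred (fun x => a x == b x).
Proof.
by move=> ca cb; apply: (computable_pred_ext (computable_eqn ca cb)) => x; case: (a x) (b x) => [] [].
Qed.

Lemma computable_pred_if a b1 b2 : computable_pred a -> computable_pred b1 ->
  computable_pred b2 -> computable_pred (fun x => if a x then b1 x else b2 x).
Proof.
by move=> ca c1 c2; apply: (computable_pred_ext (computable_if ca c1 c2)) => x; case: (a x).
Qed.

Lemma computable_odd f : computable f -> computable_pred (fun x => odd (f x)).
Proof.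
move=> cf; pose h x := f x %/ 2.
have ch : computable h by apply: computable_div => //; apply: computable_const.
apply: (computable_pred_ext (computableB cf (computableM ch (@computable_const c 2)))) => x.
by rewrite /h divn2 muln2 -{1}(odd_double_half (f x)) addnK.
Qed.

End Connectives.

(** * Bounded comprehension on bit masks *)

(** Capping the exponent at [n] keeps the value short for every argument, so that it is computable
    in polynomial time without a side condition on [i]. *)
Definition pow2 n i := 2 ^ minn i n.
Definition bit n x i := odd (x %/ pow2 n i).
Definition counting n (P : nat -> bool) := \sum_(i < n) P i.
Definition exists_lt n (P : nat -> bool) := 0 < counting n P.
Definition mask n (P : nat -> bool) := \sum_(i < n) P i * pow2 n i.
(** The indices counted are those before the first element of [P]; the result is [n] if [P] has no
    element below [n]. *)
Definition first n (P : nat -> bool) := counting n (fun i => ~~ exists_lt n (fun j => (j <= i) && P j)).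

Lemma ltn_mask n P : mask n P < 2 ^ n.
Proof.
have H m : m <= n -> \sum_(i < m) P i * pow2 n i < 2 ^ m.
  elim: m => [|m IH] mn; first by rewrite big_ord0 expn_gt0.
  have e : pow2 n m = 2 ^ m by rewrite /pow2 (minn_idPl (ltnW mn)).
  rewrite big_ord_recr /= expnS e.
  move: {IH}(IH (ltnW mn)); move: (\sum_(i < m) _) (2 ^ m) => u v.
  by case: (P m); rewrite ?mul1n ?mul0n; lia.
exact: H.
Qed.

Lemma bit_mask n P i : i < n -> bit n (mask n P) i = P i.
Proof.
move=> ni; rewrite /bit /mask.
have -> : \sum_(j < n) P j * pow2 n j = \sum_(0 <= j < n) P j * pow2 n j.
  by rewrite big_mkord.
rewrite (@big_cat_nat _ _ _ i) //=; last exact: ltnW.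
rewrite [X in _ + X]big_ltn //=.
have -> : pow2 n i = 2 ^ i by rewrite /pow2 (minn_idPl (ltnW ni)).
(* The bits below [i] add up to less than [2 ^ i], those above to a multiple of [2 ^ i.+1]; dividing
   by [2 ^ i] and taking the parity isolates bit [i]. *)
set l := \sum_(0 <= j < i) _; set h := \sum_(i.+1 <= j < n) _.
have lt_l : l < 2 ^ i.
  rewrite /l big_mkord; apply: leq_ltn_trans (ltn_mask i P).
  apply/eq_leq/eq_bigr => j _; have ji := ltn_ord j.
  by rewrite /pow2 !(minn_idPl _) //; lia.
have [q ->] : exists q, h = q * 2 ^ i.+1.
  exists (\sum_(i.+1 <= j < n) P j * 2 ^ (j - i.+1)).
  rewrite /h big_distrl /= !big_nat; apply: eq_bigr => j /andP[ij jn].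
  by rewrite -mulnA -expnD subnK // /pow2 (minn_idPl (ltnW jn)).
have -> : l + (P i * 2 ^ i + q * 2 ^ i.+1) = (P i + q * 2) * 2 ^ i + l.
  by rewrite expnS; nia.
rewrite divnMDl ?expn_gt0 // divn_small // addn0 oddD oddM andbF addbF.
by case: (P i).
Qed.

Lemma exists_ltE n (P : nat -> bool) : exists_lt n P = [exists i : 'I_n, P i].
Proof.
rewrite /exists_lt /counting lt0n sum_nat_eq0 negb_forall; apply: eq_existsb => i.
by case: (P i).
Qed.

Lemma countingE n (P : nat -> bool) : counting n P = #|[set i : 'I_n | P i]|.
Proof.
rewrite /counting -sum1_card big_mkcond /= [RHS]big_mkcond; apply: eq_bigr => i _.
by rewrite inE; case: (P i).
Qed.

Section Comprehension.
Variable c : context.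

Lemma computable_iteri (n : c -> nat) (init : c -> nat) (body : c -> nat -> nat -> nat) :
  (forall x, n x = inp x 0) -> computable init ->
  computable (fun z : extend (extend c) => body z.1.1 z.1.2 z.2) ->
  (exists T, poly_bounded T /\ forall (x : c) L, fits L x -> forall j, j <= inp x 0 ->
     bitlength (iteri j (body x) (init x)) <= T L) ->
  computable (fun x => iteri (n x) (body x) (init x)).
Proof.
by move=> nE ci cb H; apply: (computable_ext (computable_iter ci cb H)) => x; rewrite nE.
Qed.

Lemma computable_counting (P : c -> nat -> bool) :
  computable_pred (fun y : extend c => P y.1 y.2) ->
  computable (fun x => counting (inp x 0) (P x)).
Proof. exact: computable_sum. Qed.

Lemma computable_exists (P : c -> nat -> bool) :
  computable_pred (fun y : extend c => P y.1 y.2) ->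
  computable_pred (fun x => exists_lt (inp x 0) (P x)).
Proof.
by move=> cP; apply: computable_ltn; [apply: computable_const|apply: computable_counting].
Qed.

Lemma computable_pow2 f : computable f -> computable (fun x : c => pow2 (inp x 0) (f x)).
Proof.
move=> cf; pose body (x : c) j acc := if j < f x then acc * 2 else acc.
have E x n : iteri n (body x) 1 = 2 ^ minn (f x) n.
  elim: n => [|n /= ->]; first by rewrite minn0.
  rewrite /body; case: ltnP => h; last by rewrite !(minn_idPl _) //; lia.
  by rewrite !(minn_idPr _) ?expnSr //; lia.
suff ci : computable (fun x : c => iteri (inp x 0) (body x) 1).
  by apply: (computable_ext ci) => x; rewrite E.
apply: (@computable_iteri _ (fun=> 1)) => //; first exact: computable_const.
  apply: computable_if.
  - apply: computable_ltn; first exact: (computable_fst (@computable_snd c)).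
    exact: (computable_fst (computable_fst cf)).
  - by apply: computableM; [apply: computable_snd|apply: computable_const].
  - exact: computable_snd.
exists (fun L => L + 1); split; first by poly.
move=> x L [L1 nL _ _] j jn; rewrite E; apply: bitlength_leq; first lia.
by rewrite ltn_exp2l //; have := geq_minr (f x) j; lia.
Qed.

Lemma computable_bit f g : computable f -> computable g ->
  computable_pred (fun x : c => bit (inp x 0) (f x) (g x)).
Proof.
by move=> cf cg; apply/computable_odd/computable_div => //; apply: computable_pow2.
Qed.

End Comprehension.

Lemma computable_mask (c : context) (P : c -> nat -> bool) :
  computable_pred (fun y : extend c => P y.1 y.2) ->
  computable (fun x => mask (inp x 0) (P x)).
Proof.
move=> cP; apply: (@computable_sum c (fun y => P y.1 y.2 * pow2 (inp y 0) y.2)).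
by apply: computableM => //; apply: computable_pow2; apply: computable_snd.
Qed.

Lemma computable_first (c : context) (P : c -> nat -> bool) :
  computable_pred (fun y : extend c => P y.1 y.2) ->
  computable (fun x => first (inp x 0) (P x)).
Proof.
move=> cP; apply: computable_counting; apply: computable_not.
apply: (@computable_exists (extend c) (fun y j => (j <= y.2) && P y.1 j)).
apply: computable_and; last exact: (computable_skip cP).
by apply: computable_leq; [apply: computable_snd|apply/computable_fst/computable_snd].
Qed.

(** * Search in an implicitly given graph *)

Inductive reachable (start : nat) (next : nat -> nat -> nat) (choices : nat) : nat -> Prop :=
| reachable_start : reachable start next choices start
| reachable_next v c : c < choices -> reachable start next choices v ->
    reachable start next choices (next v c).

Definition input_context : context := @Context memory id [::].

Lemma bitlength_leq_cost s e : bitlength (eval s e) <= eval_cost s e.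
Proof. by case: e => *; rewrite /= leq_addr. Qed.

Lemma cost_add s e1 e2 B1 B2 : eval_cost s e1 <= B1 -> eval_cost s e2 <= B2 ->
  eval_cost s (Add e1 e2) <= 2 * (B1 + B2).
Proof.
have := bitlengthD (eval s e1) (eval s e2).
have := bitlength_leq_cost s e1; have := bitlength_leq_cost s e2; move=> /=; lia.
Qed.

Lemma cost_mul s e1 e2 B1 B2 : eval_cost s e1 <= B1 -> eval_cost s e2 <= B2 ->
  eval_cost s (Mul e1 e2) <= 2 * (B1 + B2).
Proof.
have := bitlengthM (eval s e1) (eval s e2).
have := bitlength_leq_cost s e1; have := bitlength_leq_cost s e2; move=> /=; lia.
Qed.

Lemma cost_sub s e1 e2 B1 B2 : eval_cost s e1 <= B1 -> eval_cost s e2 <= B2 ->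
  eval_cost s (Defs.Sub e1 e2) <= 2 * (B1 + B2).
Proof.
have := leq_bitlength (leq_subr (eval s e2) (eval s e1)).
have := bitlength_leq_cost s e1; move=> /=; lia.
Qed.

Section Search.
Variable W : nat.
Hypothesis W5 : 5 < W.

Definition queue_addr e := Add (addr W) (Mul (Const 2) e).
Definition mark_addr e := Add (addr W.+1) (Mul (Const 2) e).

Definition search_step next :=
  Seq next
    (Seq (If (Fetch (mark_addr (reg 5))) Skip
       (Seq (Store (mark_addr (reg 5)) (Const 1))
          (Seq (Store (queue_addr (reg 1)) (reg 5))
             (Store (addr 1) (Add (reg 1) (Const 1))))))
    (Store (addr 4) (Add (reg 4) (Const 1)))).

(** The bound [n + 3] leaves room for three fixed choices and one for each vertex. *)
Definition expand next :=
  While (Defs.Sub (Add (Fetch (Const 0)) (Const 3)) (reg 4)) (search_step next).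

Definition visit goal next :=
  Seq (Store (addr 3) (Fetch (queue_addr (reg 0))))
    (Seq (Store (addr 0) (Add (reg 0) (Const 1)))
    (Seq goal
    (Seq (If (reg 5) (Store (addr 2) (Const 1)) Skip)
    (Seq (Store (addr 4) (Const 0)) (expand next))))).

Definition search start goal next :=
  Seq start
    (Seq (Store (mark_addr (reg 5)) (Const 1))
    (Seq (Store (queue_addr (Const 0)) (reg 5))
    (Seq (Store (addr 1) (Const 1))
    (Seq (While (Defs.Sub (reg 1) (reg 0)) (visit goal next))
       (Store (Const 0) (reg 2)))))).

Variable m : memory.

(* Registers 0 to 4 hold the number of expanded queue entries, the length of the
   queue, the answer, the state under expansion and the current choice; queue
   entries and marks of visited states alternate from register [W] on. *)
Record represents (s : memory) (Q : seq nat) h (found : bool) v c := Represents {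
  rep_agree : agree m s;
  rep_head : s (base m + 0) = h;
  rep_tail : s (base m + 1) = size Q;
  rep_found : s (base m + 2) = found;
  rep_state : s (base m + 3) = v;
  rep_choice : s (base m + 4) = c;
  rep_queue : forall i, i < size Q -> s (base m + W + 2 * i) = nth 0 Q i;
  rep_mark : forall u, s (base m + W + 2 * u + 1) = (u \in Q) }.

Lemma represents_framed s s' Q h found v c w : represents s Q h found v c ->
  framed m s s' 5 w -> 5 + w <= W -> represents s' Q h found v c.
Proof.
move=> [a b d e f g q k] fr wW; split; rewrite ?fr //; try by apply/orP; left; lia.
- exact: agree_framed a fr.
- by move=> i iQ; rewrite fr ?q //; apply/orP; right; lia.
- by move=> u; rewrite fr ?k //; apply/orP; right; lia.
Qed.

Lemma represents_update s Q h found v c r x h' (found' : bool) v' c' :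
  represents s Q h found v c -> r <= 4 ->
  update s (base m + r) x (base m + 0) = h' ->
  update s (base m + r) x (base m + 1) = size Q ->
  update s (base m + r) x (base m + 2) = found' :> nat ->
  update s (base m + r) x (base m + 3) = v' ->
  update s (base m + r) x (base m + 4) = c' ->
  represents (update s (base m + r) x) Q h' found' v' c'.
Proof.
move=> [ag _ _ _ _ _ sq sk] r4 *; split=> //.
- by move=> a am; rewrite update_neq ?ag //; lia.
- by move=> i iQ; rewrite update_neq ?sq //; lia.
- by move=> u; rewrite update_neq ?sk //; lia.
Qed.

Variables (L N : nat).
Hypotheses (L1 : 1 < L) (nL : m 0 <= L) (NL : bitlength N.+1 <= L).

Definition step_time (W L : nat) := 1000 * (L + addr_time (W + 5) L + 10).

Lemma cost_addrW s r : agree m s -> r <= W + 5 -> eval_cost s (addr r) <= addr_time (W + 5) L.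
Proof.
move=> ag rW; apply: leq_trans (cost_addr r ag nL) _.
by rewrite /addr_time; lia.
Qed.

Lemma cost_regW s r v : agree m s -> r <= W + 5 -> s (base m + r) = v -> bitlength v <= L + 4 ->
  eval_cost s (reg r) <= L + 4 + addr_time (W + 5) L.
Proof.
move=> ag rW sv vL; have -> : eval_cost s (reg r) =
  bitlength (s (eval s (addr r))) + eval_cost s (addr r) by [].
by rewrite (eval_addr _ ag) sv; apply: leq_add => //; apply: cost_addrW.
Qed.

Lemma cost_small s v : v <= 3 -> eval_cost s (Const v) <= 3.
Proof. by move: v => [|[|[|[|]]]]. Qed.

Lemma eval_queue_addr s e : agree m s -> eval s (queue_addr e) = base m + W + 2 * eval s e.
Proof.
move=> ag; have -> : eval s (queue_addr e) = eval s (addr W) + 2 * eval s e by [].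
by rewrite (eval_addr _ ag).
Qed.

Lemma eval_mark_addr s e : agree m s -> eval s (mark_addr e) = base m + W + 2 * eval s e + 1.
Proof.
move=> ag; have -> : eval s (mark_addr e) = eval s (addr W.+1) + 2 * eval s e by [].
by rewrite (eval_addr _ ag); lia.
Qed.

Lemma cost_queue_addr s e : agree m s ->
  eval_cost s (queue_addr e) <= 2 * (addr_time (W + 5) L + 2 * (3 + eval_cost s e)).
Proof.
move=> ag; apply: cost_add; first by apply: cost_addrW => //; lia.
by apply: cost_mul => //; apply: cost_small.
Qed.

Lemma cost_mark_addr s e : agree m s ->
  eval_cost s (mark_addr e) <= 2 * (addr_time (W + 5) L + 2 * (3 + eval_cost s e)).
Proof.
move=> ag; apply: cost_add; first by apply: cost_addrW => //; lia.
by apply: cost_mul => //; apply: cost_small.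
Qed.

Lemma eval_incr s r : agree m s -> eval s (Add (reg r) (Const 1)) = (s (base m + r)).+1.
Proof.
move=> ag; have -> : eval s (Add (reg r) (Const 1)) = eval s (reg r) + 1 by [].
by rewrite (eval_reg _ ag) addn1.
Qed.

Lemma cost_incr s r v : agree m s -> r <= W + 5 -> s (base m + r) = v -> bitlength v <= L + 4 ->
  eval_cost s (Add (reg r) (Const 1)) <= 2 * (L + 4 + addr_time (W + 5) L + 3).
Proof.
by move=> ag rW sv vL; apply: cost_add; [apply: cost_regW sv vL|apply: cost_small].
Qed.

Lemma bitlength_N v : v <= N.+1 -> bitlength v <= L.
Proof. by move=> vN; apply: leq_trans (leq_bitlength vN) NL. Qed.

Section Step.
Variables (next : nat -> nat -> nat) (pnext : program) (w T : nat).
Hypothesis wW : 5 + w <= W.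
Variable good : nat -> Prop.
Hypothesis good_bits : forall v, good v -> bitlength v <= L.
Hypothesis good_next : forall v c, c < m 0 + 3 -> good v -> good (next v c).
Hypothesis good_bound : forall Q : seq nat, uniq Q -> (forall v, v \in Q -> good v) -> size Q <= N.
Hypothesis pnextP : forall s v c, agree m s -> s (base m + 3) = v -> s (base m + 4) = c ->
  good v -> c < m 0 + 3 ->
  exists s' t, [/\ exec pnext s s' t, s' (base m + 5) = next v c,
                   framed m s s' 5 w & t <= T].

Definition add_new (Q : seq nat) v := if v \in Q then Q else rcons Q v.

Lemma add_new_uniq Q v : uniq Q -> uniq (add_new Q v).
Proof. by rewrite /add_new; case: ifP => // vQ uQ; rewrite rcons_uniq vQ. Qed.

Lemma mem_add_new Q v u : (u \in add_new Q v) = (u == v) || (u \in Q).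
Proof.
rewrite /add_new; case: ifP => vQ; rewrite ?mem_rcons ?inE //.
by case: eqP => // ->.
Qed.

Lemma add_new_prefix Q v : exists Q', add_new Q v = Q ++ Q'.
Proof.
rewrite /add_new; case: ifP => _; first by exists [::]; rewrite cats0.
by exists [:: v]; rewrite cats1.
Qed.

Lemma search_stepP s Q h found v c :
  represents s Q h found v c -> good v -> c < m 0 + 3 ->
  uniq Q -> (forall u, u \in Q -> good u) ->
  exists s' t, [/\ exec (search_step pnext) s s' t,
    represents s' (add_new Q (next v c)) h found v c.+1 & t <= T + step_time W L].
Proof.
move=> rs gv cn uQ gQ; case: (rs) => ag _ _ _ sv sc _ _.
have [s1 [t1 [e1 v1 fr1 c1]]] := pnextP ag sv sc gv cn.
have rs1 := represents_framed rs fr1 wW; case: (rs1) => ag1 h1 l1 f1 sv1 sc1 q1 k1.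
set u := next v c in v1 *; have gu : good u by apply: good_next.
have gQ' x : x \in add_new Q u -> good x.
  by rewrite mem_add_new => /orP[/eqP->|/gQ].
have sQ' := good_bound (add_new_uniq u uQ) gQ'.
have cN : bitlength c <= L + 4 by have := bitlength_leqS c; lia.
have uL : bitlength u <= L + 4 by have := good_bits gu; lia.
have c5 : eval_cost s1 (reg 5) <= L + 4 + addr_time (W + 5) L by apply: cost_regW v1 uL => //; lia.
have cm := cost_mark_addr (reg 5) ag1.
have em : eval s1 (mark_addr (reg 5)) = base m + W + 2 * u + 1.
  by rewrite eval_mark_addr // (eval_reg _ ag1) v1.
have cf : eval_cost s1 (Fetch (mark_addr (reg 5))) <= 1 + eval_cost s1 (mark_addr (reg 5)).
  have -> : eval_cost s1 (Fetch (mark_addr (reg 5))) =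
    bitlength (s1 (eval s1 (mark_addr (reg 5)))) + eval_cost s1 (mark_addr (reg 5)) by [].
  by rewrite em k1 leq_add2r; case: (_ \in _).
have ef : eval s1 (Fetch (mark_addr (reg 5))) = (u \in Q).
  have -> : eval s1 (Fetch (mark_addr (reg 5))) = s1 (eval s1 (mark_addr (reg 5))) by [].
  by rewrite em k1.
suff [s2 [t2 [e2 rs2 c2]]] : exists s2 t2,
  [/\ exec (If (Fetch (mark_addr (reg 5))) Skip
       (Seq (Store (mark_addr (reg 5)) (Const 1))
          (Seq (Store (queue_addr (reg 1)) (reg 5))
             (Store (addr 1) (Add (reg 1) (Const 1)))))) s1 s2 t2,
     represents s2 (add_new Q u) h found v c
   & t2 <= 100 * (L + addr_time (W + 5) L + 10)].
  case: (rs2) => ag2 h2 l2 f2 sv2 sc2 q2 k2.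
  have E := exec_reg 4 (Add (reg 4) (Const 1)) ag2; rewrite eval_incr // sc2 in E.
  exists (update s2 (base m + 4) c.+1); eexists; split.
  - by apply: exec_seq e1 _; apply: exec_seq e2 E.
  - by apply: represents_update rs2 _ _ _ _ _ _; rewrite ?update_eq // update_neq //; lia.
  - have := cost_addrW ag2 (_ : 4 <= W + 5); have := cost_incr ag2 _ sc2 cN.
    move=> /(_ _) H1 /(_ _) H2; rewrite /step_time.
    have := H1 ltac:(lia); have := H2 ltac:(lia); lia.
rewrite /add_new in sQ' *; case: ifP => uQ1; rewrite uQ1 in ef sQ'.
  exists s1, (eval_cost s1 (Fetch (mark_addr (reg 5))) + 1); split=> //; last lia.
  by apply: exec_if_true; [rewrite ef|apply: exec_skip].
have lN : size Q <= N by apply: ltnW; rewrite -(size_rcons Q u).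
have lL : bitlength (size Q) <= L + 4 by have := bitlength_N (leqW lN); lia.
pose s2 := update s1 (base m + W + 2 * u + 1) 1.
have ag2 : agree m s2 by move=> a am; rewrite /s2 update_neq ?ag1 //; lia.
have l2 : s2 (base m + 1) = size Q by rewrite /s2 update_neq ?l1 //; lia.
have v2 : s2 (base m + 5) = u by rewrite /s2 update_neq ?v1 //; lia.
pose s3 := update s2 (base m + W + 2 * size Q) u.
have ag3 : agree m s3 by move=> a am; rewrite /s3 update_neq ?ag2 //; lia.
have l3 : s3 (base m + 1) = size Q by rewrite /s3 update_neq ?l2 //; lia.
pose s4 := update s3 (base m + 1) (size Q).+1.
exists s4; eexists; split.
- apply: exec_if_false => //; apply: exec_seq.
    by have := exec_store s1 (mark_addr (reg 5)) (Const 1); rewrite em; apply.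
  apply: exec_seq.
    have := exec_store s2 (queue_addr (reg 1)) (reg 5).
    by rewrite eval_queue_addr // !(eval_reg _ ag2) l2 v2; apply.
  by have := exec_reg 1 (Add (reg 1) (Const 1)) ag3; rewrite eval_incr // l3; apply.
- have s4E a : a <> base m + W + 2 * u + 1 -> a <> base m + W + 2 * size Q ->
    a <> base m + 1 -> s4 a = s1 a by move=> *; rewrite /s4 /s3 /s2 !update_neq.
  split; try (by rewrite s4E //; lia).
  + by move=> a am; rewrite s4E ?ag1 //; lia.
  + by rewrite /s4 update_eq size_rcons.
  + move=> i; rewrite size_rcons ltnS nth_rcons leq_eqVlt => /orP[/eqP->|iQ].
      by rewrite ltnn eqxx /s4 /s3 update_neq ?update_eq //; lia.
    by rewrite iQ s4E ?q1 //; lia.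
  + move=> x; rewrite mem_rcons inE; case: (x =P u) => [->|xu].
      by rewrite /s4 /s3 update_neq ?update_neq /s2 ?update_eq //; lia.
    by rewrite s4E ?k1 //; lia.
- have l2L := cost_regW ag2 (_ : 1 <= W + 5) l2 lL.
  have := cost_queue_addr (reg 1) ag2; have := cost_regW ag2 (_ : 5 <= W + 5) v2 uL.
  have := cost_addrW ag3 (_ : 1 <= W + 5); have := cost_incr ag3 (_ : 1 <= W + 5) l3 lL.
  have := l2L ltac:(lia) => {}l2L H1 H2 H3 H4.
  have := H1 ltac:(lia); have := H2 ltac:(lia); have := H3 ltac:(lia).
  have := cost_small s1 (isT : 1 <= 3); lia.
Qed.

(** The queue grows only at its end, so indices of entries stay valid; hence the form [Q ++ Q'] of
    the result. *)
Lemma expandP d s Q h found v j : d + j = m 0 + 3 ->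
  represents s Q h found v j -> good v -> uniq Q -> (forall u, u \in Q -> good u) ->
  exists s' t Q', [/\ exec (expand pnext) s s' t,
    represents s' (Q ++ Q') h found v (m 0 + 3),
    uniq (Q ++ Q') /\ (forall u, u \in Q ++ Q' -> good u),
    forall c, j <= c < m 0 + 3 -> next v c \in Q ++ Q'
  & t <= d * (T + 2 * step_time W L) + step_time W L].
Proof.
have test x : agree m x -> forall i, x (base m + 4) = i -> i <= m 0 + 3 ->
    eval x (Defs.Sub (Add (Fetch (Const 0)) (Const 3)) (reg 4)) = m 0 + 3 - i /\
    eval_cost x (Defs.Sub (Add (Fetch (Const 0)) (Const 3)) (reg 4)) <= step_time W L.
  move=> ag i xi im; have iL : bitlength i <= L + 4 by have := bitlength_leqS i; lia.
  split.
    have -> : eval x (Defs.Sub (Add (Fetch (Const 0)) (Const 3)) (reg 4)) =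
      x 0 + 3 - eval x (reg 4) by [].
    by rewrite (eval_reg _ ag) xi ag.
  have c4 := cost_regW ag (_ : 4 <= W + 5) xi iL; have {}c4 := c4 ltac:(lia).
  have cf : eval_cost x (Fetch (Const 0)) <= L + 4.
    by rewrite /= ag //; have := bitlength_leqS (m 0); have := bitlength_leqS 0; lia.
  by have := cost_sub (cost_add cf (cost_small x (leqnn 3))) c4; rewrite /step_time; lia.
elim: d s Q j => [|d IH] s Q j dj rs gv uQ gQ; case: (rs) => ag _ _ _ sv sc _ _.
- have [ev co] := test s ag j sc (eq_leq dj).
  exists s, (eval_cost s (Defs.Sub (Add (Fetch (Const 0)) (Const 3)) (reg 4))), [::].
  have jE : j = m 0 + 3 by lia.
  rewrite cats0; split=> //; last lia.
  + by apply: exec_while_false; rewrite ev; lia.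
  + by rewrite -jE.
- have jm : j < m 0 + 3 by lia.
  have [ev co] := test s ag j sc (ltnW jm).
  have [s1 [t1 [e1 rs1 c1]]] := search_stepP rs gv jm uQ gQ.
  have uQ1 := add_new_uniq (next v j) uQ.
  have gQ1 x : x \in add_new Q (next v j) -> good x.
    by rewrite mem_add_new => /orP[/eqP->|/gQ //]; apply: good_next.
  have dj' : d + j.+1 = m 0 + 3 by lia.
  have [s2 [t2 [Q2 [e2 rs2 [uQ2 gQ2] n2 c2]]]] := IH s1 _ _ dj' rs1 gv uQ1 gQ1.
  have [Q1 Q1E] := add_new_prefix Q (next v j).
  have nj : next v j \in add_new Q (next v j) by rewrite mem_add_new eqxx.
  rewrite Q1E in rs2 uQ2 gQ2 n2 nj; rewrite -catA in rs2 uQ2 gQ2.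
  exists s2; eexists; exists (Q1 ++ Q2); split; [|by []|by []| |].
  + by refine (exec_while_true _ e1 e2); rewrite ev; lia.
  + move=> c /andP[]; rewrite leq_eqVlt => /orP[/eqP<- _|jc cm].
      by rewrite catA mem_cat nj.
    by rewrite catA; apply: n2; rewrite jc.
  + move: c1 c2 co; rewrite (mulSn d).
    by move: (d * _) => D; lia.
Qed.

Variables (goal : nat -> bool) (pgoal : program) (wg : nat).
Hypothesis wgW : 5 + wg <= W.
Hypothesis pgoalP : forall s v, agree m s -> s (base m + 3) = v -> good v ->
  exists s' t, [/\ exec pgoal s s' t, s' (base m + 5) = goal v,
                   framed m s s' 5 wg & t <= T].

Definition visit_time := (m 0 + 10) * (T + 2 * step_time W L).

Lemma visitP s Q h found v c :
  represents s Q h found v c -> h < size Q -> uniq Q -> (forall u, u \in Q -> good u) ->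
  exists s' t Q', [/\ exec (visit pgoal pnext) s s' t,
    represents s' (Q ++ Q') h.+1 (found || goal (nth 0 Q h)) (nth 0 Q h) (m 0 + 3),
    uniq (Q ++ Q') /\ (forall u, u \in Q ++ Q' -> good u),
    forall c, c < m 0 + 3 -> next (nth 0 Q h) c \in Q ++ Q'
  & t <= visit_time].
Proof.
move=> rs hQ uQ gQ; case: (rs) => ag sh sl sf sv sc sq sk.
set u := nth 0 Q h; have gu : good u by apply/gQ/mem_nth.
have sN := good_bound uQ gQ.
have uL : bitlength u <= L + 4 by have := good_bits gu; lia.
have hL : bitlength h <= L + 4 by apply: leq_trans (leq_addr 4 L); apply: bitlength_N; lia.
have h0 := cost_regW ag (_ : 0 <= W + 5) sh hL; have {}h0 := h0 ltac:(lia).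
pose s1 := update s (base m + 3) u.
have eu : eval s (Fetch (queue_addr (reg 0))) = u.
  have -> : eval s (Fetch (queue_addr (reg 0))) = s (eval s (queue_addr (reg 0))) by [].
  by rewrite eval_queue_addr // (eval_reg _ ag) sh sq.
have e1 := exec_reg 3 (Fetch (queue_addr (reg 0))) ag; rewrite eu -/s1 in e1.
have cu : eval_cost s (Fetch (queue_addr (reg 0))) <= L + 4 + eval_cost s (queue_addr (reg 0)).
  have -> : eval_cost s (Fetch (queue_addr (reg 0))) =
    bitlength (eval s (Fetch (queue_addr (reg 0)))) + eval_cost s (queue_addr (reg 0)) by [].
  by rewrite eu leq_add2r.
have cq := cost_queue_addr (reg 0) ag.
have c3 := cost_addrW ag (_ : 3 <= W + 5); have {}c3 := c3 ltac:(lia).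
have rs1 : represents s1 Q h found u c.
  by apply: represents_update rs _ _ _ _ _ _; rewrite ?update_eq // update_neq //; lia.
case: (rs1) => ag1 sh1 sl1 sf1 sv1 sc1 sq1 sk1.
pose s2 := update s1 (base m + 0) h.+1.
have e2 := exec_reg 0 (Add (reg 0) (Const 1)) ag1; rewrite eval_incr // sh1 -/s2 in e2.
have ci := cost_incr ag1 (_ : 0 <= W + 5) sh1 hL; have {}ci := ci ltac:(lia).
have c0 := cost_addrW ag1 (_ : 0 <= W + 5); have {}c0 := c0 ltac:(lia).
have rs2 : represents s2 Q h.+1 found u c.
  by apply: represents_update rs1 _ _ _ _ _ _; rewrite ?update_eq // update_neq //; lia.
case: (rs2) => ag2 _ _ _ sv2 _ _ _.
have [s3 [t3 [e3 v3 fr3 ct3]]] := pgoalP ag2 sv2 gu.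
have rs3 := represents_framed rs2 fr3 wgW.
have [s4 [t4 [e4 rs4 ct4]]] : exists s4 t4,
  [/\ exec (If (reg 5) (Store (addr 2) (Const 1)) Skip) s3 s4 t4,
     represents s4 Q h.+1 (found || goal u) u c & t4 <= step_time W L].
  case: (rs3) => ag3 sh3 sl3 sf3 sv3 sc3 sq3 sk3.
  have gL : bitlength (goal u) <= L + 4.
    by apply: leq_trans (bitlength_leqS _) _; case: (goal u); lia.
  have cr := cost_regW ag3 (_ : 5 <= W + 5) v3 gL; have {}cr := cr ltac:(lia).
  case gE: (goal u) in v3 *.
    exists (update s3 (base m + 2) 1); eexists; split.
    - apply: exec_if_true; first by rewrite (eval_reg _ ag3) v3.
      exact: exec_reg 2 (Const 1) ag3.
    - by apply: represents_update rs3 _ _ _ _ _ _;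
        rewrite ?update_eq ?orbT // update_neq //; lia.
    - have := cost_addrW ag3 (_ : 2 <= W + 5); move/(_ ltac:(lia)).
      have := cost_small s3 (isT : 1 <= 3); rewrite /step_time; lia.
  exists s3, (eval_cost s3 (reg 5) + 1); split.
  - apply: exec_if_false; [by rewrite (eval_reg _ ag3) v3|exact: exec_skip].
  - by rewrite orbF.
  - by rewrite /step_time; lia.
case: (rs4) => ag4 sh4 sl4 sf4 sv4 sc4 sq4 sk4.
pose s5 := update s4 (base m + 4) 0.
have e5 := exec_reg 4 (Const 0) ag4; rewrite -/s5 in e5.
have c4 := cost_addrW ag4 (_ : 4 <= W + 5); have {}c4 := c4 ltac:(lia).
have cz := cost_small s4 (isT : 0 <= 3).
have rs5 : represents s5 Q h.+1 (found || goal u) u 0.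
  by apply: represents_update rs4 _ _ _ _ _ _; rewrite ?update_eq // update_neq //; lia.
have [s6 [t6 [Q' [e6 rs6 gQ' n6 ct6]]]] := expandP (addn0 _) rs5 gu uQ gQ.
exists s6; eexists; exists Q'; split; [|by []|by []|by []|].
- apply: exec_seq e1 _; apply: exec_seq e2 _; apply: exec_seq e3 _.
  by apply: exec_seq e4 _; apply: exec_seq e5 e6.
- have : (eval_cost s (addr 3) + eval_cost s (Fetch (queue_addr (reg 0)))).+1 +
    (eval_cost s1 (addr 0) + eval_cost s1 (Add (reg 0) (Const 1))).+1 +
    (eval_cost s4 (addr 4) + eval_cost s4 (Const 0)).+1 <= step_time W L.
    by rewrite /step_time; lia.
  rewrite /visit_time (_ : m 0 + 10 = (m 0 + 3) + 7) ?mulnDl; last lia.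
  move: ct3 ct4 ct6; rewrite mulnDl; move: (m 0 * _) (3 * (_ + _)) => u3 u4; lia.
Qed.

(** Once [h] reaches the end of the queue, this says that the queue is closed under [next]. *)
Definition closed (Q : seq nat) h :=
  forall i c, i < h -> c < m 0 + 3 -> next (nth 0 Q i) c \in Q.

(** The loop ends within [N] rounds: the queue is free of repetitions and contains only good states,
    so its length, which bounds [h], never exceeds [N]. *)
Lemma searchP d s Q h v c : d + h = N ->
  h <= size Q -> represents s Q h (has goal (take h Q)) v c -> closed Q h ->
  uniq Q -> (forall u, u \in Q -> good u) ->
  exists s' t Q', [/\ exec (While (Defs.Sub (reg 1) (reg 0)) (visit pgoal pnext)) s s' t,
    agree m s', s' (base m + 2) = has goal (Q ++ Q'),
    closed (Q ++ Q') (size (Q ++ Q')) /\ (forall u, u \in Q ++ Q' -> good u)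
  & t <= d * (visit_time + step_time W L) + step_time W L].
Proof.
have test x Q1 h1 b1 v1 c1 : represents x Q1 h1 b1 v1 c1 -> h1 <= size Q1 -> size Q1 <= N ->
    eval x (Defs.Sub (reg 1) (reg 0)) = size Q1 - h1 /\
    eval_cost x (Defs.Sub (reg 1) (reg 0)) <= step_time W L.
  move=> [ag sh sl _ _ _ _ _] hQ1 sQ1; split.
    have -> : eval x (Defs.Sub (reg 1) (reg 0)) = eval x (reg 1) - eval x (reg 0) by [].
    by rewrite !(eval_reg _ ag) sl sh.
  have hL : bitlength h1 <= L + 4 by apply: leq_trans (leq_addr 4 L); apply: bitlength_N; lia.
  have lL : bitlength (size Q1) <= L + 4 by apply: leq_trans (leq_addr 4 L); apply: bitlength_N; lia.
  have h0 := cost_regW ag (_ : 0 <= W + 5) sh hL; have {}h0 := h0 ltac:(lia).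
  have l0 := cost_regW ag (_ : 1 <= W + 5) sl lL; have {}l0 := l0 ltac:(lia).
  by have := cost_sub l0 h0; rewrite /step_time; lia.
have stop x Q1 h1 v1 c1 : h1 = size Q1 -> represents x Q1 h1 (has goal (take h1 Q1)) v1 c1 ->
    closed Q1 h1 -> uniq Q1 -> (forall u, u \in Q1 -> good u) -> exists s' t Q',
  [/\ exec (While (Defs.Sub (reg 1) (reg 0)) (visit pgoal pnext)) x s' t,
    agree m s', s' (base m + 2) = has goal (Q1 ++ Q'),
    closed (Q1 ++ Q') (size (Q1 ++ Q')) /\ (forall u, u \in Q1 ++ Q' -> good u)
  & t <= step_time W L].
  move=> hE rs1 cl u1 g1.
  have [ev co] := test _ _ _ _ _ _ rs1 (eq_leq hE) (good_bound u1 g1).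
  exists x, (eval_cost x (Defs.Sub (reg 1) (reg 0))), [::]; case: rs1 => ag _ _ sf _ _ _ _.
  rewrite cats0; split=> //; [by apply: exec_while_false; rewrite ev; lia| |by rewrite -hE].
  by rewrite sf hE take_size.
elim: d s Q h v c => [|d IH] s Q h v c dh hQ rs cQ uQ gQ; have sN := good_bound uQ gQ.
- by rewrite mul0n add0n; apply: stop rs cQ uQ gQ; lia.
- case: (ltnP h (size Q)) => [hQ'|]; last first.
    move=> Qh; have [|s' [t [Q' [e1 e2 e3 e4 e5]]]] := stop _ _ _ _ _ _ rs cQ uQ gQ; first lia.
    by exists s', t, Q'; split=> //; apply: leq_trans e5 (leq_addl _ _).
  have [s1 [t1 [Q1 [e1 rs1 [uQ1 gQ1] n1 c1]]]] := visitP rs hQ' uQ gQ.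
  have [ev co] := test _ _ _ _ _ _ rs hQ sN.
  have hasE : has goal (take h.+1 (Q ++ Q1)) = has goal (take h Q) || goal (nth 0 Q h).
    by rewrite takel_cat // (take_nth 0 hQ') has_rcons orbC.
  rewrite -hasE in rs1.
  have cQ1 : closed (Q ++ Q1) h.+1.
    move=> i x; rewrite ltnS leq_eqVlt nth_cat => /orP[/eqP->|ih] xc.
      by rewrite hQ'; apply: n1.
    by rewrite (ltn_trans ih hQ') mem_cat cQ.
  have [||s2 [t2 [Q2 [e2 ag2 f2 [cQ2 gQ2] c2]]]] := IH s1 (Q ++ Q1) h.+1 _ _ _ _ rs1 cQ1 uQ1 gQ1.
  + by lia.
  + by rewrite size_cat; lia.
  rewrite -catA in f2 cQ2 gQ2.
  exists s2; eexists; exists (Q1 ++ Q2); split; [|by []|by []|by []|].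
  + by refine (exec_while_true _ e1 e2); rewrite ev; lia.
  + move: c1 c2 co; rewrite (mulSn d).
    by move: (d * _) => D; lia.
Qed.

End Step.
End Search.

(** Each reachable state is expanded once, whatever the number of paths to it; so the time is the
    number of reachable states up to a polynomial factor. *)
Theorem search_program (start : memory -> nat) (goal : memory -> nat -> bool)
    (next : memory -> nat -> nat -> nat) :
  @computable input_context start ->
  @computable_pred (extend input_context) (fun y => goal y.1 y.2) ->
  @computable (extend (extend input_context)) (fun z => next z.1.1 z.1.2 z.2) ->
  exists p T, poly_bounded T /\ forall m L N,
    (forall a, base m <= a -> m a = 0) -> 1 < L -> m 0 <= L ->
    (forall a, a < base m -> bitlength (m a) <= L) -> bitlength N.+1 <= L ->
    (forall v, reachable (start m) (next m) (m 0 + 3) v -> bitlength v <= L) ->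
    (forall Q : seq nat, uniq Q ->
       (forall v, v \in Q -> reachable (start m) (next m) (m 0 + 3) v) -> size Q <= N) ->
    exists s t, [/\ exec p m s t,
      accepting s <-> exists2 v, reachable (start m) (next m) (m 0 + 3) v & goal m v
    & t <= N.+1 * T L].
Proof.
move=> cs cg cn.
(* Subprograms deliver their value in register 5 and find the state in register 3 and the choice in
   register 4; the list [[:: 4; 3]] names the newest variable first. *)
have [p0 [w0 [T0 [pT0 H0]]]] := cs [::] 5 erefl isT.
have [p1 [w1 [T1 [pT1 H1]]]] := cg [:: 3] 5 erefl isT.
have [p2 [w2 [T2 [pT2 H2]]]] := cn [:: 4; 3] 5 erefl isT.
(* From register [W] on, the table lies above the work registers of all three subprograms. *)
pose W := 6 + w0 + w1 + w2; pose U L := L + (L + 4).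
pose T L := T0 (U L) + T1 (U L) + T2 (U L).
pose D L := (L + 20) * (T L + 2 * step_time W L) + 10 * step_time W L.
exists (search W p0 p1 p2), D; split.
  have pU T' : poly_bounded T' -> poly_bounded (fun L => T' (U L)).
    by apply: (poly_comp (T1 := fun L => L + 4)); apply: polyD poly_id (poly_const 4).
  have pT : poly_bounded T by apply: polyD; [apply: polyD|]; apply: pU.
  have pS : poly_bounded (step_time W).
    apply: polyM (poly_const 1000) _; apply: polyD _ (poly_const 10).
    exact: polyD poly_id (poly_addr _).
  apply: polyD _ (polyM (poly_const 10) pS).
  exact: polyM (polyD poly_id (poly_const 20)) (polyD pT (polyM (poly_const 2) pS)).
move=> m L N mz L1 nL mL NL; set R := reachable _ _ _ => Rb Rn.
have W5 : 5 < W by rewrite /W; lia.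
have fit0 : @fits input_context (U L) m.
  split; rewrite /U //=; try lia.
  by move=> a am; have := mL a am; lia.
have fit1 v : R v -> @fits (extend input_context) (U L) (m, v).
  by move=> Rv; apply: fits_extend => //; rewrite /U; have := Rb v Rv; lia.
have fit2 v c : R v -> c < m 0 + 3 -> @fits (extend (extend input_context)) (U L) ((m, v), c).
  move=> Rv cm; apply: fits_extend; first exact: fit1.
  by rewrite /U; have := bitlength_leqS c; lia.
have goalP s v : agree m s -> s (base m + 3) = v -> R v -> exists s' t,
    [/\ exec p1 s s' t, s' (base m + 5) = goal m v, framed m s s' 5 w1 & t <= T L].
  move=> ag sv Rv; have [_ _ H] := H1 _ _ (fit1 v Rv).
  have [|s' [t [e1 e2 e3 e4]]] := H s; last by exists s', t; split=> //; rewrite /T; lia.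
  by split=> // -[|i] //= _; rewrite sv.
have nextP s v c : agree m s -> s (base m + 3) = v -> s (base m + 4) = c -> R v ->
    c < m 0 + 3 -> exists s' t,
    [/\ exec p2 s s' t, s' (base m + 5) = next m v c, framed m s s' 5 w2 & t <= T L].
  move=> ag sv sc Rv cm; have [_ _ H] := H2 _ _ (fit2 v c Rv cm).
  have [|s' [t [e1 e2 e3 e4]]] := H s; last by exists s', t; split=> //; rewrite /T; lia.
  by split=> // -[|[|i]] //= _; rewrite ?sv ?sc.
have Rnext v c : c < m 0 + 3 -> R v -> R (next m v c) by move=> cm Rv; apply: reachable_next.
have R0 : R (start m) by apply: reachable_start.
have [_ _ H] := H0 _ _ fit0; have [|s1 [t1 [e1 v1 fr1 c1]]] := H m; first by split.
have w0W : 5 + w0 <= W by rewrite /W; lia.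
have ag1 : agree m s1 by apply: agree_framed fr1.
have z1 a : base m <= a -> (a < base m + 5) || (base m + W <= a) -> s1 a = 0.
  move=> ba ha; rewrite fr1 ?mz //; case/orP: ha => ha; first by rewrite ha.
  by rewrite (leq_trans _ ha) ?orbT // -addnA leq_add2l.
set v0 := start m in R0 v1.
have b0 : bitlength v0 <= L + 4 by have := Rb _ R0; lia.
have c5 := cost_regW W5 L1 nL NL ag1 (_ : 5 <= W + 5) v1 b0; have {}c5 := c5 ltac:(lia).
pose s2 := update s1 (base m + W + 2 * v0 + 1) 1.
have E2 : exec (Store (mark_addr W (reg 5)) (Const 1)) s1 s2
    (eval_cost s1 (mark_addr W (reg 5)) + eval_cost s1 (Const 1)).+1.
  have := exec_store s1 (mark_addr W (reg 5)) (Const 1).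
  by rewrite (eval_mark_addr W5 L1 nL NL) // (eval_reg _ ag1) v1; apply.
have ag2 : agree m s2 by move=> a am; rewrite /s2 update_neq ?ag1 //; lia.
have v2 : s2 (base m + 5) = v0 by rewrite /s2 update_neq ?v1 //; lia.
have c52 := cost_regW W5 L1 nL NL ag2 (_ : 5 <= W + 5) v2 b0; have {}c52 := c52 ltac:(lia).
pose s3 := update s2 (base m + W) v0.
have E3 : exec (Store (queue_addr W (Const 0)) (reg 5)) s2 s3
    (eval_cost s2 (queue_addr W (Const 0)) + eval_cost s2 (reg 5)).+1.
  have := exec_store s2 (queue_addr W (Const 0)) (reg 5).
  have -> : eval s2 (queue_addr W (Const 0)) = base m + W.
    by rewrite (eval_queue_addr W _ ag2) /= addn0.
  by rewrite (eval_reg _ ag2) v2; apply.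
have ag3 : agree m s3 by move=> a am; rewrite /s3 update_neq ?ag2 //; lia.
pose s4 := update s3 (base m + 1) 1.
have E4 := exec_reg 1 (Const 1) ag3; rewrite -/s4 in E4.
have rs4 : represents W m s4 [:: v0] 0 (has (goal m) (take 0 [:: v0])) 0 0.
  have s4E a : a <> base m + W + 2 * v0 + 1 -> a <> base m + W ->
    a <> base m + 1 -> s4 a = s1 a by move=> *; rewrite /s4 /s3 /s2 !update_neq.
  split; rewrite ?take0 /=; try (by rewrite s4E ?z1 //; lia).
  - by move=> a am; rewrite s4E ?ag1 //; lia.
  - by rewrite /s4 update_eq.
  - move=> [|i] //= _; rewrite muln0 addn0 /s4 update_neq /s3 ?update_eq //; lia.
  - move=> u; rewrite inE; case: (u =P v0) => [->|uv].
      by rewrite /s4 /s3 update_neq ?update_neq /s2 ?update_eq //; lia.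
    by rewrite s4E ?z1 //; lia.
have [|||||s5 [t5 [Q [e5 ag5 f5 [cl gQ] c5']]]] := @searchP W W5 m L N L1 nL NL
  (next m) p2 w2 (T L) _ R Rb Rnext Rn nextP (goal m) p1 w1 _ goalP N s4 [:: v0] 0 0 0
  (addn0 N) isT rs4.
- by rewrite /W; lia.
- by rewrite /W; lia.
- by [].
- by [].
- by move=> u; rewrite inE => /eqP->.
set Q' := [:: v0] ++ Q in f5 cl gQ.
(* The final queue contains the start and is closed under [next]. *)
have allQ v : R v -> v \in Q'.
  elim=> [|u c cm Ru uQ]; first by rewrite mem_cat inE eqxx.
  by rewrite -(nth_index 0 uQ); apply: cl; rewrite ?index_mem.
exists (update s5 0 (has (goal m) Q')); eexists; split.
- apply: exec_seq e1 _; apply: exec_seq E2 _; apply: exec_seq E3 _.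
  apply: exec_seq E4 _; apply: exec_seq e5 _.
  have := exec_store s5 (Const 0) (reg 2); rewrite (eval_reg _ ag5) f5; apply.
- rewrite /accepting update_eq; split.
    by case: hasP => // -[v vQ gv] _; exists v => //; apply: gQ.
  by move=> [v Rv gv]; rewrite (_ : has _ _) //; apply/hasP; exists v => //; apply: allQ.
- have f1 : bitlength (has (goal m) Q' : nat) <= L + 4.
    by apply: leq_trans (bitlength_leqS _) _; case: (has _ _); lia.
  have c2 := cost_regW W5 L1 nL NL ag5 (_ : 2 <= W + 5) f5 f1; have {}c2 := c2 ltac:(lia).
  have h1 := cost_mark_addr W5 L1 nL NL (reg 5) ag1.
  have h2 := cost_queue_addr W5 L1 nL NL (Const 0) ag2.
  have h3 := cost_addrW W5 L1 nL NL ag3 (_ : 1 <= W + 5); have {}h3 := h3 ltac:(lia).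
  have k1 := cost_small s1 (isT : 1 <= 3); have k2 := cost_small s2 (isT : 0 <= 3).
  have k3 := cost_small s3 (isT : 1 <= 3); have k4 := cost_small s5 (isT : 0 <= 3).
  have vt : visit_time W m L (T L) + step_time W L <= D L.
    rewrite /visit_time /D; apply: leq_trans (_ : (L + 20) * (T L + 2 * step_time W L) + step_time W L <= _).
      by rewrite leq_add2r leq_mul2r; apply/orP; right; lia.
    by rewrite leq_add2l; lia.
  have tD : T L <= D L - 10 * step_time W L by rewrite /D addnK; nia.
  have Dst : 10 * step_time W L <= D L by rewrite /D leq_addl.
  have c1T : t1 <= T L by rewrite /T; lia.
  have pre : t1 + (eval_cost s1 (mark_addr W (reg 5)) + eval_cost s1 (Const 1)).+1 +
     (eval_cost s2 (queue_addr W (Const 0)) + eval_cost s2 (reg 5)).+1 +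
     (eval_cost s3 (addr 1) + eval_cost s3 (Const 1)).+1 +
     (eval_cost s5 (Const 0) + eval_cost s5 (reg 2)).+1 <= T L + 5 * step_time W L.
    by rewrite /step_time; lia.
  have loop : t5 <= N * D L + step_time W L.
    by apply: leq_trans c5' _; rewrite leq_add2r leq_mul2l vt orbT.
  rewrite mulSn; move: pre loop tD Dst.
  by move: (N * D L) (eval_cost s5 (Const 0)) (eval_cost s3 (Const 1)) => *; lia.
Qed.

(** * Tree colourings *)

Lemma connect_ind1 (T : finType) (r : rel T) (Q : T -> Prop) x :
  Q x -> (forall y z, Q y -> r y z -> Q z) -> forall y, connect r x y -> Q y.
Proof.
move=> Qx step y /connectP[p pp ->]; elim: p x Qx pp => //= z p IH x Qx /andP[xz pp].
by apply: IH pp; apply: step xz.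
Qed.

Lemma connect_out (T : finType) (r : rel T) (Q : pred T) x y :
  Q x -> ~~ Q y -> connect r x y -> exists u v, [/\ Q u, ~~ Q v & r u v].
Proof.
move=> Qx Qy /connectP[p pp yE]; rewrite {}yE in Qy.
elim: p x Qx pp Qy => [|z p IH] x Qx /=; first by rewrite Qx.
move=> /andP[xz pp] Qy; case Qz: (Q z); first exact: IH pp Qy.
by exists x, z; rewrite Qz.
Qed.

Section Colouring.
Variables (T : finType) (e : rel T).
Hypothesis e_sym : symmetric e.
Implicit Types (P D A S : {set T}) (x y a b : T).

(* A colouring of the vertices in [D] is given by the set [A] of vertices with
   the first colour. *)
Definition mono D A : rel T :=
  fun x y => [&& x \in D, y \in D, e x y & (x \in A) == (y \in A)].

(** For [A = set0] all vertices have the same colour, and this is connectivity in the subgraph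
    induced by [D]. Every vertex is linked to itself, even outside [D]. *)
Definition linked D A := connect (mono D A).
Definition block D A x := [set y | linked D A x y].

(* Contracting the monochromatic components of [P] yields an acyclic graph: any
   two neighbours of a component that are connected in its complement belong to
   the same component. *)
Definition tree_colouring P A := forall x a b, x \in P -> a \in P -> b \in P ->
  ~~ linked P A x a -> ~~ linked P A x b ->
  (exists2 y, linked P A x y & e y a) -> (exists2 y, linked P A x y & e y b) ->
  linked (P :\: block P A x) set0 a b -> linked P A a b.

Definition separated P A S := {in S &, forall x y, linked P A x y -> x = y}.

(* A set of representatives of the components witnesses the number of
   contractions. *)
Definition contracts P k := exists A S,
  [/\ tree_colouring P A, S \subset P, separated P A S & #|P| <= #|S| + k].

Lemma contractsW P k k' : k <= k' -> contracts P k -> contracts P k'.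
Proof.
move=> kk' [A [S [t sP sep le]]]; exists A, S; split=> //.
by apply: leq_trans le _; rewrite leq_add2l.
Qed.

Lemma mono_edge_sym D A : symmetric (mono D A).
Proof. by move=> x y; rewrite /mono e_sym eq_sym !andbA [(x \in D) && _]andbC. Qed.

Lemma linked_sym D A x y : linked D A x y = linked D A y x.
Proof. by exact: (sym_connect_sym (mono_edge_sym D A)). Qed.

Lemma linked0 D A x : linked D A x x.
Proof. exact: connect0. Qed.

Lemma linked_trans D A x y z : linked D A x y -> linked D A y z -> linked D A x z.
Proof. exact: connect_trans. Qed.

Lemma linked1 D A x y : x \in D -> y \in D -> e x y -> (x \in A) = (y \in A) ->
  linked D A x y.
Proof. by move=> xD yD exy xy; apply: connect1; rewrite /mono xD yD exy xy eqxx. Qed.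

Lemma linked_mono D A D' A' : (forall x y, mono D A x y -> mono D' A' x y) ->
  forall x y, linked D A x y -> linked D' A' x y.
Proof. by move=> h; apply: connect_sub => x y /h; apply: connect1. Qed.

Lemma eq_linked D A D' A' : mono D A =2 mono D' A' -> linked D A =2 linked D' A'.
Proof. by move=> h x y; rewrite /linked (eq_connect h). Qed.

Lemma linked_in D A x y : linked D A x y -> x \in D -> y \in D.
Proof. by move=> h xD; apply: (@connect_ind1 _ _ (fun y => y \in D) _ _ _ _ h) => // u v _ /and4P[]. Qed.

Lemma linked_neq D A x y : linked D A x y -> x != y -> x \in D.
Proof.
case/connectP => -[|z p] /= => [_ ->|]; first by rewrite eqxx.
by case/andP => /and4P[].
Qed.

Lemma linked_colour D A x y : linked D A x y -> (y \in A) = (x \in A).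
Proof. by move=> h; apply: (@connect_ind1 _ _ (fun y => (y \in A) = (x \in A)) _ _ _ _ h) => // u v <- /and4P[_ _ _ /eqP->]. Qed.

Lemma linked_sub D D' A x y : D \subset D' -> linked D A x y -> linked D' A x y.
Proof.
move=> DD'; apply: linked_mono => u v /and4P[uD vD uv c].
by rewrite /mono !(subsetP DD') // uv.
Qed.

Lemma mem_block D A x y : (y \in block D A x) = linked D A x y.
Proof. by rewrite inE. Qed.

Lemma linked_block D A x y : linked D A x y -> block D A x = block D A y.
Proof.
move=> xy; apply/setP => z; rewrite !inE; apply/idP/idP; last exact: linked_trans.
by apply: linked_trans; rewrite linked_sym.
Qed.

Lemma eq_tree_colouring P A A' : mono P A =2 mono P A' ->
  tree_colouring P A -> tree_colouring P A'.
Proof.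
move=> eqm t x a b xP aP bP; have E := eq_linked eqm; rewrite -!E => xa xb ya yb.
have -> : block P A' x = block P A x by apply/setP => z; rewrite !inE E.
apply: t => //; [case: ya|case: yb] => y; rewrite -E => h1 h2; by exists y.
Qed.

End Colouring.

(** * Quotients with connected fibres *)

Section Quotient.
Variables (T T' : finType) (e : rel T) (e' : rel T') (f : T -> T').
Hypothesis e_sym : symmetric e.
Hypothesis e'_sym : symmetric e'.
Hypothesis f_edge : forall x y, e x y -> f x = f y \/ e' (f x) (f y).
Hypothesis f_lift : forall a b, e' a b -> exists x y, [/\ f x = a, f y = b & e x y].
Hypothesis f_fibre : forall x y, f x = f y -> linked e (f @^-1: [set f x]) set0 x y.
Lemma linked_fibre (A' D' : {set T'}) x y : f x = f y -> f x \in D' ->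
  linked e (f @^-1: D') (f @^-1: A') x y.
Proof.
move=> fxy xD; apply: linked_mono (f_fibre fxy) => u v /and4P[].
rewrite !inE => /eqP fu /eqP fv uv _.
by rewrite /mono !inE fu fv xD uv eqxx.
Qed.

(** A path in the quotient lifts edge by edge; between two lifted edges it continues inside a fibre,
    which is connected and monochromatic. *)
Lemma linked_quotient (A' D' : {set T'}) x y : f x \in D' ->
  linked e (f @^-1: D') (f @^-1: A') x y = linked e' D' A' (f x) (f y).
Proof.
move=> xD; apply/idP/idP => [h|].
  apply: (@connect_ind1 _ _ (fun y => linked e' D' A' (f x) (f y)) _ _ _ _ h) => [|u v xu].
    exact: linked0.
  rewrite /mono !inE => /and4P[uD vD uv c].
  case: (f_edge uv) => [<- //|fuv]; apply: linked_trans xu _.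
  by apply: linked1 => //; apply/eqP.
case/connectP => p; elim: p x xD => [|a p IH] x xD /=.
  by move=> _ /esym fxy; apply: linked_fibre.
case/andP => /and4P[_ aD xa c] pp last_p.
have [u [v [fu fv uv]]] := f_lift xa.
apply: linked_trans (linked_fibre A' (esym fu) xD) _.
apply: (@linked_trans _ _ _ _ _ v).
  by apply: linked1; rewrite ?inE ?fu ?fv //; apply/eqP.
by apply: IH; rewrite fv.
Qed.

Lemma linked_quotientT (A' : {set T'}) x y :
  linked e setT (f @^-1: A') x y = linked e' setT A' (f x) (f y).
Proof. by rewrite -linked_quotient ?preimsetT // inE. Qed.

Lemma block_quotient (A' : {set T'}) x :
  block e setT (f @^-1: A') x = f @^-1: (block e' setT A' (f x)).
Proof. by apply/setP => y; rewrite !inE linked_quotientT. Qed.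

Lemma linked_quotientC (A' : {set T'}) x y z : ~~ linked e' setT A' (f x) (f y) ->
  linked e (setT :\: block e setT (f @^-1: A') x) set0 y z =
  linked e' (setT :\: block e' setT A' (f x)) set0 (f y) (f z).
Proof.
move=> xy; rewrite -linked_quotient ?inE ?xy //.
have -> : f @^-1: set0 = set0 by apply/setP => u; rewrite !inE.
by rewrite block_quotient; congr linked; apply/setP => u; rewrite !inE.
Qed.

Lemma tree_colouring_quotient (A' : {set T'}) : (forall a, exists x, f x = a) ->
  tree_colouring e setT (f @^-1: A') <-> tree_colouring e' setT A'.
Proof.
move=> f_surj; split=> tr.
  move=> x' a' b' _ _ _ xa xb [y1 ya1 ea] [y2 yb2 eb] ab.
  have [x fx] := f_surj x'; subst x'.
  have [u [a [fu fa ua]]] := f_lift ea; have [v [b [fv fb vb]]] := f_lift eb; subst.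
  rewrite -linked_quotientT; apply: (tr x); rewrite ?inE ?linked_quotientT //.
  - by exists u => //; rewrite linked_quotientT.
  - by exists v => //; rewrite linked_quotientT.
  - by rewrite linked_quotientC.
move=> x a b _ _ _; rewrite !linked_quotientT => xa xb [y ya ea] [z zb eb].
rewrite linked_quotientC //; move: ya zb; rewrite !linked_quotientT => ya zb.
apply: tr; rewrite ?inE //.
(* If the edge lay in a fibre, [a] would belong to the component of [x]. *)
- exists (f y) => //.
  by case: (f_edge ea) => // fya; rewrite fya (negPf xa) in ya.
- exists (f z) => //.
  by case: (f_edge eb) => // fzb; rewrite fzb (negPf xb) in zb.
Qed.

End Quotient.

(** * Acyclic graphs *)

Section Acyclic.
Variable T : finType.
Implicit Type r : rel T.

Definition avoiding r x : rel T := fun u v => [&& r u v, u != x & v != x].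

(** Two distinct neighbours of [x] joined by a path off [x] close a cycle through [x]. In this form
    the notion is the case of [tree_colouring] in which all components are singletons. *)
Definition acyclic r := forall x a b, r x a -> r x b -> connect (avoiding r x) a b -> a = b.

Lemma connect_avoiding r u v : connect r u v -> u <> v ->
  exists2 a, r u a & connect (avoiding r u) a v.
Proof.
case/connectP => p0 pp0 ->; case: (shortenP pp0) => p pp up _ uv {p0 pp0}.
case: p pp up uv => [|a p] /= => [_ _ //|/andP[ua pp] /andP[up _] _].
exists a => //; apply/connectP; exists p => //.
elim: p a {ua} pp up => //= b p IH a /andP[ab pp]; rewrite !inE !negb_or.
move=> /and3P[ua ub up]; rewrite /avoiding ab !(eq_sym _ u) ua ub /=.
by apply: IH => //; rewrite inE negb_or ub.
Qed.

(** Induction on the number of edges: delete an edge, colour the rest, and exchange the colours in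
    the component of one end if both ends got the same. *)
Lemma acyclic_bipartite r : symmetric r -> irreflexive r -> acyclic r ->
  exists A : {set T}, forall x y, r x y -> (x \in A) != (y \in A).
Proof.
move: {2}_.+1 (ltnSn #|[set p : T * T | r p.1 p.2]|) => m.
elim: m r => // m IH r ltm r_sym r_irr acr.
case: (pickP (fun p : T * T => r p.1 p.2)) => [[u v] /= ruv|r0]; last first.
  by exists set0 => x y; have := r0 (x, y) => /= ->.
pose r' : rel T := fun a b => r a b && ~~ (((a == u) && (b == v)) || ((a == v) && (b == u))).
have r'r a b : r' a b -> r a b by case/andP.
have r'_sym : symmetric r'.
  by move=> a b; rewrite /r' r_sym; congr (_ && ~~ _); rewrite orbC andbC [X in _ || X]andbC.
have [|||A HA] := IH r' _ r'_sym _ _.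
- rewrite -ltnS; apply: leq_trans ltm; rewrite ltnS; apply: proper_card.
  apply/properP; split; first by apply/subsetP => p; rewrite !inE => /r'r.
  by exists (u, v); rewrite !inE //= /r' !eqxx andbF.
- by move=> a; rewrite /r' r_irr.
- move=> x a b /r'r xa /r'r xb ab; apply: (acr x) => //.
  apply: connect_sub ab => c d /and3P[/r'r cd cx dx].
  by apply: connect1; rewrite /avoiding cd cx.
(* Otherwise the edge would lie on a cycle: [v] and the first vertex of another path from [u] to [v]
   are neighbours of [u] joined off [u]. *)
have nuv : ~~ connect r' u v.
  apply/negP => h; have uv : u <> v by move=> uv; rewrite uv r_irr in ruv.
  have [a ua av] := connect_avoiding h uv.
  have aE : a = v.
    apply: (acr u) => //; first exact: r'r.
    apply: connect_sub av => c d /and3P[/r'r cd cx dx].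
    by apply: connect1; rewrite /avoiding cd cx.
  by rewrite aE /r' !eqxx andbF in ua.
exists [set x | (x \in A) (+) (connect r' v x && ((u \in A) == (v \in A)))] => x y rxy.
have key a b : r a b -> r' a b \/ (a = u /\ b = v) \/ (a = v /\ b = u).
  move=> rab; rewrite /r' rab /=.
  case: (boolP (_ || _)) => [/orP[]/andP[/eqP-> /eqP->]|_]; auto.
have cs := sym_connect_sym r'_sym.
have nvu : connect r' v u = false by rewrite cs (negPf nuv).
rewrite !inE; case: (key _ _ rxy) => [r'xy|[[-> ->]|[-> ->]]].
- have -> : connect r' v x = connect r' v y.
    by rewrite ![connect r' v _]cs; apply: same_connect => //; apply: connect1.
  by have := HA x y r'xy; case: (x \in A) (y \in A) (_ && _) => [] [] [].
- by rewrite nvu connect0 /=; case: (u \in A) (v \in A) => [] [].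
- by rewrite nvu connect0 /=; case: (u \in A) (v \in A) => [] [].
Qed.

Lemma ucycle_acyclic r : symmetric r ->
  (forall c : seq T, 2 < size c -> ~ ucycle r c) <-> acyclic r.
Proof.
move=> r_sym; split=> [nc x a b xa xb|acr [|x [|a p]] //= sp /andP[/= /andP[xa pp]]].
  case/connectP => p0 pp0 bE; case: (shortenP pp0) bE => p pp up _ bE {p0 pp0}.
  case: p pp up bE => [|c p] pp up bE //.
  have xp : all (fun z => z != x) (a :: c :: p).
    have allp q : forall d, path (avoiding r x) d q -> all (fun z => z != x) q.
      by elim: q => //= f q IH d /andP[/and3P[_ _ ->] /IH].
    have ax : a != x by case/andP: pp => /and3P[].
    by rewrite [all _ _]/= ax; apply: (allp (c :: p)) pp.
  have rp : path r a (c :: p) by apply: sub_path pp => u v /and3P[].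
  case: (nc [:: x, a, c & p] isT); apply/andP; split.
    have : path r x (rcons (a :: c :: p) x); last by [].
    rewrite rcons_path; apply/andP; split; first by rewrite [path _ _ _]/= xa.
    by move: bE => /= <-; rewrite r_sym.
  have : (x \notin a :: c :: p) && uniq (a :: c :: p); last by [].
  by rewrite up andbT; apply/negP => /(allP xp); rewrite eqxx.
rewrite inE negb_or => /andP[/andP[xNa xp] ap].
move: pp; rewrite rcons_path => /andP[pp lx].
case: p sp xp ap pp lx => // b p _ xp ap pp lx.
have aE : a = last b p.
  apply: (acr x) => //; first by rewrite r_sym.
  have H q : forall d, path r d q -> x \notin d :: q -> path (avoiding r x) d q.
    elim: q => //= f q IH d /andP[df pq]; rewrite !inE !negb_or => /and3P[xd xf xq].
    by rewrite /avoiding df !(eq_sym _ x) xd xf IH //= inE negb_or xf.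
  apply/connectP; exists (b :: p) => //; apply: H => //.
  by rewrite inE negb_or xNa.
by case/andP: ap; rewrite aE mem_last.
Qed.

End Acyclic.

Lemma linkedT (T : finType) (e : rel T) : linked e setT set0 =2 connect e.
Proof. by move=> x y; apply: eq_connect => u v; rewrite /mono !inE /= andbT. Qed.

Lemma acyclic_tree_colouring (T : finType) (e : rel T) (A : {set T}) :
  symmetric e -> (forall x y, e x y -> (x \in A) != (y \in A)) ->
  tree_colouring e setT A <-> acyclic e.
Proof.
move=> e_sym prop.
have lE x y : linked e setT A x y = (x == y).
  apply/idP/eqP => [|->]; last exact: linked0.
  move=> h; apply: (@connect_ind1 _ _ (fun y => x = y) _ _ _ _ h) => // u v -> /and4P[_ _ uv].
  by rewrite (negPf (prop _ _ uv)).
have aE x a b : linked e (setT :\: block e setT A x) set0 a b = connect (avoiding e x) a b.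
  apply: eq_connect => u v; rewrite /mono !inE !lE !andbT !(eq_sym x).
  by rewrite /avoiding; case: (e u v); rewrite ?andbT ?andbF.
split=> tr x a b.
  move=> xa xb ab; have irr y : e y y = false.
    by apply/negP => /prop; rewrite eqxx.
  apply/eqP; rewrite -lE; apply: (tr x); rewrite ?inE ?lE ?aE //.
  - by apply/eqP => xE; rewrite xE irr in xa.
  - by apply/eqP => xE; rewrite xE irr in xb.
  - by exists x => //; apply: linked0.
  - by exists x => //; apply: linked0.
move=> _ _ _ _ _ [y]; rewrite lE => /eqP <- xa [z]; rewrite lE => /eqP <- xb.
by rewrite aE lE => /(tr x _ _ xa xb) ->.
Qed.

(** * Edge contractions and tree colourings *)

Section Contraction.
Variables (G : sgraph) (x y : G).
Hypothesis xy : adj x y.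

Definition contraction (v : G) : contract x y := insub v.

Lemma contractionN v : (v == x) || (v == y) -> contraction v = None.
Proof. by move=> h; apply: insubN; rewrite -negb_or h. Qed.

Lemma contraction_val (w : {v : G | (v != x) && (v != y)}) : contraction (val w) = Some w.
Proof. exact: valK. Qed.

Lemma contractionP u v : contraction u = contraction v ->
  u = v \/ ((u == x) || (u == y)) /\ ((v == x) || (v == y)).
Proof.
rewrite /contraction; case: insubP => [u' _ uE|]; case: insubP => [v' _ vE|] //.
  by move=> [uv]; left; rewrite -uE -vE uv.
by rewrite -!negb_or !negbK => -> ->; right.
Qed.

Definition uncontract (w : contract x y) : G := if w is Some v then val v else x.

Lemma uncontractK : cancel uncontract contraction.
Proof. by case=> [v|] /=; rewrite ?contraction_val // contractionN ?eqxx. Qed.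

Lemma contraction_edge u v : adj u v ->
  contraction u = contraction v \/ adj (contraction u) (contraction v).
Proof.
move=> uv; rewrite /contraction.
case: insubP => [u' _ uE|]; case: insubP => [v' _ vE|]; last by left.
- by right; rewrite /= uE vE.
- by rewrite -negb_or negbK => /orP[]/eqP vE; right => /=; rewrite uE -vE [adj v u]adj_sym uv ?orbT.
- by rewrite -negb_or negbK => /orP[]/eqP uE; right => /=; rewrite vE -uE uv ?orbT.
Qed.

Lemma contraction_lift (a b : contract x y) : adj a b ->
  exists u v, [/\ contraction u = a, contraction v = b & adj u v].
Proof.
case: a b => [a|] [b|] //= => [ab|/orP[]ab|/orP[]ab].
- by exists (val a), (val b); rewrite !contraction_val.
- by exists (val a), x; rewrite contraction_val contractionN ?eqxx // adj_sym.
- by exists (val a), y; rewrite contraction_val contractionN ?eqxx ?orbT // adj_sym.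
- by exists x, (val b); rewrite contraction_val contractionN ?eqxx.
- by exists y, (val b); rewrite contraction_val contractionN ?eqxx ?orbT.
Qed.

Lemma contraction_fibre u v : contraction u = contraction v ->
  linked (@adj G) (contraction @^-1: [set contraction u]) set0 u v.
Proof.
move=> uv; case: (contractionP uv) => [->|[hu hv]]; first exact: linked0.
have adE a b : (a == x) || (a == y) -> (b == x) || (b == y) -> a != b -> adj a b.
  by do 2!case/orP=> /eqP->; rewrite ?eqxx // adj_sym.
case: (u =P v) => [->|/eqP nuv]; first exact: linked0.
by apply: linked1; rewrite ?inE ?uv ?adE.
Qed.

Lemma card_contract : #|contract x y|.+1 = #|G|.
Proof.
have xNy : x != y by apply: contraTneq xy => ->; rewrite adj_irrefl.
rewrite /= /contract_vertex card_option card_sig.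
have := cardC [pred v | (v == x) || (v == y)] => /=.
have -> : #|[pred v | (v == x) || (v == y)]| = 2.
  by have := cards2 x y; rewrite xNy => <-; apply: eq_card => v; rewrite !inE.
rewrite add2n => <-; congr _.+2; apply: eq_card => v.
by rewrite !inE negb_or.
Qed.

Lemma connected_contract :
  (forall u v : contract x y, connect (@adj _) u v) <-> (forall u v : G, connect (@adj _) u v).
Proof.
have E u v : connect (@adj G) u v = connect (@adj (contract x y)) (contraction u) (contraction v).
  rewrite -!linkedT -(linked_quotientT contraction_edge contraction_lift contraction_fibre).
  by congr linked; apply/setP => w; rewrite !inE.
split=> h u v; first by rewrite E.
by rewrite -(uncontractK u) -(uncontractK v) -E.
Qed.

Lemma contracts_contract m : contracts (@adj (contract x y)) setT m -> contracts (@adj G) setT m.+1.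
Proof.
move=> [A [S [tr _ sep le]]]; exists (contraction @^-1: A), (uncontract @: S); split=> //.
- by apply/(tree_colouring_quotient contraction_edge contraction_lift contraction_fibre) => //;
    move=> w; exists (uncontract w); apply: uncontractK.
- move=> _ _ /imsetP[u uS ->] /imsetP[v vS ->].
  rewrite (linked_quotientT contraction_edge contraction_lift contraction_fibre) !uncontractK.
  by move=> /sep-> //.
- rewrite card_imset; last exact: can_inj uncontractK.
  by move: le; rewrite !cardsT -card_contract; lia.
Qed.

(** A monochromatic edge can be contracted without loss: the colour classes are unions of fibres,
    and [x] and [y], being linked, are not both in [S]. For the same reason [S] is not the whole
    vertex set, so [k] is positive. *)
Lemma contract_contracts k (A S : {set G}) : (x \in A) = (y \in A) ->
  tree_colouring (@adj G) setT A -> separated (@adj G) setT A S ->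
  #|[set: G]| <= #|S| + k -> exists2 m, k = m.+1 & contracts (@adj (contract x y)) setT m.
Proof.
move=> xyA tr sep le; pose A' := contraction @: A.
have AE : A = contraction @^-1: A'.
  apply/setP => v; rewrite inE; apply/idP/imsetP => [vA|[u uA]]; first by exists v.
  move=> /contractionP[->//|[hu hv]].
  have E w : (w == x) || (w == y) -> (w \in A) = (x \in A) by case/orP=> /eqP->.
  by rewrite E // -(E u).
have lxy : linked (@adj G) setT A x y by apply: linked1; rewrite ?inE.
have xNy : x != y by apply: contraTneq xy => ->; rewrite adj_irrefl.
have injS : {in S &, injective contraction}.
  move=> u v uS vS uv; apply: sep => //.
  rewrite AE (linked_quotientT contraction_edge contraction_lift contraction_fibre) uv.
  exact: linked0.
have cS : #|contraction @: S| = #|S| by apply: card_in_imset.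
have ltS : #|S| < #|G|.
  rewrite -cardsT; apply: proper_card; rewrite properE subsetT /=.
  apply/negP => /subsetP h; case/eqP: xNy; apply: sep => //; exact: h.
rewrite cardsT in le; case: k le => [|k] le; first by lia.
exists k => //; exists A', (contraction @: S); split=> //.
- apply/(tree_colouring_quotient contraction_edge contraction_lift contraction_fibre).
    by move=> w; exists (uncontract w); apply: uncontractK.
  by rewrite -AE.
- move=> _ _ /imsetP[u uS ->] /imsetP[v vS ->].
  rewrite -(linked_quotientT contraction_edge contraction_lift contraction_fibre) -AE.
  by move/sep=> -> //.
- by rewrite cS cardsT; have := card_contract; lia.
Qed.

End Contraction.

Lemma isomorphic_contracts (G H : sgraph) : isomorphic G H -> is_tree H ->
  [/\ 0 < #|G|, forall u v : G, connect (@adj G) u v & contracts (@adj G) setT 0].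
Proof.
move=> [f bij_f fE] [H0 Hc Ha]; have [g fK gK] := bij_f.
have f_edge u v : adj u v -> f u = f v \/ adj (f u) (f v) by rewrite fE; right.
have f_lift a b : adj a b -> exists u v, [/\ f u = a, f v = b & adj u v].
  by move=> ab; exists (g a), (g b); rewrite -fE !gK.
have f_fib u v : f u = f v -> linked (@adj G) (f @^-1: [set f u]) set0 u v.
  by move/(can_inj fK)->; apply: linked0.
split.
- by rewrite (bij_eq_card bij_f).
- move=> u v; have := Hc (f u) (f v); rewrite -!linkedT.
  rewrite -(linked_quotientT f_edge f_lift f_fib).
  by have -> : f @^-1: set0 = set0 by apply/setP => w; rewrite !inE.
have acH := (ucycle_acyclic (@adj_sym H)).1 Ha.
have [A prop] := acyclic_bipartite (@adj_sym H) (@adj_irrefl H) acH.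
have tr := (acyclic_tree_colouring (@adj_sym H) prop).2 acH.
exists (f @^-1: A), setT; split; rewrite ?subsetT ?addn0 //.
  by apply/(tree_colouring_quotient f_edge f_lift f_fib) => // a; exists (g a).
move=> u v _ _ h; apply: (@connect_ind1 _ _ (fun v => u = v) _ _ _ _ h) => // a b _.
case/and4P => _ _ ab; rewrite !inE.
by have := prop (f a) (f b); rewrite fE ab => /(_ isT)/negPf->.
Qed.

Theorem tree_contractibleP (G : sgraph) k : tree_contractible G k <->
  [/\ 0 < #|G|, forall u v : G, connect (@adj G) u v & contracts (@adj G) setT k].
Proof.
split=> [[H tH [m mk]]|].
  suff : contracts_to H m G ->
      [/\ 0 < #|G|, forall u v : G, connect (@adj G) u v & contracts (@adj G) setT m].
    move=> h /h[G0 Gc [A [S [tr sS sep le]]]]; split=> //.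
    by exists A, S; split=> //; apply: leq_trans le _; rewrite leq_add2l.
  elim=> {m mk G} [G iso|m G x y xy _ [_ IHc IH]]; first exact: isomorphic_contracts iso tH.
  split; [by apply/card_gt0P; exists x|exact: (connected_contract xy).1|].
  exact: (contracts_contract xy IH).
case; move: {2}_.+1 (ltnSn #|G|) => n; elim: n G k => // n IH G k ltn G0 Gc [A [S [tr _ sep le]]].
(* Monochromatic edges are contracted as long as there are any; then the colouring is proper and the
   graph itself is a tree. *)
case: (pickP (fun p : G * G => adj p.1 p.2 && ((p.1 \in A) == (p.2 \in A)))) => /=.
  move=> [x y] /= /andP[xy /eqP xyA].
  have [m -> cm] := contract_contracts xy xyA tr sep le.
  have [|||H tH [m' m'm cH]] := IH (contract x y) m _ _ _ cm.
  - by have := card_contract xy; lia.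
  - by apply/card_gt0P; exists None.
  - exact: (connected_contract xy).2.
  by exists H => //; exists m'.+1 => //; apply: contracts_toS xy cH.
move=> noE; exists G; last first.
  by exists 0 => //; apply: contracts_to0; exists id => //; exists id.
split=> //; apply/(ucycle_acyclic (@adj_sym G)).
apply: (acyclic_tree_colouring (@adj_sym G) _).1 tr => x y xy.
by have := noE (x, y); rewrite /= xy /= => ->.
Qed.

(** * Decomposition at a cut vertex *)

Section Glue.
Variables (T : finType) (e : rel T).
Hypothesis e_sym : symmetric e.
Local Notation linked := (linked e).
Local Notation block := (block e).

(** The case [x = y] says that [v] is the only common vertex, the other case that no edge between
    the sides bypasses [v]. *)
Definition glued (U1 U2 : {set T}) v :=
  [/\ v \in U1, v \in U2
    & forall x y, x \in U1 -> y \in U2 -> e x y \/ x = y -> x = v \/ y = v].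

Lemma glued_sym U1 U2 v : glued U1 U2 v -> glued U2 U1 v.
Proof.
move=> [v1 v2 h]; split=> // x y x2 y1 xy.
by case: (h y x y1 x2); [rewrite e_sym; case: xy; auto| |]; auto.
Qed.

Section Half.
Variables (U1 U2 : {set T}) (v : T).
Hypothesis g : glued U1 U2 v.
Local Notation U := (U1 :|: U2).

(** The map that fixes [U1] and sends all other vertices to [v] takes paths to paths, since [U1] can
    be left and entered only through [v]. *)
Lemma glued_linkedW (A D : {set T}) x y : x \in U1 -> D \subset U -> linked D A x y ->
  linked (D :&: U1) A x (if y \in U1 then y else v).
Proof.
case: g => v1 v2 h x1 /subsetP DU xy.
apply: (@connect_ind1 _ _ (fun y => linked (D :&: U1) A x (if y \in U1 then y else v))
  _ _ _ _ xy); first by rewrite x1; apply: linked0.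
move=> y' z IH /and4P[yD zD yz c]; move: IH.
have [] := (DU _ yD, DU _ zD); rewrite !inE.
case: ifP => y1 /= yU; case: ifP => z1 /= zU IH //.
- apply: linked_trans IH _; apply: linked1; rewrite ?inE ?yD ?zD //; exact/eqP.
- case: (h y' z y1 zU); [by left|by move=> <-|by move=> zv; rewrite zv v1 in z1].
- case: (h z y' z1 yU); [by left; rewrite e_sym|by move=> ->|].
  by move=> yv; rewrite yv v1 in y1.
Qed.

Lemma glued_linked (A D : {set T}) x y : x \in U1 -> y \in U1 -> D \subset U ->
  linked D A x y = linked (D :&: U1) A x y.
Proof.
move=> x1 y1 DU; apply/idP/idP => [/(glued_linkedW x1 DU)|]; first by rewrite y1.
by apply: linked_sub; apply: subsetIl.
Qed.

Lemma glued_linkedU (A : {set T}) x y : x \in U1 -> y \in U1 -> linked U A x y = linked U1 A x y.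
Proof. by move=> x1 y1; rewrite glued_linked // setUK. Qed.

Lemma glued_block (A : {set T}) x : x \in U1 ->
  (U :\: block U A x) :&: U1 = U1 :\: block U1 A x.
Proof.
move=> x1; apply/setP => y; rewrite !inE.
case y1: (y \in U1); rewrite ?andbF //= !andbT.
by rewrite glued_linkedU.
Qed.

Lemma glued_restrict (A : {set T}) : tree_colouring e U A -> tree_colouring e U1 A.
Proof.
move=> tr x a b x1 a1 b1; rewrite -!glued_linkedU // => xa xb [y xy ya] [z xz zb] ab.
have sU : U1 \subset U by apply: subsetUl.
apply: (tr x); rewrite ?(subsetP sU) //.
- by exists y => //; apply: linked_sub xy.
- by exists z => //; apply: linked_sub xz.
- by apply: linked_sub ab; rewrite -glued_block //; apply: subsetIl.
Qed.

Lemma glued_side (A : {set T}) x a b y z : tree_colouring e U1 A ->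
  x \in U1 -> a \in U1 -> b \in U1 -> y \in U1 -> z \in U1 ->
  ~~ linked U A x a -> ~~ linked U A x b -> linked U A x y -> e y a ->
  linked U A x z -> e z b -> linked (U :\: block U A x) set0 a b ->
  linked U A a b.
Proof.
move=> tr x1 a1 b1 y1 z1; rewrite !glued_linkedU // => xa xb xy ya xz zb ab.
apply: (tr x) => //; [by exists y|by exists z|].
by rewrite -glued_block // -glued_linked // subsetDl.
Qed.

(* The component of [x] contains the cut vertex [v], so that the neighbours [a]
   and [b], connected while avoiding it, lie on the same side. *)
Lemma glued_through (A : {set T}) x a b y z : tree_colouring e U1 A ->
  linked U A x v -> a \in U1 -> b \in U ->
  ~~ linked U A x a -> ~~ linked U A x b -> linked U A x y -> e y a ->
  linked U A x z -> e z b -> linked (U :\: block U A x) set0 a b ->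
  linked U A a b.
Proof.
case: (g) => v1 v2 h tr xv a1 bU xa xb xy ya xz zb ab.
have av : a <> v by move=> av; rewrite av xv in xa.
have bv : b <> v by move=> bv; rewrite bv xv in xb.
have inU w : linked U A x w -> w \in U.
  move=> xw; case: (x =P w) => [xw'|/eqP nxw]; last first.
    by apply: (linked_in xw); apply: linked_neq xw nxw.
  rewrite -xw'; have vx : linked U A v x by rewrite linked_sym.
  by apply: (linked_in vx); rewrite inE v1.
have b1 : b \in U1.
  apply/negPn/negP => b1.
  have := glued_linkedW a1 (subsetDl U (block U A x)) ab; rewrite (negPf b1) => av'.
  have nav : a != v by apply/eqP.
  by have := linked_in av' (linked_neq av' nav); rewrite !inE xv.
have side w c : c \in U1 -> c <> v -> linked U A x w -> e w c -> w \in U1.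
  move=> c1 cv /inU; rewrite inE => /orP[//|w2] wc.
  by case: (h c w c1 w2); [left; rewrite e_sym|by move/cv|move=> ->].
have E : block U A x = block U A v by apply: linked_block.
have tov w : linked U A x w -> linked U A v w by apply: linked_trans; rewrite linked_sym.
have ntov w : ~~ linked U A x w -> ~~ linked U A v w by apply: contra; apply: linked_trans.
rewrite E in ab.
exact: (glued_side tr v1 a1 b1 (side _ _ a1 av xy ya) (side _ _ b1 bv xz zb)
  (ntov _ xa) (ntov _ xb) (tov _ xy) ya (tov _ xz) zb ab).
Qed.

End Half.

(** A component without [v] lies with all its neighbours on one side; a component containing [v]
    separates the sides, so neighbours joined off it are on the same side. *)
Lemma glued_tree U1 U2 v A : glued U1 U2 v ->
  tree_colouring e U1 A -> tree_colouring e U2 A -> tree_colouring e (U1 :|: U2) A.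
Proof.
move=> g tr1 tr2 x a b xU aU bU xa xb [y xy ya] [z xz zb] ab.
have g' := glued_sym g; have UC := setUC U1 U2; case: (g) => v1 v2 h.
case: (boolP (linked (U1 :|: U2) A x v)) => [xv|xv].
  case: (setUP aU) => a1; first exact: (glued_through g tr1 xv a1 bU xa xb xy ya xz zb).
  by rewrite UC in xv bU xa xb xy xz ab *; exact: (glued_through g' tr2 xv a1 bU xa xb xy ya xz zb).
have side V1 V2 : glued V1 V2 v -> tree_colouring e V1 A -> U1 :|: U2 = V1 :|: V2 ->
    x \in V1 -> linked (U1 :|: U2) A a b.
  move=> gV tr E x1; rewrite E in xv xU aU bU xa xb xy xz ab *; case: (gV) => w1 w2 hV.
  have xw w : linked (V1 :|: V2) A x w -> w \in V1 /\ w <> v.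
    move=> xw; split; last by move=> wv; rewrite -wv xw in xv.
    apply/negPn/negP => w1'; have := glued_linkedW gV x1 (subxx _) xw.
    by rewrite (negPf w1') => /(linked_sub (subsetIl _ _)); rewrite (negPf xv).
  have [[y1 yv] [z1 zv]] := (xw y xy, xw z xz).
  have nb w c : w \in V1 -> w <> v -> c \in V1 :|: V2 -> e w c -> c \in V1.
    move=> w1' wv; rewrite inE => /orP[//|c2] wc.
    by case: (hV w c w1' c2); [left|move/wv|move=> ->].
  apply: (glued_side gV tr x1 _ _ y1 z1 xa xb xy ya xz zb ab).
  - exact: nb ya.
  - exact: nb zb.
by case: (setUP xU); [apply: (side U1 U2)|apply: (side U2 U1)].
Qed.

(** [v] replaces the element of [S] in its own component, if there is one. *)
Lemma separated_through P A S v : separated e P A S -> S \subset P -> v \in P ->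
  exists S', [/\ separated e P A S', S' \subset P, v \in S' & #|S| <= #|S'|].
Proof.
move=> sep /subsetP SP vP; exists (v |: [set s in S | ~~ linked P A v s]); split.
- move=> s t; rewrite !inE => /orP[/eqP->|/andP[sS vs]] /orP[/eqP->|/andP[tS vt]] //.
  + by move=> vt'; rewrite vt' in vt.
  + by rewrite linked_sym // => vs'; rewrite vs' in vs.
  + exact: sep.
- apply/subsetP => s; rewrite !inE => /orP[/eqP-> //|/andP[sS _]]; exact: SP.
- by rewrite setU11.
rewrite cardsU1 !inE linked0 andbF /=.
have -> : #|S| = #|[set s in S | linked P A v s]| + #|[set s in S | ~~ linked P A v s]|.
  rewrite -(cardsID [set s | linked P A v s]); congr (_ + _); apply: eq_card => s.
    by rewrite !inE.
  by rewrite !inE andbC.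
rewrite leq_add2r; apply/card_le1_eqP => s t; rewrite !inE => /andP[sS vs] /andP[tS vt].
have tv : linked P A t v by rewrite linked_sym.
by apply: sep => //; apply: linked_trans tv vs.
Qed.

Lemma mono_setC P A : mono e P A =2 mono e P (~: A).
Proof. by move=> x y; rewrite /mono !inE; case: (x \in A) (y \in A) => [] []. Qed.

Lemma eq_separated P A A' S : mono e P A =2 mono e P A' ->
  separated e P A S -> separated e P A' S.
Proof. by move=> E sep x y xS yS; rewrite -(eq_linked E); apply: sep. Qed.

(** The number of contractions is the number of vertices minus that of components. Summed over the
    two sides, both counts are too large by one, because [v] and its component occur twice. *)
Lemma contracts_glued U1 U2 v k : glued U1 U2 v ->
  contracts e (U1 :|: U2) k <->
  exists k1 k2, [/\ contracts e U1 k1, contracts e U2 k2 & k1 + k2 <= k].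
Proof.
move=> g; have g' := glued_sym g; case: (g) => v1 v2 h.
have I12 : U1 :&: U2 = [set v].
  apply/setP => x; rewrite !inE; apply/andP/eqP => [[x1 x2]|->//].
  by case: (h x x x1 x2); [right| |].
have cU : #|U1 :|: U2| + 1 = #|U1| + #|U2| by rewrite -(cardsUI U1) I12 cards1.
split=> [[A [S0 [tr S0U sep0 le0]]]|[k1 [k2 [[A1 [S1 [tr1 S1U sep1 le1]]] [A2 [S2 [tr2 S2U sep2 le2]]] lek]]]].
  have vU : v \in U1 :|: U2 by rewrite inE v1.
  have [S [sep SU vS leS]] := separated_through sep0 S0U vU.
  exists (#|U1| - #|S :&: U1|), (#|U2| - #|S :&: U2|).
  have half V1 V2 : glued V1 V2 v -> U1 :|: U2 = V1 :|: V2 ->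
      contracts e V1 (#|V1| - #|S :&: V1|).
    move=> gV E; exists A, (S :&: V1); split.
    - by apply: (glued_restrict gV); rewrite -E.
    - exact: subsetIr.
    - move=> x y; rewrite !inE => /andP[xS x1] /andP[yS y1] xy; apply: sep => //.
      by rewrite E; apply: linked_sub xy; apply: subsetUl.
    - by rewrite subnKC // subset_leq_card ?subsetIr.
  split; [exact: (half U1 U2)|exact: (half U2 U1 g' (setUC _ _))|].
  have cS : #|S| + 1 = #|S :&: U1| + #|S :&: U2|.
    rewrite -(cardsUI (S :&: U1)) -setIUr (setIidPl SU) setIACA setIid I12.
    by rewrite (setIidPr _) ?cards1 // sub1set.
  have := subset_leq_card (subsetIr S U1); have := subset_leq_card (subsetIr S U2).
  lia.
have {S1 sep1 S1U le1} [S1 [sep1 S1U vS1 le1]] : exists S1,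
    [/\ separated e U1 A1 S1, S1 \subset U1, v \in S1 & #|U1| <= #|S1| + k1].
  have [S [s1 s2 s3 s4]] := separated_through sep1 S1U v1; exists S; split=> //.
  by apply: leq_trans le1 _; rewrite leq_add2r.
have {S2 sep2 S2U le2} [S2 [sep2 S2U vS2 le2]] : exists S2,
    [/\ separated e U2 A2 S2, S2 \subset U2, v \in S2 & #|U2| <= #|S2| + k2].
  have [S [s1 s2 s3 s4]] := separated_through sep2 S2U v2; exists S; split=> //.
  by apply: leq_trans le2 _; rewrite leq_add2r.
(* Exchanging the colours on one side makes the two colourings agree at [v]. *)
pose A2' := if (v \in A1) == (v \in A2) then A2 else ~: A2.
have m2 : mono e U2 A2 =2 mono e U2 A2'.
  by rewrite /A2'; case: ifP => _ //; apply: mono_setC.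
have vA : (v \in A2') = (v \in A1).
  rewrite /A2'; case: eqP => [->//|]; rewrite inE.
  by case: (v \in A1) (v \in A2) => [] [].
pose A := (A1 :&: U1) :|: (A2' :&: U2).
have both x : x \in U1 -> x \in U2 -> x = v.
  by move=> x1 x2; apply/set1P; rewrite -I12 inE x1.
have mA1 : mono e U1 A1 =2 mono e U1 A.
  have E x : x \in U1 -> (x \in A) = (x \in A1).
    move=> x1; rewrite !inE x1 andbT; case x2: (x \in U2); last by rewrite andbF orbF.
    by rewrite (both x) // vA andbT orbb.
  by move=> x y; rewrite /mono; case x1: (x \in U1); case y1: (y \in U1); rewrite //= !E.
have mA2 : mono e U2 A2' =2 mono e U2 A.
  have E x : x \in U2 -> (x \in A) = (x \in A2').
    move=> x2; rewrite !inE x2 andbT; case x1: (x \in U1); last by rewrite andbF.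
    by rewrite (both x) // vA andbT orbb.
  by move=> x y; rewrite /mono; case x1: (x \in U2); case y1: (y \in U2); rewrite //= !E.
have s1 := eq_separated mA1 sep1; have s2 := eq_separated mA2 (eq_separated m2 sep2).
exists A, (S1 :|: S2); split.
- apply: (glued_tree g); first exact: eq_tree_colouring mA1 tr1.
  exact: eq_tree_colouring mA2 (eq_tree_colouring m2 tr2).
- exact: setUSS.
- have cross V1 V2 R1 R2 x y : glued V1 V2 v -> U1 :|: U2 = V1 :|: V2 ->
      separated e V1 A R1 -> separated e V2 A R2 -> R1 \subset V1 -> R2 \subset V2 ->
      v \in R1 -> v \in R2 -> x \in R1 -> y \in R2 ->
      linked (U1 :|: U2) A x y -> x = y.
    move=> gV E p1 p2 /subsetP q1 /subsetP q2 w1 w2 xR yR; rewrite E => xy.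
    case: (gV) => u1 u2 hV; have := glued_linkedW gV (q1 _ xR) (subxx _) xy.
    rewrite setUK; case: ifP => y1 xy1.
      have yv : y = v by case: (hV y y y1 (q2 _ yR)); [right| |].
      by rewrite yv in xy1 *; apply: p1.
    have xv : x = v by apply: p1.
    rewrite xv setUC in xy *.
    have := glued_linkedW (glued_sym gV) u2 (subxx _) xy.
    by rewrite (q2 _ yR) setUK; apply: p2.
  move=> x y /setUP[x1|x2] /setUP[y1|y2] xy.
  + by apply: s1 => //; rewrite -(glued_linkedU g) // (subsetP S1U).
  + exact: (cross U1 U2 S1 S2).
  + apply/esym; apply: (cross U1 U2 S1 S2) => //; by rewrite linked_sym.
  + apply: s2 => //; rewrite -(glued_linkedU g') 1?setUC // (subsetP S2U) //.
- have cS : #|S1 :|: S2| + 1 = #|S1| + #|S2|.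
    rewrite -(cardsUI S1); congr (_ + _); apply/esym/eqP/cards1P; exists v.
    apply/eqP; rewrite eqEsubset sub1set inE vS1 vS2 andbT -I12.
    by rewrite setISS.
  lia.
Qed.

End Glue.

(** * Partial colourings of a 2-connected graph *)

Section Leaders.
Variables (n : nat) (L : rel 'I_n) (D : {set 'I_n}).
Hypotheses (L_refl : reflexive L) (L_sym : symmetric L) (L_trans : transitive L).

(** The least element of each class: representatives determined by the relation alone, hence
    computable from a state. *)
Definition leaders := [set x in D | [forall y in D, (y < x) ==> ~~ L y x]].

Lemma leader_exists x : x \in D -> exists2 r, r \in leaders & L x r.
Proof.
move=> xD; case: (@arg_minnP _ x (fun y => (y \in D) && L x y) (@nat_of_ord n)).
  by rewrite xD L_refl.
move=> r /andP[rD xr] rmin; exists r => //; rewrite inE rD; apply/forall_inP => y yD.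
apply/implyP => yr; apply/negP => Lyr; have := rmin y.
by rewrite yD (L_trans xr) 1?L_sym // => /(_ isT); rewrite leqNgt yr.
Qed.

Lemma leader_unique x y : x \in leaders -> y \in leaders -> L x y -> x = y.
Proof.
rewrite !inE => /andP[xD /forall_inP xm] /andP[yD /forall_inP ym] xy; apply: val_inj => /=.
case: (ltngtP x y) => // lt.
  by have := ym _ xD; rewrite lt xy.
by have := xm _ yD; rewrite lt L_sym xy.
Qed.

Lemma leaders_sub : leaders \subset D.
Proof. by apply/subsetP => x; rewrite inE => /andP[]. Qed.

End Leaders.

Section Local.
Variables (n : nat) (e : rel 'I_n).
Hypothesis e_sym : symmetric e.
Local Notation linked := (linked e).
Local Notation block := (block e).
Local Notation tree_colouring := (tree_colouring e).
Implicit Types (P Z A Q S : {set 'I_n}) (v w x y z q r s : 'I_n).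

Definition sees P Z (A : {set 'I_n}) v := [exists y, [&& y \in P, y \in Z, e v y & y \in A]].
Definition uncoloured P Z v := [set y in P | (y \notin Z) && e v y].
Definition settled P Z A v := (#|uncoloured P Z v| == 0) && (sees P Z A v (+) sees P Z (~: A) v).
Definition unsettled P Z A v := [&& v \in P, v \notin Z & ~~ settled P Z A v].
(** Every uncoloured vertex takes the colour it sees and so joins its neighbours. The components
    that meet [Z] are then as large as any choice of joining vertices could make them. *)
Definition filled P Z A := [set x in P | if x \in Z then x \in A else sees P Z A x].
(** One vertex of each component coloured so far; [block_leaders] has one of each block into which
    these must be connected. The difference in size is the number of mergers still due. *)
Definition coloured_leaders P Z A := leaders (linked (P :&: Z) A) (P :&: Z).
Definition block_leaders P Z A := leaders (linked P (filled P Z A)) (P :&: Z).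
Definition hits P Z A q r :=
  [exists y, [&& y \in P :&: Z, e q y & linked (P :&: Z) A y r]].

Section Settled.
Variables P Z A : {set 'I_n}.
Hypothesis all_settled : forall v, ~~ unsettled P Z A v.
Local Notation PZ := (P :&: Z).
Local Notation I := (P :\: Z).
Local Notation Phi := (filled P Z A).

Lemma settled_edge v y : v \in I -> y \in P -> e v y ->
  y \in Z /\ (y \in A) = (v \in Phi).
Proof.
rewrite inE => /andP[vZ vP] yP vy.
have := all_settled v; rewrite /unsettled vP vZ negbK => /andP[/eqP c0 sAB].
have yZ : y \in Z.
  apply/negPn/negP => yZ; move/eqP: c0; apply/negP; rewrite -lt0n.
  by apply/card_gt0P; exists y; rewrite inE yP yZ.
split=> //; rewrite inE vP (negPf vZ) /=.
apply/idP/idP => [yA|sA]; first by apply/existsP; exists y; rewrite yP yZ vy.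
apply/negPn/negP => yA; move: sAB; rewrite sA /=; apply/negP; rewrite negbK.
by apply/existsP; exists y; rewrite yP yZ vy inE.
Qed.

Lemma filled_coloured z : z \in PZ -> (z \in Phi) = (z \in A).
Proof. by rewrite !inE => /andP[-> ->]. Qed.

Lemma settled_mono v y : v \in I -> y \in P -> e v y -> y \in PZ /\ (y \in Phi) = (v \in Phi).
Proof.
move=> vI yP vy; have [yZ yA] := settled_edge vI yP vy.
have yPZ : y \in PZ by rewrite inE yP.
by rewrite filled_coloured.
Qed.

(* The colouring in which exactly the uncoloured vertices in [Q] join the block
   of their neighbours. *)
Definition joining Q := [set x in P | (x \in Phi) (+) ((x \notin Z) && (x \notin Q))].

(** An uncoloured vertex outside [Q] gets the colour opposite to that of its neighbours, which are
    all coloured and of one colour; so no monochromatic edge meets it. *)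
Lemma mono_joining Q : Q \subset I -> mono e P (joining Q) =2 mono e (PZ :|: Q) Phi.
Proof.
move=> /subsetP QI x y; rewrite /mono.
have KP z : z \in PZ :|: Q -> z \in P.
  by rewrite !inE => /orP[/andP[]//|/QI]; rewrite inE => /andP[].
case xP: (x \in P); last by case xK: (x \in PZ :|: Q) => //; rewrite KP in xP.
case yP: (y \in P); last first.
  by rewrite /=; case yK: (y \in PZ :|: Q); [rewrite KP in yP|rewrite /= andbF].
case xy: (e x y); rewrite ?andbF //= !inE xP yP /=.
case xZ: (x \in Z); case yZ: (y \in Z); rewrite ?orbT ?addbF //=.
- have yI : y \in I by rewrite inE yZ.
  have [_ h] := settled_mono yI xP (etrans (e_sym _ _) xy).
  move: h; rewrite !inE xP yP xZ yZ /= => ->.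
  by case: (y \in Q); case: (sees _ _ _ _).
- have xI : x \in I by rewrite inE xZ.
  have [_ h] := settled_mono xI yP xy.
  move: h; rewrite !inE xP yP xZ yZ /= => ->.
  by case: (x \in Q); case: (sees _ _ _ _).
- have xI : x \in I by rewrite inE xZ.
  by have [] := settled_edge xI yP xy; rewrite yZ.
Qed.

Lemma linked_joining Q : Q \subset I -> linked P (joining Q) =2 linked (PZ :|: Q) Phi.
Proof. by move=> QI; apply/eq_linked/mono_joining. Qed.

Definition connecting Q :=
  forall x y, x \in PZ -> y \in PZ -> linked P Phi x y -> linked (PZ :|: Q) Phi x y.

Lemma joined_sub Q : Q \subset I -> PZ :|: Q \subset P.
Proof.
move=> QI; rewrite subUset subsetIl; apply: subset_trans QI _; exact: subsetDl.
Qed.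

(** Acyclicity depends only on the grouping of the coloured vertices, which is the same for all
    connecting sets: an uncoloured vertex has its neighbours in a single block and closes no cycle,
    whether it joins or not. The search can therefore test the colouring before it knows which
    vertices join. *)
Lemma joining_tree Q Q' : Q \subset I -> Q' \subset I -> connecting Q -> connecting Q' ->
  tree_colouring P (joining Q) -> tree_colouring P (joining Q').
Proof.
move=> QI QI' cQ cQ' tr x a b xP aP bP; rewrite !linked_joining //.
have SP := joined_sub QI; have SP' := joined_sub QI'.
have blkE : block P (joining Q') x = block (PZ :|: Q') Phi x.
  by apply/setP => z; rewrite !inE linked_joining.
rewrite blkE => xa xb [y]; rewrite linked_joining // => xy ya [z].
rewrite linked_joining // => xz zb ab.
have inP w : linked (PZ :|: Q') Phi x w -> w \in P.
  case: (x =P w) => [<- //|/eqP nxw] xw.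
  by apply: (subsetP SP'); apply: (linked_in xw); apply: linked_neq xw nxw.
have cases w : w \in P -> w \in PZ \/ w \in I.
  by move=> wP; rewrite !inE wP; case: (w \in Z); [left|right].
have IPhi v w : v \in I -> w \in P -> e v w -> linked P Phi v w.
  move=> vI wP vw; have [wZ wc] := settled_mono vI wP vw.
  by apply: linked1 => //; move: vI; rewrite inE => /andP[].
have INN v w w' : v \in I -> w \in P -> w' \in P -> e v w -> e v w' ->
    linked (PZ :|: Q') Phi w w'.
  move=> vI wP wP' vw vw'; have [wZ _] := settled_mono vI wP vw.
  have [wZ' _] := settled_mono vI wP' vw'; apply: cQ' => //.
  apply: linked_trans (IPhi v w' vI wP' vw'); rewrite linked_sym //; exact: IPhi.
(* A vertex of [I] adjacent to the block of [x] has no neighbour outside it. *)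
have isolated v w : v \in I -> w \in P -> linked (PZ :|: Q') Phi x w -> e v w ->
    forall u, mono e (P :\: block (PZ :|: Q') Phi x) set0 v u -> False.
  move=> vI wP xw vw u /and4P[_ uD vu _]; move: uD; rewrite !inE => /andP[xu uP].
  by move/negP: xu; apply; apply: linked_trans xw (INN v w u vI wP uP vw vu).
(* If [x] is uncoloured and does not join, its component is [x] alone, and all its neighbours are in
   one block. *)
case: (boolP (x \in PZ :|: Q')) => xK; last first.
  have xI : x \in I.
    case: (cases x xP) => // xPZ; case/negP: xK; by rewrite inE xPZ.
  have single w : linked (PZ :|: Q') Phi x w -> w = x.
    move=> xw; apply/eqP/negPn/negP; rewrite eq_sym => nxw.
    by case/negP: xK; apply: linked_neq xw nxw.
  move/single: xy ya => -> xa'; move/single: xz zb => -> xb'.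
  exact: (INN x).
case: (cases a aP) => [aZ|aI]; last first.
  case/connectP: ab => -[|c p] /=; first by move=> _ ->; apply: linked0.
  case/andP => ac _; case: (isolated a y aI (inP y xy) xy _ c ac).
  by rewrite e_sym.
case: (cases b bP) => [bZ|bI]; last first.
  move: ab; rewrite linked_sym //; case/connectP => -[|c p] /=.
    by move=> _ ->; apply: linked0.
  case/andP => bc _; case: (isolated b z bI (inP z xz) xz _ c bc).
  by rewrite e_sym.
have other w c : c \in PZ -> ~~ linked (PZ :|: Q') Phi x c ->
    linked (PZ :|: Q') Phi x w -> e w c -> w \in PZ /\ (w \in Phi) != (c \in Phi).
  move=> cZ xc xw wc; have wK : w \in PZ :|: Q' by apply: linked_in xw xK.
  have cK : c \in PZ :|: Q' by rewrite inE cZ.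
  have nc : (w \in Phi) != (c \in Phi).
    apply/negP => /eqP E; case/negP: xc; apply: linked_trans xw _; exact: linked1.
  split=> //; case: (cases w (inP w xw)) => // wI.
  have cP : c \in P by move: cZ; rewrite inE => /andP[].
  by have [_ E] := settled_mono wI cP wc; rewrite E eqxx in nc.
have [yZ ync] := other y a aZ xa xy ya; have [zZ znc] := other z b bZ xb xz zb.
have yzP : linked P Phi y z.
  by apply: (linked_sub SP'); apply: linked_trans xz; rewrite linked_sym.
have toP w w' : linked (PZ :|: Q) Phi w w' -> linked P Phi w w' by apply: linked_sub.
have yz : linked (PZ :|: Q) Phi y z by apply: cQ.
suff h : linked P (joining Q) a b by apply: cQ' => //; apply: toP; rewrite -linked_joining.
(* The coloured vertex [y] of the component replaces [x], which may belong to [Q'] but not to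
   [Q]. *)
apply: (tr y) => //; rewrite ?linked_joining //; first exact: inP xy.
- by apply/negP => /linked_colour E; rewrite E eqxx in ync.
- apply/negP => /linked_colour E; have := linked_colour yz.
  by rewrite -E => zE; rewrite zE eqxx in znc.
- by exists y => //; apply: linked0.
- by exists z => //; rewrite linked_joining.
have -> : block P (joining Q) y = block (PZ :|: Q) Phi y.
  by apply/setP => w; rewrite !inE linked_joining.
apply: linked_mono ab => u v uv; case/and4P: (uv) => uD vD euv _.
have step c d : mono e (P :\: block (PZ :|: Q') Phi x) set0 c d ->
    c \in P :\: block (PZ :|: Q) Phi y.
  move=> cd; case/and4P: (cd); rewrite !inE => /andP[xc cP] /andP[_ dP] ecd _.
  rewrite cP andbT; apply/negP => yc.
  case: (cases c cP) => [cZ|cI].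
    by case/negP: xc; apply: linked_trans xy _; apply: cQ' => //; apply: toP.
  have [dZ _] := settled_mono cI dP ecd.
  have yd : linked P Phi y d by apply: linked_trans (toP _ _ yc) (IPhi c d cI dP ecd).
  apply: (isolated c d cI dP _ ecd d cd).
  by apply: linked_trans xy _; apply: cQ'.
have vu : mono e (P :\: block (PZ :|: Q') Phi x) set0 v u by rewrite (mono_edge_sym e_sym).
by rewrite /mono (step _ _ uv) (step _ _ vu) euv !inE eqxx.
Qed.

Lemma linked_PZ : linked PZ A =2 linked PZ Phi.
Proof.
apply: eq_linked => x y; rewrite /mono; case xZ: (x \in PZ); case yZ: (y \in PZ) => //=.
by rewrite !filled_coloured.
Qed.

Local Notation Rep := (coloured_leaders P Z A).
Local Notation Rt := (block_leaders P Z A).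

Lemma Rep_exists x : x \in PZ -> exists2 r, r \in Rep & linked PZ A x r.
Proof.
apply: leader_exists; [exact: linked0|move=> u v; exact: linked_sym|].
move=> v u w; exact: linked_trans.
Qed.

Lemma Rt_exists x : x \in PZ -> exists2 r, r \in Rt & linked P Phi x r.
Proof.
apply: leader_exists; [exact: linked0|move=> u v; exact: linked_sym|].
move=> v u w; exact: linked_trans.
Qed.

Lemma Rep_unique x y : x \in Rep -> y \in Rep -> linked PZ A x y -> x = y.
Proof. by apply: leader_unique => u v; exact: linked_sym. Qed.

Lemma Rt_unique x y : x \in Rt -> y \in Rt -> linked P Phi x y -> x = y.
Proof. by apply: leader_unique => u v; exact: linked_sym. Qed.

Lemma Rep_sub : Rep \subset PZ. Proof. exact: leaders_sub. Qed.
Lemma Rt_sub : Rt \subset PZ. Proof. exact: leaders_sub. Qed.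

Lemma linked_PZ_P x y : linked PZ A x y -> linked P Phi x y.
Proof. by rewrite linked_PZ; apply: linked_sub; apply: subsetIl. Qed.

(** The least coloured vertex of a block is in particular least in its coloured component. *)
Lemma Rt_Rep : Rt \subset Rep.
Proof.
apply/subsetP => x; rewrite !inE => /andP[-> /forall_inP h]; apply/forall_inP => y yD.
apply/implyP => yx; have := h y yD; rewrite yx /=; apply: contra; exact: linked_PZ_P.
Qed.

(** Representatives are the block leaders and the uncoloured vertices that do not join. *)
Lemma joining_contracts Q : Q \subset I -> connecting Q ->
  tree_colouring P (joining Q) -> contracts e P (#|PZ| - #|Rt| + #|Q|).
Proof.
move=> QI cQ tr; exists (joining Q), (Rt :|: (I :\: Q)); split=> //.
- rewrite subUset (subset_trans Rt_sub (subsetIl _ _)).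
  by apply: subset_trans (subsetDl _ _) (subsetDl _ _).
- have alone x y : x \in I :\: Q -> linked P (joining Q) x y -> x = y.
    rewrite linked_joining // => xI xy; apply/eqP/negPn/negP => /(linked_neq xy).
    move: xI; rewrite !inE => /and3P[xQ xZ xP].
    by rewrite (negPf xZ) (negPf xQ) andbF.
  move=> x y /setUP[xR|xI] /setUP[yR|yI] xy; try exact: alone xy.
    apply: Rt_unique => //; move: xy; rewrite linked_joining //.
    exact: (linked_sub (joined_sub QI)).
  by apply/esym/(alone y x yI); rewrite linked_sym.
have dis : Rt :&: (I :\: Q) = set0.
  apply/setP => x; rewrite !inE; apply/negP.
  by case/andP => /andP[/andP[_ ->]]; rewrite /= andbF.
have -> : #|Rt :|: (I :\: Q)| = #|Rt| + (#|I| - #|Q|).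
  by rewrite cardsU dis cards0 subn0 (cardsD I Q) (setIidPr QI).
rewrite -(cardsID Z P); move: (subset_leq_card QI) (subset_leq_card Rt_sub).
by move: #|Rt| #|I| #|Q| #|PZ| => *; lia.
Qed.

(** [S] is the set [R] of a state. For [S = Rep] the empty [Q] will do; for [S = Rt] the condition
    says that [Q] connects every block. *)
Definition joined Q S := forall r, r \in Rep ->
  exists2 s, s \in S & linked (PZ :|: Q) Phi r s.

Lemma joined_Rt Q : Q \subset I -> joined Q Rt -> connecting Q.
Proof.
move=> QI jQ x y xZ yZ xy; have SP := joined_sub QI.
have inPZ u v : linked PZ A u v -> linked (PZ :|: Q) Phi u v.
  by rewrite linked_PZ; apply: linked_sub; apply: subsetUl.
have [rx rxR xrx] := Rep_exists xZ; have [ry ryR yry] := Rep_exists yZ.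
have [s sR rs] := jQ _ rxR; have [t tR rt] := jQ _ ryR.
have xs := linked_trans (inPZ _ _ xrx) rs; have yt := linked_trans (inPZ _ _ yry) rt.
have st : s = t.
  apply: Rt_unique => //; have sx : linked P Phi s x.
    by rewrite linked_sym //; apply: linked_sub xs.
  by apply: linked_trans sx (linked_trans xy _); apply: linked_sub yt.
by apply: linked_trans xs _; rewrite linked_sym // st.
Qed.

Lemma joined_step Q S q s : q \in I -> s \in S -> hits P Z A q s ->
  joined Q (S :|: [set r in Rep | hits P Z A q r]) -> joined (q |: Q) S.
Proof.
move=> qI sS qs jQ r rR; have [t tS rt] := jQ r rR.
have sub : PZ :|: Q \subset PZ :|: (q |: Q) by apply: setUS; apply: subsetUr.
have rt' := linked_sub sub rt; case/setUP: tS => [tS|]; first by exists t.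
rewrite inE => /andP[_ qt]; exists s => //; apply: linked_trans rt' _.
have hit u : hits P Z A q u -> linked (PZ :|: (q |: Q)) Phi q u.
  case/existsP => y /and3P[yZ qy yu].
  have yP : y \in P by move: yZ; rewrite inE => /andP[].
  have [_ yc] := settled_mono qI yP qy.
  apply: (@linked_trans _ _ _ _ _ y).
    by apply: linked1; rewrite // !inE ?eqxx ?orbT //; move: yZ; rewrite inE => ->.
  by move: yu; rewrite linked_PZ; apply: linked_sub; apply: subsetUl.
by apply: linked_trans (hit s qs); rewrite linked_sym //; apply: hit.
Qed.

(** A path through coloured vertices and [Q], from a leader in [Rt] to one outside [S], leaves the
    region attached to [S] at some [q] in [Q]. All components hit by vertices of [D] are already in
    [S], so [q] is not one of them. *)
Lemma joined_progress Q S (D : {set 'I_n}) : Q \subset I -> connecting Q -> Rt \subset S -> S \subset Rep ->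
  S != Rep -> (forall q r, q \in D -> r \in Rep -> hits P Z A q r -> r \in S) ->
  exists q s, [/\ q \in Q, q \notin D, s \in S & hits P Z A q s].
Proof.
move=> /subsetP QI cQ /subsetP RS /subsetP SR SNR sat.
have /properP[_ [r rR rS]] : S \proper Rep by rewrite properEneq SNR; apply/subsetP.
have rZ := subsetP Rep_sub r rR; have [r0 r0R rr0] := Rt_exists rZ.
have r0Z := subsetP Rt_sub r0 r0R.
pose good w := if w \in Z then [exists s in S, linked PZ A w s]
               else [exists s in S, hits P Z A w s].
have good0 : good r0.
  rewrite /good; move: (r0Z); rewrite inE => /andP[_ ->]; apply/exists_inP.
  by exists r0; [apply: RS|apply: linked0].
have goodr : ~~ good r.
  rewrite /good; move: (rZ); rewrite inE => /andP[_ ->]; apply/exists_inP => -[s sS rs].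
  by rewrite (Rep_unique rR (SR _ sS) rs) sS in rS.
have r0r : linked (PZ :|: Q) Phi r0 r by apply: cQ => //; rewrite linked_sym.
have [u [v [gu gv /and4P[uK vK uv /eqP c]]]] := connect_out good0 goodr r0r.
have inP w : w \in PZ :|: Q -> w \in P.
  by rewrite !inE => /orP[/andP[]//|/QI]; rewrite inE => /andP[].
have cases w : w \in PZ :|: Q -> (w \in PZ /\ w \in Z) \/ [/\ w \in Q, w \in I & w \notin Z].
  rewrite inE => /orP[wZ|wQ]; first by left; split=> //; move: wZ; rewrite inE => /andP[].
  by right; have wI := QI _ wQ; split=> //; move: wI; rewrite inE => /andP[].
case: (cases u uK) => [[uPZ uZ]|[uQ uI uZ]].
  move: gu; rewrite /good uZ => /exists_inP[s sS us].
  case: (cases v vK) => [[vPZ vZ]|[vQ vI vZ]]; move: gv; rewrite /good ?vZ ?(negPf vZ) => gv.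
    case/negP: gv; apply/exists_inP; exists s => //.
    have vu : linked PZ A v u by rewrite linked_PZ; apply: linked1; rewrite // e_sym.
    exact: linked_trans vu us.
  case/negP: gv; apply/exists_inP; exists s => //; apply/existsP; exists u.
  by rewrite uPZ e_sym uv.
move: gu; rewrite /good (negPf uZ) => /exists_inP[s sS us].
have [vPZ _] := settled_mono uI (inP v vK) uv; have vZ : v \in Z by move: vPZ; rewrite inE => /andP[].
have [r' rR' vr'] := Rep_exists vPZ.
exists u, s; split=> //; apply/negP => uD.
have uhit : hits P Z A u r' by apply/existsP; exists v; rewrite vPZ uv.
move: gv; rewrite /good vZ => /negP; apply; apply/exists_inP; exists r' => //.
exact: sat uhit.
Qed.

End Settled.
End Local.

(** * The blocks of a solution and their potential *)

Section Biconnected.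
Variables (n : nat) (e : rel 'I_n).
Hypotheses (e_sym : symmetric e) (e_irr : irreflexive e).
Local Notation linked := (linked e).
Local Notation block := (block e).
Local Notation tree_colouring := (tree_colouring e).
Implicit Types (P Z A F Q S V W : {set 'I_n}) (v w x y z q r s : 'I_n).

Definition biconnected P := [forall x in P, forall a in P, forall b in P,
  (a != x) ==> (b != x) ==> linked (P :\ x) set0 a b].

Variables P A0 S0 : {set 'I_n}.
Variable kappa : nat.
Hypothesis P_bic : biconnected P.
Hypothesis P_gt2 : 2 < #|P|.
Hypothesis A0_tree : tree_colouring P A0.
Hypothesis S0_sub : S0 \subset P.
Hypothesis S0_sep : separated e P A0 S0.
Hypothesis S0_card : #|P| <= #|S0| + kappa.

(* The vertices in blocks with at least two elements: those involved in a
   contraction.  Since [P] is 2-connected, all other blocks are leaves of the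
   tree. *)
Definition busy := [set x in P | [exists y, (y != x) && linked P A0 x y]].
Local Notation X := busy.
Local Notation blk := (block P A0).

Lemma bicP x a b : x \in P -> a \in P -> b \in P -> a != x -> b != x ->
  linked (P :\ x) set0 a b.
Proof.
move=> xP aP bP ax bx; have /forall_inP/(_ x xP)/forall_inP/(_ a aP) := P_bic.
by move/forall_inP/(_ b bP); rewrite ax bx.
Qed.

Lemma third a b : exists2 c, c \in P & (c != a) && (c != b).
Proof.
have : 0 < #|P :\: [set a; b]|.
  rewrite cardsD subn_gt0; apply: leq_ltn_trans P_gt2.
  apply: leq_trans (subset_leq_card (subsetIr P [set a; b])) _.
  by rewrite cards2; case: (a != b).
by case/card_gt0P => c; rewrite !inE negb_or => /andP[ab cP]; exists c.
Qed.

Lemma connected_P a b : a \in P -> b \in P -> linked P set0 a b.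
Proof.
move=> aP bP; have [c cP /andP[ca cb]] := third a b.
by apply: (linked_sub (subsetDl P [set c])); apply: bicP; rewrite // eq_sym.
Qed.

Lemma busyP x : x \in X -> x \in P. Proof. by rewrite inE => /andP[]. Qed.

Lemma idle_alone l y : l \in P -> l \notin X -> linked P A0 l y -> y = l.
Proof.
move=> lP; rewrite inE lP negb_exists => /forallP/(_ y).
by rewrite negb_and negbK => /orP[/eqP//|/negP].
Qed.

(** Removing [l] leaves [P] connected, so two neighbours of [l] are joined off its block, which is
    [l] alone; the tree condition puts them into one block. *)
Lemma idle_linked l a b : l \in P -> l \notin X -> a \in P -> b \in P -> e l a -> e l b ->
  linked P A0 a b.
Proof.
move=> lP lX aP bP la lb.
have ne c : e l c -> c != l by apply: contraTneq => ->; rewrite e_irr.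
have nl c : e l c -> ~~ linked P A0 l c.
  by move=> lc; apply/negP => /(idle_alone lP lX) cl; have := ne c lc; rewrite cl eqxx.
apply: (A0_tree lP) => //; rewrite ?nl //; try by exists l => //; apply: linked0.
have -> : blk l = [set l].
  apply/setP => c; rewrite !inE; apply/idP/eqP => [|->]; last exact: linked0.
  exact: idle_alone.
by apply: bicP; rewrite ?ne.
Qed.

Lemma idle_colour l a : l \in P -> l \notin X -> a \in P -> e l a -> (a \in A0) != (l \in A0).
Proof.
move=> lP lX aP la; apply/negP => /eqP E.
have := idle_alone lP lX (linked1 lP aP la (esym E)) => al.
by rewrite al e_irr in la.
Qed.

Lemma neighbour_avoiding l a : l \in P -> a \in P -> l != a ->
  exists b, [/\ b \in P, b != a & e l b].
Proof.
move=> lP aP la; have [c cP /andP[cl ca]] := third l a.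
have : linked (P :\ a) set0 l c by apply: bicP.
case/connectP => -[|b p] /=; first by move=> _ E; rewrite E eqxx in cl.
case/andP => /and4P[_ bP lb _] _ _; exists b.
by move: bP; rewrite !inE => /andP[ba bP]; rewrite ba.
Qed.

Lemma idle_neighbour l : l \in P -> exists2 b, b \in P & e l b.
Proof.
move=> lP; have [c cP /andP[cl _]] := third l l.
by have [|b [bP _ lb]] := neighbour_avoiding lP cP; [rewrite eq_sym|exists b].
Qed.

(** By 2-connectedness [l] has a second neighbour, and it shares the block of [a]. *)
Lemma idle_busy l a : l \in P -> l \notin X -> a \in P -> e l a -> a \in X.
Proof.
move=> lP lX aP la; have nla : l != a by apply: contraTneq la => ->; rewrite e_irr.
have [b [bP ba lb]] := neighbour_avoiding lP aP nla.
by rewrite inE aP; apply/existsP; exists b; rewrite ba (idle_linked lP lX).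
Qed.

Lemma busy_neighbour x : x \in X ->
  exists y, [/\ y \in X, e x y, (y \in A0) = (x \in A0) & linked P A0 x y].
Proof.
move=> xX; have xP := busyP xX; move: xX; rewrite inE xP => /existsP[y /andP[yx]].
case/connectP => -[|z p] /=; first by move=> _ E; rewrite E eqxx in yx.
case/andP => xz _ _; have /and4P[_ zP exz /eqP c] := xz.
have lxz : linked P A0 x z by apply: connect1.
exists z; split=> //; rewrite inE zP; apply/existsP; exists x.
rewrite linked_sym // lxz andbT.
by apply: contraTneq exz => ->; rewrite e_irr.
Qed.

Definition blocks Z := [set blk x | x in Z].
Definition part Z W := #|[set x in Z | blk x == W]|.

Lemma sum_part Z : Z \subset X -> \sum_(W in blocks X) part Z W = #|Z|.
Proof.
move=> /subsetP ZX; rewrite -sum1_card (partition_big blk (mem (blocks X))) /=; last first.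
  by move=> x xZ; apply: imset_f; apply: ZX.
apply: eq_bigr => W _; rewrite /part -sum1_card.
by apply: eq_bigl => x; rewrite inE.
Qed.

Lemma sum_blocks Z : Z \subset X -> \sum_(W in blocks X) (0 < part Z W) = #|blocks Z|.
Proof.
move=> ZX; rewrite -sum1_card [RHS](big_setID (blocks X)) /= [X in _ = _ + X]big1 ?addn0.
  rewrite [RHS]big_mkcond [LHS]big_mkcond; apply: eq_bigr => W _.
  rewrite !inE; case: (W \in blocks X); rewrite ?andbF // andbT.
  have -> : (0 < part Z W) = (W \in blocks Z); last by case: (_ \in _).
  apply/card_gt0P/imsetP => [[x]|[x xZ ->]]; last by exists x; rewrite inE xZ /=.
  by rewrite inE => /andP[xZ /eqP <-]; exists x.
by move=> W; rewrite !inE => /andP[/negP WX] /(subsetP (imsetS blk ZX)).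
Qed.

Lemma part_sub Z Z' W : Z \subset Z' -> part Z W <= part Z' W.
Proof.
move=> /subsetP h; apply/subset_leq_card/subsetP => x.
by rewrite !inE => /andP[/h -> ->].
Qed.

Lemma part_busy W : W \in blocks X -> 1 < part X W.
Proof.
case/imsetP => x xX ->; have [y [yX exy _ lxy]] := busy_neighbour xX.
have xy : x != y by apply: contraTneq exy => ->; rewrite e_irr.
apply: leq_trans (_ : #|[set x; y]| <= _); first by rewrite cards2 xy.
have sx : x \in [set z in X | blk z == blk x] by rewrite inE xX eqxx.
have sy : y \in [set z in X | blk z == blk x].
  by rewrite inE yX eq_sym; apply/eqP/linked_block.
by apply: subset_leq_card; apply/subsetP => z /set2P[]->.
Qed.

(** [S0] has at most one vertex in each block of [X], so at least [|X| - |blocks X|] vertices are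
    missing from it. *)
Lemma busy_leq : #|X| <= kappa + #|blocks X|.
Proof.
have XP : X \subset P by apply/subsetP => x /busyP.
have : #|S0| <= #|blocks X| + #|P :\: X|.
  rewrite -(cardsID X S0) leq_add //; last by rewrite subset_leq_card ?setSD.
  rewrite -(card_in_imset (f := blk)); first by apply/subset_leq_card/imsetS/subsetIr.
  move=> x y; rewrite !inE => /andP[xS _] /andP[yS _] E; apply: S0_sep => //.
  by rewrite -mem_block E mem_block linked0.
have := cardsID X P; rewrite (setIidPr XP).
by move: S0_card; move: #|P| #|S0| #|X| #|blocks X| #|P :\: X| => *; lia.
Qed.

(** Anchors bound the number of coloured components from above and need no update when components
    merge. *)
Definition anchored Z A F := F \subset Z /\
  forall x, x \in Z -> exists2 y, y \in F & linked Z A x y.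

Lemma part_anchored Z F W : Z \subset P -> F \subset Z ->
  (forall x, x \in Z -> exists2 y, y \in F & linked P A0 x y) ->
  0 < part Z W -> 0 < part F W.
Proof.
move=> /subsetP ZP FZ anc /card_gt0P[x]; rewrite inE => /andP[xZ /eqP <-].
have [y yF xy] := anc x xZ; apply/card_gt0P; exists y.
by rewrite inE yF eq_sym; apply/eqP/linked_block.
Qed.

(* In units of 1/16 contraction: a block of [w >= 2] vertices, [j] of them
   coloured and [f >= 1] of these anchors, satisfies [10 j - f - 3 <= 16 (w - 1)]. *)
Lemma potential_bound Z F : Z \subset X -> F \subset Z ->
  (forall x, x \in Z -> exists2 y, y \in F & linked P A0 x y) ->
  10 * #|Z| <= 16 * kappa + #|F| + 3 * #|blocks Z|.
Proof.
move=> ZX FZ anc; have FX := subset_trans FZ ZX.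
have XP : X \subset P by apply/subsetP => x /busyP.
have : \sum_(W in blocks X) (10 * part Z W + 16) <=
       \sum_(W in blocks X) (16 * part X W + part F W + 3 * (0 < part Z W)).
  apply: leq_sum => W WX; have := part_busy WX; have := part_sub W ZX.
  have := part_anchored (W := W) (subset_trans ZX XP) FZ anc.
  by case: (posnP (part Z W)) => [z0 _|zp /(_ isT)]; rewrite ?z0 /=; lia.
have sumM c (G : {set 'I_n} -> nat) :
    \sum_(W in blocks X) c * G W = c * \sum_(W in blocks X) G W by rewrite big_distrr.
have -> : \sum_(W in blocks X) (10 * part Z W + 16) = 10 * #|Z| + #|blocks X| * 16.
  by rewrite big_split sumM sum_part // sum_nat_const.
have -> : \sum_(W in blocks X) (16 * part X W + part F W + 3 * (0 < part Z W)) =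
    16 * #|X| + #|F| + 3 * #|blocks Z|.
  by rewrite big_split [X in X + _ = _]big_split !sumM !sum_part // sum_blocks.
have := busy_leq; move: #|Z| #|X| #|F| #|blocks Z| #|blocks X| => *; lia.
Qed.

Definition agrees Z A := forall x, x \in Z -> (x \in A) = (x \in A0).

Lemma linked_agree Z A x y : Z \subset P -> agrees Z A -> linked Z A x y -> linked P A0 x y.
Proof.
move=> /subsetP ZP ag; apply: linked_mono => u v /and4P[uZ vZ uv /eqP c].
by rewrite /mono !ZP // uv -!ag // c eqxx.
Qed.

Section Final.
Variables (Z A : {set 'I_n}).
Hypothesis ZX : Z \subset X.
Hypothesis ZA : agrees Z A.
Hypothesis all_settled : forall v, ~~ unsettled e P Z A v.
Local Notation PZ := (P :&: Z).
Local Notation I := (P :\: Z).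
Local Notation Phi := (filled e P Z A).
Local Notation Q0 := (X :\: Z).
Local Notation Rep := (coloured_leaders e P Z A).
Local Notation Rt := (block_leaders e P Z A).

Lemma Z_sub_P : Z \subset P.
Proof. by apply: subset_trans ZX _; apply/subsetP => x /busyP. Qed.

Lemma PZ_Z : PZ = Z.
Proof. exact/setIidPr/Z_sub_P. Qed.

Lemma Q0_sub : Q0 \subset I.
Proof. by apply: setSD; apply/subsetP => x /busyP. Qed.

(** The solution itself has the form [joining]: the busy uncoloured vertices join, and the idle
    ones, being leaves, have the colour opposite to that of their neighbours. *)
Lemma joining_busy : mono e P A0 =2 mono e P (joining e P Z A Q0).
Proof.
suff E x : x \in P -> (x \in joining e P Z A Q0) = (x \in A0).
  by move=> x y; rewrite /mono; case xP: (x \in P); case yP: (y \in P); rewrite //= !E.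
move=> xP; rewrite /joining in_set xP /=; case xZ: (x \in Z) => /=.
  by rewrite addbF filled_coloured ?ZA // inE xP.
have xI : x \in I by rewrite inE xZ.
rewrite in_setD xZ /=; case: (boolP (x \in X)) => xX /=.
  have [y [yX xy yA _]] := busy_neighbour xX.
  have [yZ yPhi] := settled_edge all_settled xI (busyP yX) xy.
  by rewrite addbF -yPhi ZA.
have [y yP xy] := idle_neighbour xP.
have [yZ yPhi] := settled_edge all_settled xI yP xy.
have := idle_colour xP xX yP xy; rewrite -yPhi ZA //.
by case: (x \in A0) (y \in A0) => [] [].
Qed.

Lemma linked_busy : linked P A0 =2 linked (PZ :|: Q0) Phi.
Proof.
by move=> x y; rewrite (eq_linked joining_busy) linked_joining // Q0_sub.
Qed.

(** A path through an idle vertex can be rerouted: the solution already links the neighbours of such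
    a vertex within one block. *)
Lemma connecting_busy : connecting e P Z A Q0.
Proof.
move=> x y xZ yZ xy.
(* At an uncoloured vertex, the induction remembers a coloured neighbour that is linked to [x]. *)
pose inv w := if w \in Z then linked (PZ :|: Q0) Phi x w
  else [exists u in PZ, e w u && linked (PZ :|: Q0) Phi x u].
suff : inv y by move: yZ; rewrite /inv inE => /andP[_ ->].
apply: (@connect_ind1 _ _ inv _ _ _ _ xy).
  by move: xZ; rewrite /inv inE => /andP[_ ->]; apply: linked0.
move=> w w' iw /and4P[wP wP' ww' /eqP c]; move: iw; rewrite /inv.
case wZ: (w \in Z); case wZ': (w' \in Z).
- move=> iw; apply: linked_trans iw _; apply: linked1; rewrite // !inE ?wP ?wP' ?wZ ?wZ' //.
- move=> iw; apply/exists_inP; exists w; rewrite ?inE ?wP //.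
  by rewrite e_sym ww' iw.
- case/exists_inP => u uZ /andP[wu xu]; apply: linked_trans xu _.
  have wI : w \in I by rewrite inE wZ.
  have uP : u \in P by move: uZ; rewrite inE => /andP[].
  case: (boolP (w \in X)) => wX; last by rewrite -linked_busy; apply: (idle_linked wP).
  have [_ cu] := settled_mono all_settled wI uP wu.
  have wK : w \in PZ :|: Q0 by rewrite inE [w \in Q0]inE wZ wX orbT.
  have wK' : w' \in PZ :|: Q0 by rewrite !inE wP' wZ'.
  apply: (@linked_trans _ _ _ _ _ w); apply: linked1 => //; last by rewrite e_sym.
  by rewrite inE uZ.
- move=> _; have wI : w \in I by rewrite inE wZ.
  by have [] := settled_edge all_settled wI wP' ww'; rewrite wZ'.
Qed.

Lemma filled_tree : tree_colouring P Phi.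
Proof.
have tr := eq_tree_colouring joining_busy A0_tree.
have PE : PZ :|: I = P by apply: setID.
have cI : connecting e P Z A I by move=> x y _ _; rewrite PE.
have := joining_tree e_sym all_settled Q0_sub (subxx I) connecting_busy cI tr.
apply: eq_tree_colouring => x y; rewrite mono_joining //.
by rewrite PE.
Qed.

Lemma blocks_met : blocks X \subset blocks Z.
Proof.
apply/subsetP => _ /imsetP[x xX ->]; case xZ: (x \in Z); first exact: imset_f.
have [y [yX xy _ lxy]] := busy_neighbour xX.
have xI : x \in I by rewrite inE xZ busyP.
have [yZ _] := settled_edge all_settled xI (busyP yX) xy.
by rewrite (linked_block e_sym lxy); apply: imset_f.
Qed.

Lemma blocks_leq_leaders : #|blocks X| <= #|Rt|.
Proof.
apply: leq_trans (leq_imset_card blk Rt); apply/subset_leq_card/subsetP => W.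
move/(subsetP blocks_met)/imsetP => [z zZ ->].
have zPZ : z \in PZ by rewrite PZ_Z.
have [r rR zr] := Rt_exists e_sym A zPZ; apply/imsetP; exists r => //.
apply: linked_block => //; rewrite linked_busy; apply: connecting_busy => //.
exact: (subsetP (Rt_sub e P Z A)) r rR.
Qed.

Lemma cost_busy : #|PZ| - #|Rt| + #|Q0| <= kappa.
Proof.
have RZ : #|Rt| <= #|Z| by have := subset_leq_card (Rt_sub e P Z A); rewrite PZ_Z.
have := busy_leq; have := blocks_leq_leaders; have := cardsID Z X.
rewrite (setIidPr ZX) PZ_Z; move: RZ.
by move: #|Rt| #|Z| #|X| #|Q0| #|blocks X| => *; lia.
Qed.

(** The bound holds block by block. Let a block have [w] vertices, [j] of them coloured, in [c]
    components with [a] anchors. If [j < w], then [c <= a] and [c <= j] give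
    [7 c + 10 j <= a + 16 (w - 1)]; if [j = w], then [c <= 1] and [w >= 2]. Of the 10 units per
    block on the right, 7 stand for its leader and 3 are those of [potential_bound]. *)
Lemma leaders_bound F : anchored Z A F ->
  7 * #|Rep| + 10 * #|Z| <= 16 * kappa + #|F| + 10 * #|blocks X|.
Proof.
move=> [FZ anc]; have FX := subset_trans FZ ZX.
have RepZ : Rep \subset Z by have := Rep_sub e P Z A; rewrite PZ_Z.
have RepX := subset_trans RepZ ZX.
have XP : X \subset P by apply/subsetP => x /busyP.
have lA x y : linked Z A x y -> linked P A0 x y by apply: linked_agree Z_sub_P ZA.
have Rep_F W : part Rep W <= part F W.
  pose g r := odflt r [pick y in F | linked Z A r y].
  have gP r : r \in Rep -> g r \in F /\ linked Z A r (g r).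
    move=> rR; rewrite /g; case: pickP => [y /andP[]//|no].
    by have [y yF ry] := anc r (subsetP RepZ r rR); have := no y; rewrite yF ry.
  rewrite /part -(card_in_imset (f := g)); last first.
    move=> r r'; rewrite inE => /andP[rR _]; rewrite inE => /andP[rR' _] gg.
    apply: (Rep_unique e_sym rR rR'); rewrite PZ_Z.
    have [_ l1] := gP r rR; have [_ l2] := gP r' rR'; rewrite -gg in l2.
    by apply: linked_trans l1 _; rewrite linked_sym.
  apply/subset_leq_card/subsetP => _ /imsetP[r rW ->].
  move: rW; rewrite inE => /andP[rR /eqP <-]; have [gF rg] := gP r rR.
  by rewrite inE gF eq_sym; apply/eqP/linked_block/lA.
have one W : part Z W = part X W -> part Rep W <= 1.
  move=> E; have full x : x \in X -> blk x = W -> x \in Z.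
    have/eqP EW : [set x in Z | blk x == W] == [set x in X | blk x == W].
      rewrite eqEcard -/(part Z W) -/(part X W) E leqnn andbT.
      by apply/subsetP => y; rewrite in_set => /andP[yZ yW]; rewrite in_set (subsetP ZX _ yZ).
    move=> xX bx; have : x \in [set x in X | blk x == W] by rewrite in_set xX bx eqxx.
    by rewrite -EW in_set => /andP[].
  apply/card_le1_eqP => r r'; rewrite in_set => /andP[rR /eqP rW]; rewrite in_set => /andP[rR' /eqP rW'].
  apply: (Rep_unique e_sym rR' rR); rewrite PZ_Z linked_sym //.
  have rr' : linked P A0 r r' by rewrite -mem_block rW -rW' mem_block linked0.
  have [] : linked Z A r r' /\ linked P A0 r r'; last by [].
  apply: (@connect_ind1 _ _ (fun y => linked Z A r y /\ linked P A0 r y) _ _ _ _ rr').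
    by split; apply: linked0.
  move=> u v [ru ru'] uv; have /and4P[uP vP euv /eqP c] := uv.
  have rv : linked P A0 r v by apply: linked_trans ru' (connect1 uv).
  have inZ x : x \in P -> linked P A0 r x -> x \in Z.
    move=> xP rx; apply: full; last by rewrite -(linked_block e_sym rx).
    case: (r =P x) => [<-|/eqP nrx]; first exact: (subsetP RepX).
    rewrite inE xP; apply/existsP; exists r; rewrite nrx linked_sym //.
  split=> //; apply: linked_trans ru _; apply: linked1; rewrite ?inZ //.
  by rewrite !ZA ?inZ.
have : \sum_(W in blocks X) (7 * part Rep W + 10 * part Z W + 16) <=
       \sum_(W in blocks X) (16 * part X W + part F W + 10).
  apply: leq_sum => W WX; have := part_sub W ZX; rewrite leq_eqVlt.
  move=> /orP[/eqP E|]; [move: (one W E); rewrite -E|]; move: (part_busy WX) (Rep_F W) (part_sub W RepZ).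
    by rewrite -E; move: (part Rep W) (part F W) (part Z W) => *; lia.
  by move: (part Rep W) (part F W) (part Z W) (part X W) => *; lia.
have sumM c (G : {set 'I_n} -> nat) :
    \sum_(W in blocks X) c * G W = c * \sum_(W in blocks X) G W by rewrite big_distrr.
have -> : \sum_(W in blocks X) (7 * part Rep W + 10 * part Z W + 16) =
    7 * #|Rep| + 10 * #|Z| + #|blocks X| * 16.
  by rewrite big_split [X in X + _ = _]big_split !sumM !sum_part // sum_nat_const.
have -> : \sum_(W in blocks X) (16 * part X W + part F W + 10) =
    16 * #|X| + #|F| + #|blocks X| * 10.
  by rewrite big_split [X in X + _ = _]big_split !sumM !sum_part // sum_nat_const.
have := busy_leq; move: #|Z| #|X| #|F| #|Rep| #|blocks X| => *; lia.
Qed.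

End Final.
End Biconnected.

(** * The search space *)

Section FirstVertex.
Variable n : nat.
Implicit Type p : pred 'I_n.

Definition first_vertex p : option 'I_n :=
  [pick v | p v && [forall w : 'I_n, (w < v) ==> ~~ p w]].

Lemma first_vertex_some p v : first_vertex p = Some v -> p v.
Proof. by rewrite /first_vertex; case: pickP => // u /andP[pu _] [<-]. Qed.

Lemma first_vertex_none p : first_vertex p = None -> forall v, ~~ p v.
Proof.
rewrite /first_vertex; case: pickP => // no _ v; apply/negP => pv.
have [u pu umin] := @arg_minnP _ v p (@nat_of_ord n) pv.
have := no u; rewrite /= pu => /negbT/forallPn[w]; rewrite negb_imply negbK.
by case/andP => wu /umin; rewrite leqNgt wu.
Qed.

End FirstVertex.

Section Algorithm.
Variables (n : nat) (e : rel 'I_n).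
Hypotheses (e_sym : symmetric e) (e_irr : irreflexive e).
Local Notation linked := (linked e).
Local Notation block := (block e).
Implicit Types (U P Z A F Q S V W : {set 'I_n}) (v w x y z q r s : 'I_n).

Definition cut_block U v s := v |: block (U :\ v) set0 s.
Definition good_cut U v s := [&& v \in U, s \in U, v != s & biconnected e (cut_block U v s)].

(** The part cut off contains the vertex [v], and so does the rest; if [U] is itself 2-connected,
    the rest is [v] alone. *)
Definition peel U : option ({set 'I_n} * {set 'I_n}) :=
  if first_vertex (fun v => [exists s, good_cut U v s]) is Some v then
    if first_vertex (good_cut U v) is Some s then
      Some (cut_block U v s, v |: (U :\: cut_block U v s))
    else None
  else None.

Definition tree_check P A := [forall x in P, forall a in P, forall b in P,
  [==> ~~ linked P A x a, ~~ linked P A x b,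
    [exists y, linked P A x y && e y a], [exists y, linked P A x y && e y b],
    linked (P :\: block P A x) set0 a b => linked P A a b]].

Lemma tree_checkP P A : reflect (tree_colouring e P A) (tree_check P A).
Proof.
apply: (iffP forall_inP) => [h x a b xP aP bP xa xb [y xy ya] [z xz zb] ab|h x xP].
  have /forall_inP/(_ a aP)/forall_inP/(_ b bP) := h x xP.
  rewrite xa xb ab /=; have -> /= : [exists y, linked P A x y && e y a].
    by apply/existsP; exists y; rewrite xy.
  by have -> : [exists y, linked P A x y && e y b] by apply/existsP; exists z; rewrite xz.
apply/forall_inP => a aP; apply/forall_inP => b bP.
do 2!apply/implyP => ?; apply/implyP => /existsP[y /andP[xy ya]].
apply/implyP => /existsP[z /andP[xz zb]]; apply/implyP; apply: h => //.
  by exists y.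
by exists z.
Qed.

(* A state [(k, f, U, P, Z, A, R)] has [k] contractions left.  If [P] is empty,
   the part [U] of the graph is still to be treated.  Otherwise [P] is a
   2-connected part under treatment, to be followed by [U]; [Z] is the set of its
   vertices known to be in blocks with at least two vertices, coloured by [A],
   and [f] bounds the weight of the choices that may still be made.  Once the
   colours of all blocks are known, [R] is nonempty and contains one vertex of
   each component of [Z] already connected to the leader of its block. *)
Definition state := (nat * nat * {set 'I_n} * {set 'I_n} * {set 'I_n} * {set 'I_n} * {set 'I_n})%type.

(** All ways of finishing the preceding parts with the same [k] and [U] left meet in this state,
    which retains nothing else of them. *)
Definition checkpoint k U : state := (k, 0, U, set0, set0, set0, set0).

Definition paint (col : bool) A V := if col then A :|: V else A.

(* Availability, weight, coloured vertices and colour of the [c]-th choice for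
   [v]: to colour [v] (0 and 1), to let [v] be a leaf next to a block containing
   [N] (2), or to colour [v] and [w] with the colour not seen by [v] ([3 + w]).
   A weight of 16 corresponds to one contraction. *)
Definition choice P Z A v c : bool * nat * {set 'I_n} * bool :=
  let a := sees e P Z A v in
  let b := sees e P Z (~: A) v in
  let N := uncoloured e P Z v in
  if c < 2 then
    let seen := if c == 0 then a else b in
    (seen || (2 < #|N|), if seen then 10 else 6, [set v], c == 0)
  else if c == 2 then (a (+) b, 9 * #|N|, N, a)
  else if insub (c - 3) is Some w then
    ([&& a (+) b, #|N| <= 2 & w \in N], 16, [set v; w], ~~ a)
  else (false, 0, set0, false).

Definition pending P Z A v := unsettled e P Z A v && (sees e P Z A v || sees e P Z (~: A) v).

Definition all_settled P Z A := [forall v, ~~ unsettled e P Z A v].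

(* The condition [7 * (#|Rep| - #|Rt|) <= f] pays for the sets [R] between [Rt]
   and [Rep] that occur in later states. *)
Definition step (s : state) (c : nat) : option state :=
  let: (k, f, U, P, Z, A, R) := s in
  let Rep := coloured_leaders e P Z A in
  let Rt := block_leaders e P Z A in
  if P == set0 then
    if peel U is Some (P', U') then
      if #|P'| <= 2 then Some (checkpoint k U')
      else if insub c is Some r then
        if (r \in P') && (0 < k) then
          Some (k, 16 * k - 6, U', P', [set r], [set r], set0)
        else None
      else None
    else None
  else if R == set0 then
    if first_vertex (pending P Z A) is Some v then
      let: (ok, x, V, col) := choice P Z A v c in
      if ok && (x <= f) then Some (k, f - x, U, P, Z :|: V, paint col A V, set0) else None
    else if [&& all_settled P Z A, tree_check P (filled e P Z A),
                7 * (#|Rep| - #|Rt|) <= f, #|P :&: Z| - #|Rt| <= k & Rt != set0] then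
      Some (k - (#|P :&: Z| - #|Rt|), 0, U, P, Z, A, Rt)
    else None
  else if Rep \subset R then Some (checkpoint k U)
  else if insub c is Some q then
    if [&& q \in P, q \notin Z, [exists s in R, hits e P Z A q s] & 0 < k] then
      Some (k.-1, 0, U, P, Z, A, R :|: [set r in Rep | hits e P Z A q r])
    else None
  else None.

Definition finished (s : state) :=
  let: (k, f, U, P, Z, A, R) := s in (P == set0) && (#|U| <= 1).

Inductive steps : state -> state -> Prop :=
| steps_refl (s : state) : steps s s
| steps_next (s : state) c (s1 s' : state) : c < n + 3 -> step s c = Some s1 -> steps s1 s' -> steps s s'.

Lemma steps_trans (s1 s2 s3 : state) : steps s1 s2 -> steps s2 s3 -> steps s1 s3.
Proof. by elim=> // s c s' s'' lt_c cs _ IH /IH; apply: steps_next cs. Qed.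

(** Two vertices can be given different colours, which leaves nothing to contract. *)
Lemma contracts_small P k : #|P| <= 2 -> contracts e P k.
Proof.
move=> P2; apply: (@contractsW _ _ _ 0) => //.
have [v Pv] : exists v : {set 'I_n}, forall x y, x \in P -> y \in P ->
    (x \in v) = (y \in v) -> x = y.
  case: (set_0Vmem P) => [->|[v vP]]; first by exists set0 => x y; rewrite inE.
  exists [set v] => x y xP yP; rewrite !inE.
  case: (x =P v) => [->|/eqP xv]; case: (y =P v) => [->|/eqP yv] // _.
  have : #|P :\ v| <= 1 by rewrite (cardsD1 v) vP in P2.
  by move/card_le1_eqP; apply; rewrite !inE ?xv ?yv.
have lE x y : x \in P -> linked P v x y -> x = y.
  by move=> xP xy; apply: Pv => //; [apply: linked_in xy xP|rewrite (linked_colour xy)].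
exists v, P; split=> //; last by rewrite addn0.
  move=> x a b xP aP bP xa xb _ _ ab.
  have nx c : ~~ linked P v x c -> c != x by apply: contraNneq => ->; apply: linked0.
  suff -> : a = b by apply: linked0.
  have : #|P :\ x| <= 1 by rewrite (cardsD1 x) xP in P2.
  by move/card_le1_eqP; apply; rewrite !inE nx.
by move=> x y xP yP; apply: lE.
Qed.

Lemma peelP U P' U' : peel U = Some (P', U') -> exists v,
  [/\ glued e P' U' v, U = P' :|: U', biconnected e P' & #|U'| < #|U|].
Proof.
rewrite /peel; case E1: (first_vertex _) => [v|] //; case E2: (first_vertex _) => [s|] // [<- <-].
have /and4P[vU sU vs bi] := first_vertex_some E2.
have BU : cut_block U v s \subset U.
  apply/subsetP => x; rewrite !inE => /orP[/eqP-> //|sx].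
  have : x \in U :\ v by apply: (linked_in sx); rewrite !inE eq_sym vs.
  by rewrite !inE => /andP[].
exists v; split=> //.
- split; rewrite ?setU11 // => x y xB; rewrite !inE => /orP[/eqP|]; first by right.
  case/andP; rewrite negb_or => /andP[yv sy] yU [xy|xy]; left; last first.
    by move: xB; rewrite xy !inE (negPf yv) (negPf sy).
  apply/eqP; move: xB; rewrite !inE => /orP[//|sx]; case/negP: sy.
  have xU : x \in U :\ v by apply: (linked_in sx); rewrite !inE eq_sym vs.
  apply: (linked_trans sx); apply: linked1; rewrite ?in_set0 //.
  by rewrite !inE yv.
- apply/setP => x; rewrite !inE; case: (x =P v) => [->|_] /=; first by rewrite vU.
  case sx: (linked _ _ s x) => //=.
  by apply: (subsetP BU); rewrite !inE sx orbT.
- apply: proper_card; apply/properP; split.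
    by apply/subsetP => x; rewrite !inE => /orP[/eqP->|/andP[]].
  exists s => //; rewrite !inE linked0 orbT /= orbF eq_sym; exact: vs.
Qed.

Definition contracts_both P U k :=
  exists k1 k2, [/\ contracts e P k1, contracts e U k2 & k1 + k2 <= k].

(** What a path to a finished state proves, read backwards. Nothing is claimed of [Z] and [A] while
    vertices are being coloured: wrong guesses do no harm, because the colouring is tested before
    [R] becomes nonempty. *)
Definition sound_state (s : state) : Prop :=
  let: (k, f, U, P, Z, A, R) := s in
  if P == set0 then contracts e U k
  else if R == set0 then contracts_both P U k
  else all_settled P Z A -> exists Q k2,
    [/\ Q \subset P :\: Z, joined e P Z A Q R, contracts e U k2 & #|Q| + k2 <= k].

Lemma sound_step (s s' : state) c : step s c = Some s' -> sound_state s' -> sound_state s.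
Proof.
case: s => [[[[[[k f] U] P] Z] A] S]; rewrite /step /sound_state.
case: (P =P set0) => P0.
  case E: (peel U) => [[P' U']|] //; have [v [g -> _ _]] := peelP E.
  case: ifP => P2.
    move=> [<-] /=; rewrite eqxx => cU; apply/(contracts_glued e_sym _ g).
    by exists 0, k; split=> //; apply: contracts_small.
  case: insubP => // r _ _; case: ifP => // _ [<-] /=.
  have -> : (P' == set0) = false by apply/eqP => P0'; rewrite P0' cards0 in P2.
  by rewrite eqxx => h; apply/(contracts_glued e_sym _ g).
case: (S =P set0) => S0.
  case: (first_vertex _) => [v|].
    case: (choice P Z A v c) => [[[ok x] V] col]; case: ifP => // _ [<-] /=.
    by rewrite eqxx; move/eqP/negPf: P0 => ->.
  case: ifP => // /and5P[st tr _ le R0] [<-] /=; move/eqP/negPf: (P0) => ->.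
  rewrite (negPf R0) => /(_ st)[Q [k2 [QI jQ cU leQ]]].
  have /forallP stl := st.
  have cQ := joined_Rt e_sym QI jQ.
  (* The step has tested the colouring in which all uncoloured vertices join; [joining_tree] carries
     the result over to [Q]. *)
  have cI : connecting e P Z A (P :\: Z) by move=> x y _ _; rewrite setID.
  have tI : tree_colouring e P (joining e P Z A (P :\: Z)).
    apply: eq_tree_colouring (elimT (tree_checkP _ _) tr) => x y.
    by rewrite (mono_joining e_sym stl) // setID.
  have tQ := joining_tree e_sym stl (subxx _) QI cI cQ tI.
  exists (#|P :&: Z| - #|block_leaders e P Z A| + #|Q|), k2; split=> //.
    exact: joining_contracts.
  by move: le leQ; move: (_ - #|_|) #|Q| => *; lia.
case: ifP => [RS|_].
  move=> [<-] /=; rewrite eqxx => cU _; exists set0, k; split=> //; first exact: sub0set.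
    by move=> r rR; exists r; [apply: (subsetP RS)|apply: linked0].
  by rewrite cards0.
case: insubP => // q _ _; case: ifP => // /and4P[qP qZ /exists_inP[s sS hs] k0] [<-] /=.
move/eqP/negPf: P0 => ->; have -> : (S :|: [set r in coloured_leaders e P Z A | hits e P Z A q r] == set0) = false.
  by apply/eqP => E; case/negP: (in_set0 s : _ = false); rewrite -E inE sS.
move=> h st; have [Q [k2 [QI jQ cU le]]] := h st; have /forallP stl := st.
have qI : q \in P :\: Z by rewrite inE qZ.
exists (q |: Q), k2; split=> //.
- by rewrite subUset sub1set qI.
- exact: (joined_step e_sym stl qI sS hs jQ).
- rewrite cardsU1; move: le k0; move: #|Q| => m; case: (q \notin Q) => /=; lia.
Qed.

Lemma sound_steps (s s' : state) : steps s s' -> finished s' -> sound_state s.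
Proof.
move=> h; elim: h => {s s'} [s1|s1 c s2 s3 _ st _ IH] fin; last exact: sound_step st (IH fin).
case: s1 fin => [[[[[[k f] U] P] Z] A] S] /andP[/eqP-> U1].
by rewrite /sound_state eqxx; apply: contracts_small; apply: leq_trans U1 _.
Qed.

(** Take [v] and [s] such that the component [C] of [s] in [U - v] is smallest. If some [x] in [C]
    separated a vertex [c] of [C] from [v], the component of [c] in [U - x] would be contained in
    [C - x], hence smaller. *)
Lemma peel_exists U : 1 < #|U| -> peel U != None.
Proof.
move=> U1; have [v [s [vU sU vs]]] : exists v s, [/\ v \in U, s \in U & v != s].
  by case/card_gt1P: U1 => v [s [vU sU vs]]; exists v, s.
pose ok (p : 'I_n * 'I_n) := [&& p.1 \in U, p.2 \in U & p.1 != p.2].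
have ok0 : ok (v, s) by rewrite /ok /= vU sU vs.
have [[v1 s1] /and3P[/= v1U s1U vs1] pmin] :=
  @arg_minnP _ (v, s) ok (fun p => #|block (U :\ p.1) set0 p.2|) ok0.
set B := cut_block U v1 s1; set C := block (U :\ v1) set0 s1 in pmin.
have CU x : x \in C -> x \in U /\ x != v1.
  rewrite mem_block => sx; have : x \in U :\ v1 by apply: (linked_in sx); rewrite !inE eq_sym vs1.
  by rewrite !inE => /andP[-> ->].
have Cnbr x y : x \in C -> y \in U -> e x y -> y \in B.
  move=> xC yU xy; rewrite !inE; case: (y =P v1) => //= /eqP yv.
  have [xU xv] := CU x xC; rewrite mem_block in xC; apply: linked_trans xC _.
  by apply: linked1; rewrite ?inE ?xv ?yv.
have bi : biconnected e B.
  apply/forall_inP => x xB; apply/forall_inP => a aB; apply/forall_inP => b bB.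
  apply/implyP => ax; apply/implyP => bx.
  case: (x =P v1) => [xv|/eqP xv].
    have inC c : c \in B -> c != x -> linked (B :\ x) set0 s1 c.
      rewrite xv => cB cv; have : c \in C by move: cB; rewrite in_setU1 (negPf cv).
      rewrite mem_block => sc; have [] : linked (B :\ v1) set0 s1 c /\ linked (U :\ v1) set0 s1 c; last by [].
      apply: (@connect_ind1 _ _ (fun c => linked (B :\ v1) set0 s1 c /\ linked (U :\ v1) set0 s1 c) _ _ _ _ sc).
        by split; apply: linked0.
      move=> u w [su su'] uw; have sw' := linked_trans su' (connect1 uw).
      split=> //; apply: linked_trans su _; have /and4P[] := uw.
      rewrite !in_setD1 => /andP[uv _] /andP[wv _] euw _.
      by apply: linked1; rewrite ?in_set0 // in_setD1 in_setU1 mem_block ?uv ?wv ?su' ?sw' orbT.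
    by apply: linked_trans (inC b bB bx); rewrite linked_sym //; apply: inC.
  have xC : x \in C by move: xB; rewrite in_setU1 (negPf xv).
  have tov c : c \in B -> c != x -> linked (B :\ x) set0 c v1.
    move=> cB cx; apply/negPn/negP => ncv.
    have cC : c \in C.
      move: cB; rewrite in_setU1 => /orP[/eqP cv|//].
      by rewrite cv linked0 in ncv.
    have [cU cv] := CU c cC; have [xU _] := CU x xC.
    have sub : block (U :\ x) set0 c \subset C :\ x.
      apply/subsetP => y; rewrite mem_block => cy.
      suff [h1 h2] : linked (B :\ x) set0 c y /\ y \in C :\ x by [].
      apply: (@connect_ind1 _ _ (fun y => linked (B :\ x) set0 c y /\ y \in C :\ x) _ _ _ _ cy).
        by split; [apply: linked0|rewrite !inE cx -mem_block].
      move=> u w [cu uC] /and4P[uD wD uw _].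
      have wB : w \in B.
        by apply: (Cnbr u) => //; [move: uC|move: wD]; rewrite in_setD1 => /andP[].
      have wx : w != x by move: wD; rewrite in_setD1 => /andP[].
      have cw : linked (B :\ x) set0 c w.
        apply: linked_trans cu _; apply: linked1; rewrite ?in_set0 // in_setD1 ?wx //.
        by move: uC; rewrite !in_setD1 => /andP[-> uC]; rewrite in_setU1 uC orbT.
      split=> //; rewrite in_setD1 wx /=; move: wB; rewrite in_setU1 => /orP[/eqP wv|//].
      by rewrite -wv cw in ncv.
    have := pmin (x, c); rewrite /ok /= xU cU eq_sym cx => /(_ isT).
    have := subset_leq_card sub; rewrite (cardsD1 x C) xC => h1 h2.
    by have := leq_trans h2 h1; rewrite ltnn.
  by apply: linked_trans (tov a aB ax) _; rewrite linked_sym //; apply: tov.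
have gc : good_cut U v1 s1 by rewrite /good_cut v1U s1U vs1.
rewrite /peel; case E1: (first_vertex _) => [v'|].
  have /existsP[s' gs] := first_vertex_some E1.
  case E2: (first_vertex _) => [s''|] //.
  by have := first_vertex_none E2 s'; rewrite gs.
have := first_vertex_none E1 v1; case/negP.
by apply/existsP; exists s1.
Qed.

End Algorithm.

(** * Completeness of the search *)

Section Complete.
Variables (n : nat) (e : rel 'I_n).
Hypotheses (e_sym : symmetric e) (e_irr : irreflexive e).
Local Notation linked := (linked e).
Local Notation steps := (steps e).
Implicit Types (U P Z A F Q S V W G D : {set 'I_n}) (v w x y z q r s : 'I_n).

Section Part.
Variables P A0 S0 : {set 'I_n}.
Variable kappa : nat.
Hypothesis P_bic : biconnected e P.
Hypothesis P_gt2 : 2 < #|P|.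
Hypothesis A0_tree : tree_colouring e P A0.
Hypothesis S0_sub : S0 \subset P.
Hypothesis S0_sep : separated e P A0 S0.
Hypothesis S0_card : #|P| <= #|S0| + kappa.
Variables (U : {set 'I_n}) (k : nat).
Hypothesis kappa_leq : kappa <= k.
Local Notation X := (busy e P A0).
Local Notation blks := (blocks e P A0).

(** Of the [16 k] units, at most [10 |Z| - |F| - 3 |blks Z|] have been spent, and [f] is at least
    what is left. *)
Definition invariant Z A F f := [/\ Z \subset X, A \subset Z, agrees A0 Z A, anchored e Z A F
  & 16 * k + #|F| + 3 * #|blks Z| <= f + 10 * #|Z|].

Lemma busy_sub : X \subset P. Proof. by apply/subsetP => x /busyP. Qed.

(** [V] is coloured at weight [x], with new anchors [G]. If [x] is at most the growth of the charge,
    the invariant is kept; that [f] can afford [x] is [potential_bound] for [Z :|: V], whose charge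
    is at most [16 kappa]. *)
Lemma invariant_extend Z A F f V G (col : bool) (x : nat) : invariant Z A F f ->
  V \subset X :\: Z -> {in V, forall y, (y \in A0) = col} -> G \subset V ->
  (forall y, y \in V -> y \in G \/ exists z, [/\ z \in Z :|: G, e y z & (z \in A0) = col]) ->
  x + #|G| + 3 * #|blks (Z :|: V)| <= 3 * #|blks Z| + 10 * #|V| ->
  x <= f /\ invariant (Z :|: V) (paint col A V) (F :|: G) (f - x).
Proof.
move=> [ZX AZ ag [FZ anc] le] VX Vcol GV Vanc lex.
have VZ y : y \in V -> y \notin Z by move/(subsetP VX); rewrite inE => /andP[].
have ZVX : Z :|: V \subset X by rewrite subUset ZX (subset_trans VX) ?subsetDl.
have cZ z : z \in Z -> (z \in paint col A V) = (z \in A).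
  rewrite /paint; case: col {Vcol Vanc} => //; rewrite inE => zZ.
  by case zV: (z \in V); rewrite ?orbF //; move: (VZ _ zV); rewrite zZ.
have cV y : y \in V -> (y \in paint col A V) = col.
  move=> yV; rewrite /paint; case: (col); first by rewrite inE yV orbT.
  by apply/negP => /(subsetP AZ) yZ; have := VZ y yV; rewrite yZ.
have ag' : agrees A0 (Z :|: V) (paint col A V).
  by move=> y; rewrite inE => /orP[yZ|yV]; [rewrite cZ ?ag|rewrite cV ?Vcol].
have lZ y z : linked Z A y z -> linked (Z :|: V) (paint col A V) y z.
  apply: linked_mono => a b /and4P[aZ bZ ab c].
  by rewrite /mono !inE aZ bZ ab !cZ.
have anc' : anchored e (Z :|: V) (paint col A V) (F :|: G).
  split; first exact: setUSS.
  move=> y /setUP[yZ|yV].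
    by have [z zF yz] := anc y yZ; exists z; [rewrite inE zF|apply: lZ].
  case: (Vanc y yV) => [yG|[z [zZG yz zc]]]; first by exists y; rewrite ?inE ?yG ?orbT ?linked0.
  have zZV : z \in Z :|: V by case/setUP: zZG => [|/(subsetP GV)] h; rewrite inE h ?orbT.
  have lyz : linked (Z :|: V) (paint col A V) y z.
    by apply: linked1; rewrite ?ag' // ?inE ?yV ?orbT // Vcol.
  case/setUP: zZG => [zZ|zG]; last by exists z; rewrite // inE zG orbT.
  have [w wF zw] := anc z zZ; exists w; first by rewrite inE wF.
  exact: linked_trans lyz (lZ _ _ zw).
have FG : #|F :|: G| = #|F| + #|G|.
  rewrite cardsU (_ : F :&: G = set0) ?cards0 ?subn0 //; apply/setP => y; rewrite !inE.
  apply/negP => /andP[/(subsetP FZ) yZ /(subsetP GV)/VZ]; by rewrite yZ.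
have ZV : #|Z :|: V| = #|Z| + #|V|.
  rewrite cardsU (_ : Z :&: V = set0) ?cards0 ?subn0 //; apply/setP => y; rewrite !inE.
  by apply/negP => /andP[yZ /VZ]; rewrite yZ.
have pot : 10 * #|Z :|: V| <= 16 * kappa + #|F :|: G| + 3 * #|blks (Z :|: V)|.
  apply: (potential_bound e_sym e_irr P_bic P_gt2 S0_sub S0_sep S0_card) => //.
    by case: anc'.
  move=> y /(anc'.2)[z zF yz]; exists z => //.
  by apply: linked_agree ag' yz; apply: subset_trans busy_sub.
rewrite /invariant FG ZV in pot *.
suff [xf le'] : x <= f /\ 16 * k + (#|F| + #|G|) + 3 * #|blks (Z :|: V)| <=
    f - x + 10 * (#|Z| + #|V|).
  split=> //; split=> //; rewrite /paint; case: (col); last first.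
    by apply: subset_trans AZ (subsetUl _ _).
  exact: setSU.
move: le lex pot kappa_leq; move: #|F| #|G| #|Z| #|V| #|blks Z| #|blks _|.
by clear=> *; lia.
Qed.

Lemma blocksU Z V : (forall v, v \in V -> exists2 z, z \in Z & linked P A0 z v) ->
  blks (Z :|: V) = blks Z.
Proof.
move=> h; rewrite /blocks imsetU; apply/setUidPl/subsetP => _ /imsetP[v /h[z zZ zv] ->].
by rewrite -(linked_block e_sym zv); apply: imset_f.
Qed.

Lemma blocks_leqS Z v : #|blks (Z :|: [set v])| <= #|blks Z|.+1.
Proof. by rewrite /blocks imsetU imset_set1 setUC cardsU1; case: (_ \notin _). Qed.

Lemma seesP Z A v : reflect (exists y, [/\ y \in P, y \in Z, e v y & y \in A]) (sees e P Z A v).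
Proof.
by apply: (iffP existsP) => -[y]; [case/and4P|case] => *; exists y => //; apply/and4P.
Qed.

Lemma choice_complete Z A F f v : invariant Z A F f -> pending e P Z A v ->
  exists c (x : nat) V (col : bool) F', [/\ c < n + 3, choice e P Z A v c = (true, x, V, col),
    x <= f, ~~ (V \subset Z) & invariant (Z :|: V) (paint col A V) F' (f - x)].
Proof.
move=> inv /andP[/and3P[vP vZ nset] sab]; have [ZX AZ ag [FZ anc] le] := inv.
set a := sees e P Z A v in sab; set b := sees e P Z (~: A) v in sab.
set N := uncoloured e P Z v.
have ZP := subset_trans ZX busy_sub.
have inN y : (y \in N) = [&& y \in P, y \notin Z & e v y] by rewrite inE.
have colour_seen z : z \in Z -> e v z -> if z \in A0 then a else b.
  move=> zZ vz; rewrite -(ag z zZ); case: ifP => zA; apply/seesP; exists z.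
    by rewrite (subsetP ZP).
  by rewrite (subsetP ZP) // inE zA.
have of_a : a -> exists z, [/\ z \in Z, e v z & (z \in A0) = true].
  by case/seesP => z [zP zZ vz zA]; exists z; rewrite -(ag z zZ).
have of_b : b -> exists z, [/\ z \in Z, e v z & (z \in A0) = false].
  case/seesP => z [zP zZ vz]; rewrite inE => /negPf zA; exists z.
  by rewrite -(ag z zZ).
case: (boolP (v \in X)) => vX.
  pose seen := if v \in A0 then a else b.
  have vcol : {in [set v], forall y, (y \in A0) = (v \in A0)} by move=> y /set1P->.
  have vXZ : [set v] \subset X :\: Z by rewrite sub1set inE vX vZ.
  have vD V : v \in V -> ~~ (V \subset Z) by move=> vV; apply: contra vZ => /subsetP; apply.
  have lt_c : ~~ (v \in A0) < n + 3 by rewrite addn3; case: (v \in A0).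
  have cE : choice e P Z A v (~~ (v \in A0)) =
      (seen || (2 < #|N|), if seen then 10 else 6, [set v], v \in A0).
    by rewrite /choice /seen -/a -/b -/N; case: (v \in A0).
  case: (boolP seen) => hs.
    have [z [zZ vz zA]] : exists z, [/\ z \in Z, e v z & (z \in A0) = (v \in A0)].
      by move: hs; rewrite /seen; case: (v \in A0) => [/of_a|/of_b].
    have zv : linked P A0 z v by apply: linked1; rewrite ?zA ?(subsetP ZP z zZ) // e_sym.
    (* Weight 10: [v] joins the component of a coloured neighbour, so neither an anchor nor a block
       is new. *)
    have [||xf inv'] := invariant_extend (G := set0) (x := 10) inv vXZ vcol (sub0set _).
    - by move=> y /set1P->; right; exists z; rewrite inE zZ.
    - by rewrite cards0 cards1 blocksU ?addn0 1?addnC // => u /set1P->; exists z.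
    - exists (~~ (v \in A0)), 10, [set v], (v \in A0), (F :|: set0).
      by rewrite cE hs /=; split; rewrite ?vD ?set11.
  have unseen z : z \in Z -> e v z -> (z \in A0) = ~~ (v \in A0).
    move=> zZ vz; have := colour_seen z zZ vz; move: hs; rewrite /seen.
    by case: (v \in A0); case: (z \in A0) => // /negPf->.
  case: (ltnP 2 #|N|) => N2.
    (* Weight [6 = 10 - 1 - 3]: [v] is a new anchor, possibly in a new block. *)
    have [||xf inv'] := invariant_extend (G := [set v]) (x := 6) inv vXZ vcol (subxx _).
    - by move=> y ->; left.
    - rewrite cards1; have := blocks_leqS Z v.
      by move: #|blks _| #|blks Z|; clear=> p q; lia.
    - exists (~~ (v \in A0)), 6, [set v], (v \in A0), (F :|: [set v]).
      by rewrite cE (negPf hs) N2 /=; split; rewrite ?vD ?set11.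
  (* A busy vertex has a neighbour in its block; here it is uncoloured, as [v] does not see its own
     colour. *)
  have [w [wX vw wA lvw]] := busy_neighbour e_sym e_irr vX.
  have wZ : w \notin Z.
    by apply/negP => wZ; have := unseen w wZ vw; rewrite wA; case: (_ \in _).
  have wN : w \in N by rewrite inN (subsetP busy_sub) // wZ.
  have hab : a (+) b /\ ~~ a = (v \in A0).
    by move: sab hs; rewrite /seen; case: (v \in A0); case: (a); case: (b).
  have VXZ : [set v; w] \subset X :\: Z.
    by apply/subsetP => y /set2P[]->; rewrite inE ?vZ ?wZ.
  have Vcol : {in [set v; w], forall y, (y \in A0) = (v \in A0)} by move=> y /set2P[]->.
  have vV : v \in [set v; w] by rewrite !inE eqxx.
  have nvw : v != w by apply: contraTneq vw => ->; rewrite e_irr.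
  (* Weight [16 = 20 - 1 - 3]: two vertices share one anchor and at most one new block. *)
  have [|||xf inv'] := invariant_extend (G := [set v]) (x := 16) inv VXZ Vcol.
  - by rewrite sub1set.
  - move=> y /set2P[]->; first by left; rewrite set11.
    by right; exists v; rewrite !inE eqxx orbT e_sym.
  - rewrite setUA (@blocksU (Z :|: [set v]) [set w]); last first.
      by move=> y /set1P->; exists v; rewrite ?inE ?eqxx ?orbT.
    rewrite cards1 cards2 nvw; have := blocks_leqS Z v.
    by move: #|blks _| #|blks Z|; clear=> p q /=; lia.
  - exists (3 + w), 16, [set v; w], (v \in A0), (F :|: [set v]); split; rewrite ?vD //.
      by rewrite addnC ltn_add2r.
    by rewrite /choice /= addKn valK -/a -/b -/N hab.1 N2 wN hab.2.
(* From here on [v] is a leaf, and all its neighbours belong to one block. *)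
have sameA0 x y : x \in P -> y \in P -> e v x -> e v y -> linked P A0 x y.
  exact: idle_linked.
have nab : a (+) b.
  case: (boolP a) (boolP b) sab => [/of_a[x [xZ vx xA]]|//] [/of_b[y [yZ vy yA]]|//] _.
  by have := linked_colour (sameA0 x y (subsetP ZP x xZ) (subsetP ZP y yZ) vx vy); rewrite xA yA.
have [z [zZ vz zA]] : exists z, [/\ z \in Z, e v z & (z \in A0) = a].
  by move: nab; case: (boolP a) => [/of_a//|_ /of_b].
have zP := subsetP ZP z zZ.
have NXZ : N \subset X :\: Z.
  apply/subsetP => y; rewrite inN => /and3P[yP yZ vy]; rewrite in_setD yZ /=.
  exact: (idle_busy e_irr P_bic P_gt2 A0_tree vP vX).
have Ncol : {in N, forall y, (y \in A0) = a}.
  move=> y; rewrite inN => /and3P[yP yZ vy]; rewrite -zA.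
  exact: (linked_colour (sameA0 z y zP yP vz vy)).
have N0 : N != set0.
  by move: nset; rewrite /settled -/a -/b nab andbT cards_eq0.
(* Weight [9 = 10 - 1] each: every vertex of [N] becomes an anchor, but its block, that of [z], is
   already met. *)
have [|||xf inv'] := invariant_extend (G := N) (x := 9 * #|N|) inv NXZ Ncol.
- exact: subxx.
- by move=> y ->; left.
- rewrite (@blocksU Z N); last first.
    move=> y; rewrite inN => /and3P[yP yZ vy]; exists z => //.
    exact: sameA0.
  by move: #|N| #|blks Z|; clear=> p q; lia.
exists 2, (9 * #|N|), N, a, (F :|: N); split=> //.
    by rewrite addn3.
  by rewrite /choice /= -/a -/b -/N nab.
apply: contra N0 => NZ; rewrite -subset0; apply/subsetP => y yN.
by have := subsetP NXZ y yN; rewrite inE (subsetP NZ y yN).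
Qed.

Lemma P_neq0 : (P == set0) = false.
Proof. by apply/eqP => P0; have := P_gt2; rewrite P0 cards0. Qed.

(** On a path to [Z] from a vertex that sees no colour, the first vertex that sees one is not yet in
    [Z], and its predecessor is an uncoloured neighbour. *)
Lemma pending_exists Z A v : Z \subset P -> Z != set0 -> unsettled e P Z A v ->
  exists w, pending e P Z A w.
Proof.
move=> /subsetP ZP /set0Pn[z zZ] uv.
pose blind w := [&& w \in P, w \notin Z, ~~ sees e P Z A w & ~~ sees e P Z (~: A) w].
have [pv|npv] := boolP (pending e P Z A v); first by exists v.
have bv : blind v.
  move: npv; rewrite /pending uv /= negb_or /blind => /andP[-> ->].
  by case/and3P: uv => -> ->.
have bz : ~~ blind z by rewrite /blind zZ andbF.
have vP : v \in P by case/and3P: uv.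
have [x [y [/and4P[xP xZ xa xb] by0 /and4P[_ yP xy _]]]] :=
  connect_out bv bz (connected_P P_bic P_gt2 vP (ZP z zZ)).
exists y; have yZ : y \notin Z.
  apply/negP => yZ; have : sees e P Z A x || sees e P Z (~: A) x.
    case: (boolP (y \in A)) => yA; apply/orP; [left|right]; apply/seesP; exists y => //.
    by rewrite inE yA.
  by rewrite (negPf xa) (negPf xb).
move: by0; rewrite /blind yP yZ /= negb_and !negbK /pending => ->; rewrite andbT.
rewrite /unsettled yP yZ /settled negb_and -lt0n; apply/orP; left.
by apply/card_gt0P; exists x; rewrite inE xP xZ e_sym.
Qed.

Lemma settled_or_pending Z A : Z \subset P -> Z != set0 ->
  first_vertex (pending e P Z A) = None -> all_settled e P Z A.
Proof.
move=> ZP Z0 none; apply/forallP => v; apply/negP => /(pending_exists ZP Z0)[w].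
by apply/negP; exact: first_vertex_none.
Qed.

Lemma colouring_complete Z A F f : Z != set0 -> invariant Z A F f ->
  exists Z' A' F' f', [/\ Z' != set0, invariant Z' A' F' f', all_settled e P Z' A'
    & steps (k, f, U, P, Z, A, set0) (k, f', U, P, Z', A', set0)].
Proof.
have [m] := ubnP #|P :\: Z|; elim: m => // m IH in Z A F f *; rewrite ltnS => le_m Z0 inv.
have [ZX AZ ag anc le] := inv; have ZP := subset_trans ZX busy_sub.
case E: (first_vertex (pending e P Z A)) => [v|]; last first.
  exists Z, A, F, f; split=> //; last exact: steps_refl.
  exact: settled_or_pending.
have [c [x [V [col [F' [lt_c cE xf VZ inv']]]]]] := choice_complete inv (first_vertex_some E).
have [||Z' [A' [F'' [f' [Z0' inv'' st' steps']]]]] := IH _ _ _ _ _ _ inv'.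
- apply: leq_trans le_m; apply: proper_card; apply/properP; split.
    by apply/setDS/subsetUl.
  case/subsetPn: VZ => u uV uZ; exists u; rewrite !inE ?uZ ?uV ?orbT //.
  by have [/subsetP ZVX _ _ _ _] := inv'; rewrite (subsetP busy_sub) // ZVX // inE uV orbT.
- by case/set0Pn: Z0 => y yZ; apply/set0Pn; exists y; rewrite inE yZ.
exists Z', A', F'', f'; split=> //; apply: steps_next lt_c _ steps'.
by rewrite /step P_neq0 eqxx E cE xf.
Qed.

Section Joining.
Variables Z A F : {set 'I_n}.
Variable f : nat.
Hypothesis inv : invariant Z A F f.
Hypothesis stl : all_settled e P Z A.
Local Notation Rep := (coloured_leaders e P Z A).
Local Notation Rt := (block_leaders e P Z A).
Local Notation Q0 := (X :\: Z).

Lemma joining_complete (k2 : nat) (D R : {set 'I_n}) : Rt \subset R -> R \subset Rep -> R != set0 ->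
  (forall q r, q \in D -> r \in Rep -> hits e P Z A q r -> r \in R) -> #|Q0 :\: D| <= k2 ->
  exists2 k', k2 <= k' + #|Q0 :\: D| & steps (k2, 0, U, P, Z, A, R) (checkpoint k' U).
Proof.
have [ZX AZ ag anc le] := inv; have /forallP stl' := stl.
have [m] := ubnP #|Q0 :\: D|; elim: m => // m IH in k2 D R *.
rewrite ltnS => le_m RtR RRep R0 sat le_k2.
have start c : step e (k2, 0, U, P, Z, A, R) c = if Rep \subset R then Some (checkpoint k2 U)
  else if insub c is Some q then
    if [&& q \in P, q \notin Z, [exists s in R, hits e P Z A q s] & 0 < k2] then
      Some (k2.-1, 0, U, P, Z, A, R :|: [set r in Rep | hits e P Z A q r]) else None
  else None by rewrite /step P_neq0 (negPf R0).
case: (boolP (Rep \subset R)) => RR.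
  exists k2; first exact: leq_addr.
  apply: (@steps_next _ _ _ 0) (steps_refl _ _); first by rewrite addn3.
  by rewrite start RR.
have Q0I := Q0_sub e P A0 Z.
have cQ := connecting_busy e_sym e_irr P_bic P_gt2 A0_tree ag stl'.
have [|q [s [qQ qD sR qs]]] := joined_progress e_sym stl' Q0I cQ RtR RRep _ sat.
  by apply: contra RR => /eqP->.
have qI := subsetP Q0I q qQ; have /andP[qZ qP] : (q \notin Z) && (q \in P) by rewrite -in_setD.
have D1 : #|Q0 :\: D| = #|Q0 :\: (q |: D)|.+1.
  rewrite (cardsD1 q (Q0 :\: D)) in_setD qD qQ /= add1n; congr _.+1.
  by apply: eq_card => x; rewrite in_setD1 !in_setD in_setU1 negb_or andbA.
have k2_gt0 : 0 < k2 by apply: leq_trans le_k2; rewrite D1.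
have [||||||k' le' steps'] := IH k2.-1 (q |: D) (R :|: [set r in Rep | hits e P Z A q r]).
- by rewrite -ltnS -D1 ltnS.
- exact: subset_trans RtR (subsetUl _ _).
- rewrite subUset RRep; apply/subsetP => r; rewrite in_set => /andP[].
  by [].
- by apply/set0Pn; exists s; rewrite in_setU sR.
- move=> q' r /setU1P[->|q'D] rR h; rewrite in_setU; last by rewrite (sat q' r).
  by rewrite in_set rR h orbT.
- by rewrite -ltnS -D1; case: (k2) k2_gt0 le_k2.
exists k'; first by rewrite D1 addnS; case: (k2) k2_gt0 le'.
apply: (@steps_next _ _ _ q) steps'; first by apply: leq_trans (ltn_ord q) (leq_addr _ _).
rewrite start (negPf RR) valK qP qZ k2_gt0 andbT /=.
by have -> : [exists s in R, hits e P Z A q s] by apply/exists_inP; exists s.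
Qed.

Lemma joining_start : Z != set0 -> step e (k, f, U, P, Z, A, set0) 0 =
  Some (k - (#|P :&: Z| - #|Rt|), 0, U, P, Z, A, Rt).
Proof.
move=> Z0; have [ZX AZ ag anc le] := inv; have /forallP stl' := stl.
rewrite /step P_neq0 eqxx; case E: (first_vertex _) => [v|].
  by have /andP[uv _] := first_vertex_some E; have := stl' v; rewrite uv.
have -> : tree_check e P (filled e P Z A).
  by apply/tree_checkP; exact: (filled_tree e_sym e_irr P_bic P_gt2 A0_tree ag stl').
have le1 := leaders_bound e_sym e_irr P_bic P_gt2 S0_sub S0_sep S0_card ZX ag anc.
have le2 := blocks_leq_leaders e_sym e_irr P_bic P_gt2 A0_tree ZX ag stl'.
have le3 := cost_busy e_sym e_irr P_bic P_gt2 A0_tree S0_sub S0_sep S0_card ZX ag stl'.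
have bE : #|blks Z| = #|blks X|.
  apply/eqP; rewrite eqn_leq; apply/andP; split; apply: subset_leq_card; first exact: imsetS.
  exact: (blocks_met e_sym e_irr A0 stl').
have Rt0 : Rt != set0.
  case/set0Pn: Z0 => z zZ; have zPZ : z \in P :&: Z by rewrite (PZ_Z ZX).
  by have [r rR _] := Rt_exists e_sym A zPZ; apply/set0Pn; exists r.
rewrite stl Rt0 andbT /=; rewrite bE in le.
(* [leaders_bound] and [|Rt| >= |blks X|] bound the first left side by the units that the invariant
   leaves in [f]. *)
suff [-> ->] : 7 * (#|Rep| - #|Rt|) <= f /\ #|P :&: Z| - #|Rt| <= k by [].
move: le le1 le2 le3 kappa_leq; move: (#|P :&: Z| - #|Rt|).
move: #|Rep| #|Rt| #|F| #|Z| #|blks X| #|_ :\: _|.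
by clear=> *; lia.
Qed.

End Joining.

Lemma part_complete Z A F f : Z != set0 -> invariant Z A F f ->
  exists2 k', k <= k' + kappa & steps (k, f, U, P, Z, A, set0) (checkpoint k' U).
Proof.
move=> Z0 inv0; have [Z' [A' [F' [f' [Z0' inv stl steps1]]]]] := colouring_complete Z0 inv0.
have st := joining_start inv stl Z0'.
have [ZX _ ag _ _] := inv; have /forallP stl' := stl.
have le3 := cost_busy e_sym e_irr P_bic P_gt2 A0_tree S0_sub S0_sep S0_card ZX ag stl'.
have Rt0 : block_leaders e P Z' A' != set0.
  case/set0Pn: Z0' => z zZ; have zPZ : z \in P :&: Z' by rewrite (PZ_Z ZX).
  by have [r rR _] := Rt_exists e_sym A' zPZ; apply/set0Pn; exists r.
have [||k' le steps2] := joining_complete inv stl (k2 := k - (#|P :&: Z'| - #|block_leaders e P Z' A'|))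
  (D := set0) (subxx _) (Rt_Rep _ _ _ _) Rt0.
- by move=> q r; rewrite inE.
- rewrite setD0; move: le3 kappa_leq; move: (_ - #|_|) #|_ :\: _|.
  by clear=> *; lia.
exists k'.
  rewrite setD0 in le; move: le le3 kappa_leq; move: (_ - #|_|) #|_ :\: _|.
  by clear=> *; lia.
apply: steps_trans steps1 (steps_next _ st steps2).
by rewrite addn3.
Qed.

End Part.

(** The initial guess puts [r] into the first colour class; exchanging the two colours achieves
    this. *)
Lemma rooted_colouring P k : biconnected e P -> 2 < #|P| -> contracts e P k ->
  exists A S r, [/\ tree_colouring e P A, S \subset P, separated e P A S, #|P| <= #|S| + k
    & (r \in busy e P A) && (r \in A)].
Proof.
move=> bi P2 [A [S [tA SP sepS cS]]].
have [r rX] : exists r, r \in busy e P A.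
  have /card_gt0P[l lP] : 0 < #|P| by apply: leq_trans P2.
  case: (boolP (l \in busy e P A)) => lX; first by exists l.
  have [b bP lb] := idle_neighbour bi P2 lP; exists b.
  exact: (idle_busy e_irr bi P2 tA lP lX).
case: (boolP (r \in A)) => rA; first by exists A, S, r; rewrite rX rA.
exists (~: A), S, r; split=> //.
- by apply: eq_tree_colouring tA; apply: mono_setC.
- by apply: eq_separated sepS; apply: mono_setC.
rewrite in_setC rA andbT; move: rX; rewrite /busy !inE => /andP[-> /existsP[y /andP[yr ry]]].
by apply/existsP; exists y; rewrite yr -(eq_linked (mono_setC e P A)).
Qed.

Lemma steps_complete U k : U != set0 -> contracts e U k ->
  exists2 s', steps (checkpoint k U) s' & finished s'.
Proof.
have [m] := ubnP #|U|; elim: m => // m IH in U k *; rewrite ltnS => le_m U0 cU.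
case: (ltnP 1 #|U|) => U1; last first.
  by exists (checkpoint k U); [apply: steps_refl|rewrite /= eqxx].
case E: (peel e U) (peel_exists e_sym U1) => [[P U']|] // _.
have [v [g UE bi lt]] := peelP E.
have U'0 : U' != set0 by have [_ vU _] := g; apply/set0Pn; exists v.
rewrite UE in cU; have [k1 [k2 [c1 c2 le]]] := (contracts_glued e_sym k g).1 cU.
have lt_m := leq_trans lt le_m.
have stepE c : step e (checkpoint k U) c = if #|P| <= 2 then Some (checkpoint k U') else
    if insub c is Some r then
      if (r \in P) && (0 < k) then Some (k, 16 * k - 6, U', P, [set r], [set r], set0) else None
    else None by rewrite /step /= eqxx E.
case: (leqP #|P| 2) => P2.
  have [|s' st fin] := IH U' k lt_m U'0.
    by apply: contractsW c2; apply: leq_trans le; exact: leq_addl.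
  exists s' => //; apply: (@steps_next _ _ _ 0) st; first by rewrite addn3.
  by rewrite stepE P2.
have [A0 [S0 [r [tA0 S0P sepS0 cS0 /andP[rX rA0]]]]] := rooted_colouring bi P2 c1.
have k1k : k1 <= k by apply: leq_trans le; exact: leq_addr.
have one_sub : [set r] \subset busy e P A0 by rewrite sub1set.
have anc0 : anchored e [set r] [set r] [set r].
  by split=> // x xr; exists x => //; apply: linked0.
have ag0 : agrees A0 [set r] [set r] by move=> x /set1P->; rewrite set11 rA0.
have blocks1 : #|blocks e P A0 [set r]| = 1 by rewrite /blocks imset_set1 cards1.
(* A block with two vertices needs a contraction, so [16 * k - 6] is not truncated. *)
have k1_gt0 : 0 < k1.
  have : 10 * #|[set r]| <= 16 * k1 + #|[set r]| + 3 * #|blocks e P A0 [set r]|.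
    apply: (potential_bound e_sym e_irr bi P2 S0P sepS0 cS0) => //.
    by move=> x xr; exists x => //; apply: linked0.
  rewrite cards1 blocks1; clear; lia.
(* The first vertex is charged [10 - 1 - 3 = 6] units. *)
have inv0 : invariant P A0 k [set r] [set r] [set r] (16 * k - 6).
  split=> //; rewrite cards1 blocks1; move: k1_gt0 k1k; clear; lia.
have r0 : [set r] != set0 by apply/set0Pn; exists r; rewrite set11.
have [k' le' steps1] :=
  part_complete bi P2 tA0 S0P sepS0 cS0 U' k1k r0 inv0.
have [|s' steps2 fin] := IH U' k' lt_m U'0.
  by apply: contractsW c2; move: le le'; clear; lia.
exists s' => //; apply: (@steps_next _ _ _ r) (steps_trans steps1 steps2).
  by apply: leq_trans (ltn_ord r) (leq_addr _ _).
have rP : r \in P by apply: busyP rX.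
by rewrite stepE leqNgt P2 /= valK rP (leq_trans k1_gt0 k1k).
Qed.

End Complete.

(** * Numerical codes of states *)

Definition code n (A : {set 'I_n}) := \sum_(i < n) (i \in A) * pow2 n i.

Lemma mask_code n (p : nat -> bool) (A : {set 'I_n}) : (forall i : 'I_n, p i = (i \in A)) -> mask n p = code A.
Proof. by move=> pA; apply: eq_bigr => i _; rewrite pA. Qed.

Lemma code_mask n (A : {set 'I_n}) : code A = mask n (fun i => [exists v in A, v == i :> nat]).
Proof.
apply/esym/mask_code => i; apply/exists_inP/idP => [[v vA /eqP/val_inj<-]//|iA].
by exists i.
Qed.

Lemma bit_code n (A : {set 'I_n}) (i : 'I_n) : bit n (code A) i = (i \in A).
Proof.
rewrite code_mask bit_mask //; apply/exists_inP/idP => [[v vA /eqP/val_inj<-]//|iA].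
by exists i.
Qed.

Lemma code_inj n : injective (@code n).
Proof. by move=> A B AB; apply/setP => i; rewrite -!bit_code AB. Qed.

Lemma code0 n : code (set0 : {set 'I_n}) = 0.
Proof. by rewrite /code big1 // => i _; rewrite inE. Qed.

Lemma code_eq0 n (A : {set 'I_n}) : (code A == 0) = (A == set0).
Proof. by apply/eqP/eqP => [|->]; rewrite -?(code0 n); [apply: code_inj|]. Qed.

Lemma ltn_code n (A : {set 'I_n}) : code A < 2 ^ n.
Proof. by rewrite code_mask ltn_mask. Qed.

Lemma exists_lt_code n (P : nat -> bool) (p : pred 'I_n) : (forall i : 'I_n, P i = p i) ->
  exists_lt n P = [exists i, p i].
Proof. by move=> Pp; rewrite exists_ltE; apply: eq_existsb. Qed.

Lemma counting_code n (A : {set 'I_n}) : counting n (bit n (code A)) = #|A|.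
Proof. by rewrite countingE; apply: eq_card => i; rewrite inE bit_code. Qed.

Lemma first_code n (P : nat -> bool) (p : pred 'I_n) : (forall i : 'I_n, P i = p i) ->
  first n P = if first_vertex p is Some v then v : nat else n.
Proof.
move=> Pp; rewrite /first.
have E (i : 'I_n) : exists_lt n (fun j => (j <= i) && P j) = [exists j : 'I_n, (j <= i) && p j].
  by apply: exists_lt_code => j; rewrite Pp.
have count m : m <= n -> counting n (fun i => i < m) = m.
  move=> mn; transitivity (\sum_(i < m) 1); last by rewrite sum1_card card_ord.
  rewrite (big_ord_widen n (fun=> 1) mn) big_mkcond.
  by apply: eq_bigr => i _; case: (i < m).
case V: (first_vertex p) => [v|].
  rewrite -[RHS](count v) ?(ltnW (ltn_ord v)) //; apply: eq_bigr => i _; rewrite E; congr (nat_of_bool _).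
  move: V; rewrite /first_vertex; case: pickP => // u /andP[pu /forallP umin] [<-].
  apply/existsPn/idP => [/(_ u)|iu w]; first by rewrite pu andbT -ltnNge.
  apply/negP => /andP[wi pw]; have := umin w; rewrite pw implybF -leqNgt.
  by rewrite leqNgt (leq_ltn_trans wi iu).
rewrite -[RHS](count n) //; apply: eq_bigr => i _; rewrite E ltn_ord; congr (nat_of_bool _).
by apply/existsPn => j; rewrite negb_and (first_vertex_none V) orbT.
Qed.

Section Codes.
Variable m : memory.
Local Notation n := (m 0).

Definition edge v w := 0 < read m (2 + v * n + w).

Definition num_single v := mask n (fun i => i == v).
Definition num_union X Y := mask n (fun i => bit n X i || bit n Y i).
Definition num_inter X Y := mask n (fun i => bit n X i && bit n Y i).
Definition num_compl X := mask n (fun i => ~~ bit n X i).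
Definition num_diff X Y := mask n (fun i => bit n X i && ~~ bit n Y i).
Definition num_card X := counting n (bit n X).

(** One round of closing [X] under monochromatic edges; [n] rounds from the empty set exhaust every
    component. *)
Definition num_reach D A x X := mask n (fun i => (i == x) ||
  exists_lt n (fun j => bit n X j && [&& bit n D j, bit n D i, edge j i & bit n A j == bit n A i])).
Definition num_block D A x := iteri n (fun _ => num_reach D A x) 0.
Definition num_linked D A x y := bit n (num_block D A x) y.

Definition num_sees P Z A v :=
  exists_lt n (fun y => [&& bit n P y, bit n Z y, edge v y & bit n A y]).
Definition num_uncoloured P Z v :=
  mask n (fun y => bit n P y && (~~ bit n Z y && edge v y)).
Definition num_settled P Z A v := (num_card (num_uncoloured P Z v) == 0) &&
  (num_sees P Z A v (+) num_sees P Z (num_compl A) v).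
Definition num_unsettled P Z A v := [&& bit n P v, ~~ bit n Z v & ~~ num_settled P Z A v].
Definition num_pending P Z A v :=
  num_unsettled P Z A v && (num_sees P Z A v || num_sees P Z (num_compl A) v).
Definition num_filled P Z A :=
  mask n (fun x => bit n P x && (if bit n Z x then bit n A x else num_sees P Z A x)).
Definition num_leaders K A D := mask n (fun x => bit n D x &&
  ~~ exists_lt n (fun y => [&& bit n D y, y < x & num_linked K A y x])).
Definition num_coloured_leaders P Z A := num_leaders (num_inter P Z) A (num_inter P Z).
Definition num_block_leaders P Z A := num_leaders P (num_filled P Z A) (num_inter P Z).
Definition num_hits P Z A q r := exists_lt n (fun y =>
  [&& bit n (num_inter P Z) y, edge q y & num_linked (num_inter P Z) A y r]).

Definition num_biconnected P := ~~ exists_lt n (fun x => bit n P x &&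
  exists_lt n (fun a => bit n P a && exists_lt n (fun b => [&& bit n P b, a != x, b != x
    & ~~ num_linked (num_diff P (num_single x)) 0 a b]))).
Definition num_cut_block U v s :=
  num_union (num_single v) (num_block (num_diff U (num_single v)) 0 s).
Definition num_good_cut U v s :=
  [&& bit n U v, bit n U s, v != s & num_biconnected (num_cut_block U v s)].
Definition num_peel_vertex U := first n (fun v => exists_lt n (num_good_cut U v)).
Definition num_peel_side U := first n (num_good_cut U (num_peel_vertex U)).
Definition num_peel_part U := num_cut_block U (num_peel_vertex U) (num_peel_side U).
Definition num_peel_rest U :=
  num_union (num_single (num_peel_vertex U)) (num_diff U (num_peel_part U)).

Definition num_touches P A x a := exists_lt n (fun y => num_linked P A x y && edge y a).
Definition num_violates P A x a b := [&& bit n P x, bit n P a, bit n P b,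
  ~~ num_linked P A x a, ~~ num_linked P A x b, num_touches P A x a, num_touches P A x b,
  num_linked (num_diff P (num_block P A x)) 0 a b & ~~ num_linked P A a b].
Definition num_tree_check P A := ~~ exists_lt n (fun x =>
  exists_lt n (fun a => exists_lt n (num_violates P A x a))).

Definition num_seen P Z A v c :=
  if c == 0 then num_sees P Z A v else num_sees P Z (num_compl A) v.
Definition num_choice_ok P Z A v c :=
  if c < 2 then num_seen P Z A v c || (2 < num_card (num_uncoloured P Z v))
  else (num_sees P Z A v (+) num_sees P Z (num_compl A) v) &&
    ((c == 2) || [&& c - 3 < n, num_card (num_uncoloured P Z v) <= 2
                   & bit n (num_uncoloured P Z v) (c - 3)]).
Definition num_choice_weight P Z A v c :=
  if c < 2 then if num_seen P Z A v c then 10 else 6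
  else if c == 2 then 9 * num_card (num_uncoloured P Z v) else 16.
Definition num_choice_target P Z v c :=
  if c < 2 then num_single v else if c == 2 then num_uncoloured P Z v
  else num_union (num_single v) (num_single (c - 3)).
Definition num_choice_colour P Z A v c :=
  if c < 2 then c == 0 else num_sees P Z A v == (c == 2).
Definition num_paint (col : bool) A V := if col then num_union A V else A.

(** Larger than every code of a set, which is below [2 ^ n], and than [k <= n] and [f <= 16 n]: each
    component of a state fits into one digit. *)
Definition num_base := 64 * pow2 n n.
Definition num_state k f U P Z A R := (R + (A + (Z + (P + (U + (f + k * num_base) * num_base)
  * num_base) * num_base) * num_base) * num_base).+1.

Definition num_open k U c :=
  if (num_peel_vertex U < n) && (num_peel_side U < n) then
    if num_card (num_peel_part U) <= 2 then num_state k 0 (num_peel_rest U) 0 0 0 0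
    else if [&& c < n, bit n (num_peel_part U) c & 0 < k] then
      num_state k (16 * k - 6) (num_peel_rest U) (num_peel_part U) (num_single c) (num_single c) 0
    else 0
  else 0.

Definition num_colour k f U P Z A v c :=
  if num_choice_ok P Z A v c && (num_choice_weight P Z A v c <= f) then
    num_state k (f - num_choice_weight P Z A v c) U P (num_union Z (num_choice_target P Z v c))
      (num_paint (num_choice_colour P Z A v c) A (num_choice_target P Z v c)) 0
  else 0.

Definition num_close k f U P Z A Rep Rt :=
  if [&& ~~ exists_lt n (num_unsettled P Z A), num_tree_check P (num_filled P Z A),
         7 * (num_card Rep - num_card Rt) <= f,
         num_card (num_inter P Z) - num_card Rt <= k & Rt != 0] then
    num_state (k - (num_card (num_inter P Z) - num_card Rt)) 0 U P Z A Rt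
  else 0.

Definition num_join k U P Z A R Rep c :=
  if num_diff Rep R == 0 then num_state k 0 U 0 0 0 0
  else if [&& c < n, bit n P c, ~~ bit n Z c,
              exists_lt n (fun s => bit n R s && num_hits P Z A c s) & 0 < k] then
    num_state (k - 1) 0 U P Z A
      (num_union R (mask n (fun r => bit n Rep r && num_hits P Z A c r)))
  else 0.

Definition num_step k f U P Z A R c :=
  if P == 0 then num_open k U c
  else if R == 0 then
    if first n (num_pending P Z A) < n then
      num_colour k f U P Z A (first n (num_pending P Z A)) c
    else num_close k f U P Z A (num_coloured_leaders P Z A) (num_block_leaders P Z A)
  else num_join k U P Z A R (num_coloured_leaders P Z A) c.

(** Digit [i] in base [num_base]; the remainder is expressed through the quotient, as the machine
    only divides. *)
Definition num_field x i := iter i (divn^~ num_base) x - iter i.+1 (divn^~ num_base) x * num_base.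

Definition num_next x c := if x == 0 then 0 else
  let y := x - 1 in num_step (num_field y 6) (num_field y 5) (num_field y 4) (num_field y 3)
    (num_field y 2) (num_field y 1) (num_field y 0) c.

Definition num_goal x := [&& 0 < x, num_field (x - 1) 3 == 0 & num_card (num_field (x - 1) 4) <= 1].

(** Empty and disconnected graphs are rejected by starting in the dead state 0. *)
Definition num_start := if (0 < n) && ~~ exists_lt n (fun v => exists_lt n (fun w =>
    ~~ num_linked (num_compl 0) 0 v w)) then num_state (read m 1) 0 (num_compl 0) 0 0 0 0
  else 0.

Local Notation e := (fun v w : 'I_n => edge v w).
Implicit Types (U P Z A D R X Y : {set 'I_n}) (v w x y a b q r s : 'I_n).

Lemma num_singleE v : num_single v = code [set v].
Proof. by apply: mask_code => i; rewrite in_set1. Qed.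

Lemma num_unionE X Y : num_union (code X) (code Y) = code (X :|: Y).
Proof. by apply: mask_code => i; rewrite in_setU !bit_code. Qed.

Lemma num_interE X Y : num_inter (code X) (code Y) = code (X :&: Y).
Proof. by apply: mask_code => i; rewrite in_setI !bit_code. Qed.

Lemma num_complE X : num_compl (code X) = code (~: X).
Proof. by apply: mask_code => i; rewrite in_setC !bit_code. Qed.

Lemma num_diffE X Y : num_diff (code X) (code Y) = code (X :\: Y).
Proof. by apply: mask_code => i; rewrite in_setD !bit_code andbC. Qed.

Lemma num_cardE X : num_card (code X) = #|X|.
Proof. exact: counting_code. Qed.

Lemma num_blockE D A x : num_block (code D) (code A) x = code (block e D A x).
Proof.
pose F X := [set i | (i == x) || [exists j in X, mono e D A j i]].
have stepE X : num_reach (code D) (code A) x (code X) = code (F X).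
  apply: mask_code => i; rewrite in_set; congr (_ || _).
  by apply: exists_lt_code => j; rewrite !bit_code.
have -> : num_block (code D) (code A) x = code (fixset F).
  have it i : iteri i (fun _ => num_reach (code D) (code A) x) 0 = code (iter i F set0).
    by elim: i => [|i /= ->]; rewrite ?code0 ?stepE.
  by rewrite /num_block /fixset card_ord it.
have mF : {homo F : X Y / X \subset Y}.
  move=> X Y /subsetP XY; apply/subsetP => i; rewrite !in_set => /orP[->//|/exists_inP[j jX ji]].
  by apply/orP; right; apply/exists_inP; exists j => //; apply: XY.
congr code; apply/eqP; rewrite eqEsubset; apply/andP; split.
  rewrite /fixset; elim: #|_| => [|i /subsetP IH]; first exact: sub0set.
  apply/subsetP => y; rewrite /= in_set mem_block => /orP[/eqP->|/exists_inP[j /IH]].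
    exact: linked0.
  by rewrite mem_block => xj jy; apply: linked_trans xj (connect1 jy).
apply/subsetP => y; rewrite mem_block => xy; rewrite -(fixsetK mF).
apply: (@connect_ind1 _ _ (fun y => y \in F (fixset F)) _ _ _ _ xy).
  by rewrite in_set eqxx.
move=> u v; rewrite (fixsetK mF) => uF uv; rewrite -(fixsetK mF) in_set.
by apply/orP; right; apply/exists_inP; exists u.
Qed.

Lemma num_linkedE D A x y : num_linked (code D) (code A) x y = linked e D A x y.
Proof. by rewrite /num_linked num_blockE bit_code mem_block. Qed.

Lemma num_block0E D x : num_block (code D) 0 x = code (block e D set0 x).
Proof. by rewrite -num_blockE code0. Qed.

Lemma num_linked0E D x y : num_linked (code D) 0 x y = linked e D set0 x y.
Proof. by rewrite -num_linkedE code0. Qed.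

Lemma num_seesE P Z A v : num_sees (code P) (code Z) (code A) v = sees e P Z A v.
Proof. by apply: exists_lt_code => y; rewrite !bit_code. Qed.

Lemma num_uncolouredE P Z v : num_uncoloured (code P) (code Z) v = code (uncoloured e P Z v).
Proof. by apply: mask_code => y; rewrite in_set !bit_code. Qed.

Lemma num_unsettledE P Z A v : num_unsettled (code P) (code Z) (code A) v = unsettled e P Z A v.
Proof.
rewrite /num_unsettled /num_settled num_uncolouredE num_cardE num_complE !num_seesE.
by rewrite !bit_code.
Qed.

Lemma num_pendingE P Z A v : num_pending (code P) (code Z) (code A) v = pending e P Z A v.
Proof. by rewrite /num_pending num_unsettledE num_complE !num_seesE. Qed.

Lemma num_filledE P Z A : num_filled (code P) (code Z) (code A) = code (filled e P Z A).
Proof. by apply: mask_code => y; rewrite in_set !bit_code num_seesE. Qed.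

Lemma num_leadersE K A D : num_leaders (code K) (code A) (code D) = code (leaders (linked e K A) D).
Proof.
apply: mask_code => x; rewrite in_set bit_code; congr (_ && _).
rewrite (@exists_lt_code _ _ (fun y => [&& y \in D, y < x & linked e K A y x])); last first.
  by move=> y; rewrite bit_code num_linkedE.
by rewrite negb_exists; apply: eq_forallb => y; rewrite negb_and implybE negb_and implybE.
Qed.

Lemma num_coloured_leadersE P Z A :
  num_coloured_leaders (code P) (code Z) (code A) = code (coloured_leaders e P Z A).
Proof. by rewrite /num_coloured_leaders num_interE num_leadersE. Qed.

Lemma num_block_leadersE P Z A :
  num_block_leaders (code P) (code Z) (code A) = code (block_leaders e P Z A).
Proof. by rewrite /num_block_leaders num_interE num_filledE num_leadersE. Qed.

Lemma num_hitsE P Z A q r : num_hits (code P) (code Z) (code A) q r = hits e P Z A q r.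
Proof. by apply: exists_lt_code => y; rewrite num_interE num_linkedE bit_code. Qed.

Lemma num_biconnectedE P : num_biconnected (code P) = biconnected e P.
Proof.
rewrite /num_biconnected (@exists_lt_code _ _ (fun x => (x \in P) && [exists a in P, exists b in P,
  [&& a != x, b != x & ~~ linked e (P :\ x) set0 a b]])).
  rewrite negb_exists; apply: eq_forallb => x; rewrite negb_and implybE; congr (_ || _).
  rewrite negb_exists; apply: eq_forallb => a; rewrite negb_and implybE; congr (_ || _).
  rewrite negb_exists; apply: eq_forallb => b; rewrite negb_and implybE; congr (_ || _).
  by rewrite !negb_and !negbK !implybE !negbK.
move=> x; rewrite bit_code; congr (_ && _); apply: exists_lt_code => a; rewrite bit_code.
congr (_ && _); apply: exists_lt_code => b.
by rewrite bit_code num_singleE num_diffE num_linked0E.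
Qed.

Lemma num_cut_blockE U v s : num_cut_block (code U) v s = code (cut_block e U v s).
Proof. by rewrite /num_cut_block num_singleE num_diffE num_block0E num_unionE. Qed.

Lemma num_good_cutE U v s : num_good_cut (code U) v s = good_cut e U v s.
Proof. by rewrite /num_good_cut num_cut_blockE num_biconnectedE !bit_code. Qed.

Lemma num_peelE U : match peel e U with
  | Some (P, U') => [/\ num_peel_vertex (code U) < n, num_peel_side (code U) < n,
      num_peel_part (code U) = code P & num_peel_rest (code U) = code U']
  | None => (num_peel_vertex (code U) < n) && (num_peel_side (code U) < n) = false end.
Proof.
rewrite /peel /num_peel_rest /num_peel_part /num_peel_side.
have -> : num_peel_vertex (code U) =
    if first_vertex (fun v => [exists s, good_cut e U v s]) is Some v then v : nat else n.
  by apply: first_code => v; apply: exists_lt_code => s; apply: num_good_cutE.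
case: (first_vertex _) => [v|]; last by rewrite ltnn.
rewrite (@first_code _ _ (good_cut e U v)); last by move=> s; apply: num_good_cutE.
case: (first_vertex _) => [s|]; last by rewrite ltnn andbF.
by rewrite !ltn_ord num_cut_blockE num_singleE num_diffE num_unionE.
Qed.

Lemma num_touchesE P A x a : num_touches (code P) (code A) x a =
  [exists y, linked e P A x y && e y a].
Proof. by apply: exists_lt_code => y; rewrite num_linkedE. Qed.

Lemma num_tree_checkE P A : num_tree_check (code P) (code A) = tree_check e P A.
Proof.
rewrite /num_tree_check (@exists_lt_code _ _ (fun x => [exists a : 'I_n, exists b : 'I_n,
  num_violates (code P) (code A) x a b])); last first.
  by move=> x; apply: exists_lt_code => a; apply: exists_lt_code => b.
rewrite negb_exists; apply: eq_forallb => x; apply/idP/idP.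
  move=> /existsPn h; apply/implyP => xP; apply/forall_inP => a aP; apply/forall_inP => b bP.
  have /existsPn/(_ b) := h a.
  rewrite /num_violates !num_touchesE !num_linkedE num_blockE num_diffE num_linked0E.
  rewrite !bit_code xP aP bP /= => /negP no.
  do 5!apply/implyP => ?; apply/negPn/negP => nab; case: no.
  by do 5!(apply/andP; split=> //).
move=> h; apply/existsPn => a; apply/existsPn => b.
rewrite /num_violates !num_touchesE !num_linkedE num_blockE num_diffE num_linked0E.
rewrite !bit_code; apply/negP => /and5P[xP aP bP xa /and5P[xb ya yb ab]].
apply/negP; rewrite negbK; have /forall_inP/(_ a aP)/forall_inP/(_ b bP) := implyP h xP.
by rewrite xa xb ya yb ab.
Qed.

Lemma num_choiceE P Z A v c : let: (ok, x, V, col) := choice e P Z A v c in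
  num_choice_ok (code P) (code Z) (code A) v c = ok /\
  (ok -> [/\ num_choice_weight (code P) (code Z) (code A) v c = x,
             num_choice_target (code P) (code Z) v c = code V
           & num_choice_colour (code P) (code Z) (code A) v c = col]).
Proof.
rewrite /choice /num_choice_ok /num_choice_weight /num_choice_target /num_choice_colour /num_seen.
rewrite num_complE !num_seesE num_uncolouredE !num_cardE num_singleE.
case: ifP => c2 //=; case: eqP => c3 /=; first by rewrite andbT; split=> // _; rewrite eqb_id.
case: insubP => [w _ wE|/negPf->]; last by rewrite andbF.
by rewrite -wE ltn_ord bit_code num_singleE num_unionE /=; split=> // _.
Qed.

Lemma num_paintE col A V : num_paint col (code A) (code V) = code (paint col A V).
Proof. by rewrite /num_paint /paint num_unionE; case: col. Qed.

Definition state_code (s : state n) :=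
  let: (k, f, U, P, Z, A, R) := s in
  num_state k f (code U) (code P) (code Z) (code A) (code R).

(** Bounds under which a state can be decoded digit by digit; [step] preserves them. *)
Definition small (s : state n) := let: (k, f, U, P, Z, A, R) := s in (k <= n) && (f <= 16 * n).

Lemma num_all_settledE P Z A : ~~ exists_lt n (num_unsettled (code P) (code Z) (code A)) = all_settled e P Z A.
Proof.
rewrite (@exists_lt_code _ _ (unsettled e P Z A)) ?negb_exists // => v; exact: num_unsettledE.
Qed.

Lemma num_stepE k f U P Z A R c :
  num_step k f (code U) (code P) (code Z) (code A) (code R) c =
  oapp state_code 0 (step e (k, f, U, P, Z, A, R) c).
Proof.
rewrite /num_step /step !code_eq0; case: ifP => _.
  rewrite /num_open; have := num_peelE U; case: (peel e U) => [[P' U']|->] //.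
  case=> -> -> -> -> /=; rewrite num_cardE; case: ifP => _.
    by rewrite /= !code0.
  case: insubP => [r _ rE|/negPf-> //]; rewrite -rE ltn_ord bit_code /=.
  by case: ifP => _ //=; rewrite num_singleE code0.
case: ifP => _; last first.
  rewrite /num_join num_coloured_leadersE num_diffE code_eq0 setD_eq0.
  case: ifP => _ /=; first by rewrite !code0.
  case: insubP => [q _ qE|/negPf-> //]; rewrite -qE ltn_ord !bit_code /=.
  rewrite (@exists_lt_code _ _ (fun s => (s \in R) && hits e P Z A q s)); last first.
    by move=> s; rewrite bit_code num_hitsE.
  case: ifP => _ //=; rewrite subn1; congr num_state.
  by rewrite -num_unionE; congr num_union; apply: mask_code => r; rewrite in_set bit_code num_hitsE.
rewrite (@first_code _ _ (pending e P Z A)); last by move=> v; apply: num_pendingE.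
case: (first_vertex _) => [v|]; last first.
  rewrite ltnn /num_close num_all_settledE num_filledE num_tree_checkE num_coloured_leadersE.
  by rewrite num_block_leadersE num_interE !num_cardE code_eq0; case: ifP.
rewrite ltn_ord /num_colour; have := num_choiceE P Z A v c.
case: (choice e P Z A v c) => [[[ok x] V] col] [-> h].
case: ok h => //= /(_ isT)[-> -> ->]; case: ifP => //= _.
by rewrite num_unionE num_paintE code0.
Qed.

Lemma num_field0 (a q : nat) : a < num_base -> num_field (a + q * num_base) 0 = a.
Proof.
move=> aB; have B0 : 0 < num_base by apply: leq_ltn_trans aB.
by rewrite /num_field /= addnC divnMDl // divn_small // addn0 addKn.
Qed.

Lemma num_fieldS (a q : nat) i : a < num_base -> num_field (a + q * num_base) i.+1 = num_field q i.
Proof.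
move=> aB; have B0 : 0 < num_base by apply: leq_ltn_trans aB.
by rewrite /num_field !iterSr addnC divnMDl // divn_small // addn0.
Qed.

Lemma num_fields (k f U P Z A R : nat) : let x := num_state k f U P Z A R - 1 in
  all (fun a : nat => a < num_base) [:: k; f; U; P; Z; A; R] ->
  [/\ num_field x 6 = k, num_field x 5 = f, num_field x 4 = U &
  [/\ num_field x 3 = P, num_field x 2 = Z, num_field x 1 = A & num_field x 0 = R]].
Proof.
rewrite /num_state subn1 /=; case/and5P=> hk hf hU hP /and4P[hZ hA hR _].
rewrite !num_fieldS ?num_field0 //; split=> //.
by have := @num_field0 k 0 hk; rewrite mul0n addn0.
Qed.

Lemma num_base_gt (s : state n) : small s ->
  let: (k, f, U, P, Z, A, R) := s in
  all (fun a : nat => a < num_base) [:: k; f; code U; code P; code Z; code A; code R].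
Proof.
case: s => [[[[[[k f] U] P] Z] A] R] /andP[kn fn].
have B : num_base = 64 * 2 ^ n by rewrite /num_base /pow2 minnn.
have n2 := ltn_expl n (ltnSn 1).
have cB (X : {set 'I_n}) : code X < num_base.
  by apply: leq_trans (ltn_code X) _; rewrite B leq_pmull.
by rewrite /= !cB B; move: (2 ^ n) n2 kn fn => p; move: (n) => q; clear; lia.
Qed.

Lemma num_nextE (s : state n) c : small s ->
  num_next (state_code s) c = oapp state_code 0 (step e s c).
Proof.
case: s => [[[[[[k f] U] P] Z] A] R] sm; rewrite /num_next -num_stepE.
have := num_fields (num_base_gt sm); rewrite /state_code /=.
by case=> -> -> -> [-> -> -> ->].
Qed.

Lemma num_goalE (s : state n) : small s -> num_goal (state_code s) = finished s.
Proof.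
case: s => [[[[[[k f] U] P] Z] A] R] sm; rewrite /num_goal /finished.
have := num_fields (num_base_gt sm); rewrite /state_code /=.
by case=> _ _ -> [-> _ _ _]; rewrite code_eq0 num_cardE.
Qed.

Lemma small_step (s s' : state n) c : small s -> step e s c = Some s' -> small s'.
Proof.
case: s => [[[[[[k f] U] P] Z] A] R] /andP[kn fn]; rewrite /step.
case: ifP => _.
  case: (peel e U) => [[P' U']|] //; case: ifP => _; first by move=> [<-] /=; rewrite kn.
  case: insubP => // r _ _; case: ifP => // _ [<-]; rewrite /= kn.
  by apply: leq_trans (leq_subr _ _) _; rewrite leq_mul2l.
case: ifP => _; last first.
  case: ifP => _; first by move=> [<-] /=; rewrite kn.
  case: insubP => // q _ _; case: ifP => // _ [<-] /=; rewrite andbT.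
  exact: leq_trans (leq_pred _) kn.
case: (first_vertex _) => [v|].
  case: (choice e P Z A v c) => [[[ok x] V] col]; case: ifP => // _ [<-] /=.
  by rewrite kn (leq_trans (leq_subr _ _)).
by case: ifP => // _ [<-] /=; rewrite (leq_trans (leq_subr _ _)).
Qed.

Lemma state_code_bitlength (s : state n) : small s -> bitlength (state_code s) <= 7 * n + 50.
Proof.
case: s => [[[[[[k f] U] P] Z] A] R] sm; have := num_base_gt sm.
case/and5P=> hk hf hU hP /and4P[hZ hA hR _].
have step (a q i : nat) : a < num_base -> q < num_base ^ i -> a + q * num_base < num_base ^ i.+1.
  by rewrite expnSr; move: num_base (_ ^ i) => B p; clear; nia.
apply: bitlength_leq; first by rewrite addn_gt0 orbT.
(* Seven digits of [n + 6] bits each. *)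
have B : num_base ^ 7 = 2 ^ (7 * n + 42).
  by rewrite /num_base /pow2 minnn (_ : 64 = 2 ^ 6) // -expnD -expnM; congr (_ ^ _); lia.
apply: leq_trans (_ : 2 ^ (7 * n + 43) <= _); last by rewrite leq_exp2l // leq_add2l.
have -> : 7 * n + 43 = (7 * n + 42).+1 by rewrite addnS.
rewrite expnS -B mul2n -addnn /state_code /num_state.
have : (code R + (code A + (code Z + (code P + (code U + (f + k * num_base) * num_base) * num_base)
   * num_base) * num_base) * num_base) < num_base ^ 7.
  apply: (step _ _ 6 hR); apply: (step _ _ 5 hA); apply: (step _ _ 4 hZ); apply: (step _ _ 3 hP).
  by apply: (step _ _ 2 hU); apply: (step _ _ 1 hf); rewrite expn1.
move: (num_base ^ 7) (_ + _) => p q; lia.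
Qed.

Lemma num_startE : num_start = if (0 < n) && [forall v : 'I_n, forall w : 'I_n, connect e v w]
  then state_code (checkpoint (read m 1) setT) else 0.
Proof.
have full : num_compl 0 = code ([set: 'I_n]) by rewrite -setC0 -num_complE code0.
rewrite /num_start full (@exists_lt_code _ _ (fun v => [exists w, ~~ connect e v w])).
  rewrite negb_exists /= !code0; congr (if _ && _ then _ else _); apply: eq_forallb => v.
  by rewrite negb_exists; apply: eq_forallb => w; rewrite negbK.
move=> v; apply: exists_lt_code => w; rewrite num_linked0E; congr (~~ _).
by apply: eq_connect => a b; rewrite /mono !inE eqxx andbT.
Qed.

End Codes.

(** * Computability of the transition function *)

Lemma computable_fst2 (c : context) (f : c -> nat) :
  computable f -> computable (fun x : extend (extend c) => f x.1.1).
Proof. by move=> cf; apply: (computable_fst (computable_fst cf)). Qed.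

Lemma computable_fst3 (c : context) (f : c -> nat) :
  computable f -> computable (fun x : extend (extend (extend c)) => f x.1.1.1).
Proof. by move=> cf; apply: (computable_fst (computable_fst2 cf)). Qed.

Create HintDb computability.

(** Follows the syntax of the function; the hint after each lemma makes later goals stop at the
    function named there. *)
Ltac computability := cbn beta; lazymatch goal with
  | |- computable (fun _ => ?k) => exact: computable_const
  | |- @computable_pred ?c (fun x => @?a x && @?b x) =>
      refine (@computable_and c a b _ _); computability
  | |- @computable_pred ?c (fun x => @?a x || @?b x) =>
      refine (@computable_or c a b _ _); computability
  | |- @computable_pred ?c (fun x => ~~ @?a x) =>
      refine (@computable_not c a _); computability
  | |- @computable_pred ?c (fun x => @?a x (+) @?b x) =>
      refine (@computable_addb c a b _ _); computability
  | |- @computable_pred ?c (fun x => @?f x <= @?g x) =>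
      first [refine (@computable_leq c f g _ _) | refine (@computable_ltn c _ _ _ _)]; computability
  | |- @computable_pred ?c (fun x => @eq_op _ (@?f x) (@?g x)) =>
      first [refine (@computable_eqb c f g _ _) | refine (@computable_eqn c f g _ _)]; computability
  | |- @computable_pred ?c (fun x => bit _ (@?f x) (@?g x)) =>
      refine (@computable_bit c f g _ _); computability
  | |- @computable_pred ?c (fun x => exists_lt _ (@?p x)) =>
      refine (@computable_exists c p _); computability
  | |- @computable ?c (fun x => mask _ (@?p x)) =>
      refine (@computable_mask c p _); computability
  | |- @computable ?c (fun x => counting _ (@?p x)) =>
      refine (@computable_counting c p _); computability
  | |- @computable ?c (fun x => first _ (@?p x)) =>
      refine (@computable_first c p _); computability
  | |- @computable ?c (fun x => @?f x + @?g x) =>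
      refine (@computableD c f g _ _); computability
  | |- @computable ?c (fun x => @?f x * @?g x) =>
      refine (@computableM c f g _ _); computability
  | |- @computable ?c (fun x => @?f x - @?g x) =>
      refine (@computableB c f g _ _); computability
  | |- @computable ?c (fun x => @?f x %/ @?g x) =>
      refine (@computable_div c f g _ _); computability
  | |- @computable ?c (fun x => (@?f x).+1) =>
      refine (@computableD c (fun=> 1) f _ _); computability
  | |- @computable ?c (fun x => pow2 _ (@?f x)) =>
      refine (@computable_pow2 c f _); computability
  | |- @computable ?c (fun x => read _ (@?f x)) =>
      refine (@computable_read c f _); computability
  | |- _ => first
      [ assumption | exact: computable_snd | exact: computable_order
      | exact: (computable_fst (@computable_snd _)) | exact: (computable_fst2 (@computable_snd _))
      | exact: (computable_fst3 (@computable_snd _))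
      | refine (computable_fst _); assumption | refine (computable_fst2 _); assumption
      | refine (computable_fst3 _); assumption
      | solve [auto 1 with computability nocore]
      | lazymatch goal with
        | |- computable_pred _ => refine (@computable_pred_if _ _ _ _ _ _ _); computability
        | |- _ => refine (@computable_if _ _ _ _ _ _ _); computability
        end ]
  end.

Lemma computable_edge (c : context) (v w : c -> nat) :
  computable v -> computable w ->
  computable_pred (fun x => edge (inp x) (v x) (w x)).
Proof. by move=> *; rewrite /edge; computability. Qed.
#[local] Hint Extern 0 (computable_pred (fun x => edge _ _ _)) =>
  refine (@computable_edge _ _ _ _ _); computability : computability.

Lemma computable_single (c : context) (v : c -> nat) :
  computable v ->
  computable (fun x => num_single (inp x) (v x)).
Proof. by move=> *; rewrite /num_single; computability. Qed.
#[local] Hint Extern 0 (computable (fun x => num_single _ _)) =>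
  refine (@computable_single _ _ _); computability : computability.

Lemma computable_union (c : context) (X Y : c -> nat) :
  computable X -> computable Y ->
  computable (fun x => num_union (inp x) (X x) (Y x)).
Proof. by move=> *; rewrite /num_union; computability. Qed.
#[local] Hint Extern 0 (computable (fun x => num_union _ _ _)) =>
  refine (@computable_union _ _ _ _ _); computability : computability.

Lemma computable_inter (c : context) (X Y : c -> nat) :
  computable X -> computable Y ->
  computable (fun x => num_inter (inp x) (X x) (Y x)).
Proof. by move=> *; rewrite /num_inter; computability. Qed.
#[local] Hint Extern 0 (computable (fun x => num_inter _ _ _)) =>
  refine (@computable_inter _ _ _ _ _); computability : computability.

Lemma computable_compl (c : context) (X : c -> nat) :
  computable X ->
  computable (fun x => num_compl (inp x) (X x)).
Proof. by move=> *; rewrite /num_compl; computability. Qed.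
#[local] Hint Extern 0 (computable (fun x => num_compl _ _)) =>
  refine (@computable_compl _ _ _); computability : computability.

Lemma computable_diff (c : context) (X Y : c -> nat) :
  computable X -> computable Y ->
  computable (fun x => num_diff (inp x) (X x) (Y x)).
Proof. by move=> *; rewrite /num_diff; computability. Qed.
#[local] Hint Extern 0 (computable (fun x => num_diff _ _ _)) =>
  refine (@computable_diff _ _ _ _ _); computability : computability.

Lemma computable_card (c : context) (X : c -> nat) :
  computable X ->
  computable (fun x => num_card (inp x) (X x)).
Proof. by move=> *; rewrite /num_card; computability. Qed.
#[local] Hint Extern 0 (computable (fun x => num_card _ _)) =>
  refine (@computable_card _ _ _); computability : computability.

Lemma computable_reach (c : context) (D A x0 X : c -> nat) :
  computable D -> computable A -> computable x0 -> computable X ->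
  computable (fun x => num_reach (inp x) (D x) (A x) (x0 x) (X x)).
Proof. by move=> *; rewrite /num_reach; computability. Qed.
#[local] Hint Extern 0 (computable (fun x => num_reach _ _ _ _ _)) =>
  refine (@computable_reach _ _ _ _ _ _ _ _ _); computability : computability.

Lemma computable_block (c : context) (D A v : c -> nat) :
  computable D -> computable A -> computable v ->
  computable (fun x => num_block (inp x) (D x) (A x) (v x)).
Proof.
move=> cD cA cv.
apply: (@computable_iteri c (fun x => inp x 0) (fun=> 0)
  (fun x _ X => num_reach (inp x) (D x) (A x) (v x) X)) => //.
- exact: computable_const.
- by computability.
(* Every round returns a mask, so the accumulator stays below [2 ^ n]. *)
exists (fun L => L + 1); split; first by poly.
move=> x L [_ nL _ _] j _; rewrite addn1; apply: bitlength_leq => //; rewrite expnS.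
have n2 : 2 ^ inp x 0 <= 2 ^ L by rewrite leq_exp2l.
have p2 : 0 < 2 ^ L by rewrite expn_gt0.
case: j => [|j] /=; first lia.
have := ltn_mask (inp x 0) (fun i => (i == v x) || exists_lt (inp x 0) (fun j0 =>
  bit (inp x 0) (iteri j (fun _ => num_reach (inp x) (D x) (A x) (v x)) 0) j0 &&
  [&& bit (inp x 0) (D x) j0, bit (inp x 0) (D x) i, edge (inp x) j0 i
    & bit (inp x 0) (A x) j0 == bit (inp x 0) (A x) i])).
by rewrite /num_reach; lia.
Qed.
#[local] Hint Extern 0 (computable (fun x => num_block _ _ _ _)) =>
  refine (@computable_block _ _ _ _ _ _ _); computability : computability.

Lemma computable_linked (c : context) (D A v w : c -> nat) :
  computable D -> computable A -> computable v -> computable w ->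
  computable_pred (fun x => num_linked (inp x) (D x) (A x) (v x) (w x)).
Proof. by move=> *; rewrite /num_linked; computability. Qed.
#[local] Hint Extern 0 (computable_pred (fun x => num_linked _ _ _ _ _)) =>
  refine (@computable_linked _ _ _ _ _ _ _ _ _); computability : computability.

Lemma computable_sees (c : context) (P Z A v : c -> nat) :
  computable P -> computable Z -> computable A -> computable v ->
  computable_pred (fun x => num_sees (inp x) (P x) (Z x) (A x) (v x)).
Proof. by move=> *; rewrite /num_sees; computability. Qed.
#[local] Hint Extern 0 (computable_pred (fun x => num_sees _ _ _ _ _)) =>
  refine (@computable_sees _ _ _ _ _ _ _ _ _); computability : computability.

Lemma computable_uncoloured (c : context) (P Z v : c -> nat) :
  computable P -> computable Z -> computable v ->
  computable (fun x => num_uncoloured (inp x) (P x) (Z x) (v x)).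
Proof. by move=> *; rewrite /num_uncoloured; computability. Qed.
#[local] Hint Extern 0 (computable (fun x => num_uncoloured _ _ _ _)) =>
  refine (@computable_uncoloured _ _ _ _ _ _ _); computability : computability.

Lemma computable_settled (c : context) (P Z A v : c -> nat) :
  computable P -> computable Z -> computable A -> computable v ->
  computable_pred (fun x => num_settled (inp x) (P x) (Z x) (A x) (v x)).
Proof. by move=> *; rewrite /num_settled; computability. Qed.
#[local] Hint Extern 0 (computable_pred (fun x => num_settled _ _ _ _ _)) =>
  refine (@computable_settled _ _ _ _ _ _ _ _ _); computability : computability.

Lemma computable_unsettled (c : context) (P Z A v : c -> nat) :
  computable P -> computable Z -> computable A -> computable v ->
  computable_pred (fun x => num_unsettled (inp x) (P x) (Z x) (A x) (v x)).
Proof. by move=> *; rewrite /num_unsettled; computability. Qed.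
#[local] Hint Extern 0 (computable_pred (fun x => num_unsettled _ _ _ _ _)) =>
  refine (@computable_unsettled _ _ _ _ _ _ _ _ _); computability : computability.

Lemma computable_pending (c : context) (P Z A v : c -> nat) :
  computable P -> computable Z -> computable A -> computable v ->
  computable_pred (fun x => num_pending (inp x) (P x) (Z x) (A x) (v x)).
Proof. by move=> *; rewrite /num_pending; computability. Qed.
#[local] Hint Extern 0 (computable_pred (fun x => num_pending _ _ _ _ _)) =>
  refine (@computable_pending _ _ _ _ _ _ _ _ _); computability : computability.

Lemma computable_filled (c : context) (P Z A : c -> nat) :
  computable P -> computable Z -> computable A ->
  computable (fun x => num_filled (inp x) (P x) (Z x) (A x)).
Proof. by move=> *; rewrite /num_filled; computability. Qed.
#[local] Hint Extern 0 (computable (fun x => num_filled _ _ _ _)) =>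
  refine (@computable_filled _ _ _ _ _ _ _); computability : computability.

Lemma computable_leaders (c : context) (K A D : c -> nat) :
  computable K -> computable A -> computable D ->
  computable (fun x => num_leaders (inp x) (K x) (A x) (D x)).
Proof. by move=> *; rewrite /num_leaders; computability. Qed.
#[local] Hint Extern 0 (computable (fun x => num_leaders _ _ _ _)) =>
  refine (@computable_leaders _ _ _ _ _ _ _); computability : computability.

Lemma computable_coloured_leaders (c : context) (P Z A : c -> nat) :
  computable P -> computable Z -> computable A ->
  computable (fun x => num_coloured_leaders (inp x) (P x) (Z x) (A x)).
Proof. by move=> *; rewrite /num_coloured_leaders; computability. Qed.
#[local] Hint Extern 0 (computable (fun x => num_coloured_leaders _ _ _ _)) =>
  refine (@computable_coloured_leaders _ _ _ _ _ _ _); computability : computability.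

Lemma computable_block_leaders (c : context) (P Z A : c -> nat) :
  computable P -> computable Z -> computable A ->
  computable (fun x => num_block_leaders (inp x) (P x) (Z x) (A x)).
Proof. by move=> *; rewrite /num_block_leaders; computability. Qed.
#[local] Hint Extern 0 (computable (fun x => num_block_leaders _ _ _ _)) =>
  refine (@computable_block_leaders _ _ _ _ _ _ _); computability : computability.

Lemma computable_hits (c : context) (P Z A q r : c -> nat) :
  computable P -> computable Z -> computable A -> computable q -> computable r ->
  computable_pred (fun x => num_hits (inp x) (P x) (Z x) (A x) (q x) (r x)).
Proof. by move=> *; rewrite /num_hits; computability. Qed.
#[local] Hint Extern 0 (computable_pred (fun x => num_hits _ _ _ _ _ _)) =>
  refine (@computable_hits _ _ _ _ _ _ _ _ _ _ _); computability : computability.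

Lemma computable_biconnected (c : context) (P : c -> nat) :
  computable P ->
  computable_pred (fun x => num_biconnected (inp x) (P x)).
Proof. by move=> *; rewrite /num_biconnected; computability. Qed.
#[local] Hint Extern 0 (computable_pred (fun x => num_biconnected _ _)) =>
  refine (@computable_biconnected _ _ _); computability : computability.

Lemma computable_cut_block (c : context) (U v s : c -> nat) :
  computable U -> computable v -> computable s ->
  computable (fun x => num_cut_block (inp x) (U x) (v x) (s x)).
Proof. by move=> *; rewrite /num_cut_block; computability. Qed.
#[local] Hint Extern 0 (computable (fun x => num_cut_block _ _ _ _)) =>
  refine (@computable_cut_block _ _ _ _ _ _ _); computability : computability.

Lemma computable_good_cut (c : context) (U v s : c -> nat) :
  computable U -> computable v -> computable s ->
  computable_pred (fun x => num_good_cut (inp x) (U x) (v x) (s x)).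
Proof. by move=> *; rewrite /num_good_cut; computability. Qed.
#[local] Hint Extern 0 (computable_pred (fun x => num_good_cut _ _ _ _)) =>
  refine (@computable_good_cut _ _ _ _ _ _ _); computability : computability.

Lemma computable_peel_vertex (c : context) (U : c -> nat) :
  computable U ->
  computable (fun x => num_peel_vertex (inp x) (U x)).
Proof. by move=> *; rewrite /num_peel_vertex; computability. Qed.
#[local] Hint Extern 0 (computable (fun x => num_peel_vertex _ _)) =>
  refine (@computable_peel_vertex _ _ _); computability : computability.

Lemma computable_peel_side (c : context) (U : c -> nat) :
  computable U ->
  computable (fun x => num_peel_side (inp x) (U x)).
Proof. by move=> *; rewrite /num_peel_side; computability. Qed.
#[local] Hint Extern 0 (computable (fun x => num_peel_side _ _)) =>
  refine (@computable_peel_side _ _ _); computability : computability.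

Lemma computable_peel_part (c : context) (U : c -> nat) :
  computable U ->
  computable (fun x => num_peel_part (inp x) (U x)).
Proof. by move=> *; rewrite /num_peel_part; computability. Qed.
#[local] Hint Extern 0 (computable (fun x => num_peel_part _ _)) =>
  refine (@computable_peel_part _ _ _); computability : computability.

Lemma computable_peel_rest (c : context) (U : c -> nat) :
  computable U ->
  computable (fun x => num_peel_rest (inp x) (U x)).
Proof. by move=> *; rewrite /num_peel_rest; computability. Qed.
#[local] Hint Extern 0 (computable (fun x => num_peel_rest _ _)) =>
  refine (@computable_peel_rest _ _ _); computability : computability.

Lemma computable_touches (c : context) (P A v a : c -> nat) :
  computable P -> computable A -> computable v -> computable a ->
  computable_pred (fun x => num_touches (inp x) (P x) (A x) (v x) (a x)).
Proof. by move=> *; rewrite /num_touches; computability. Qed.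
#[local] Hint Extern 0 (computable_pred (fun x => num_touches _ _ _ _ _)) =>
  refine (@computable_touches _ _ _ _ _ _ _ _ _); computability : computability.

Lemma computable_violates (c : context) (P A v a b : c -> nat) :
  computable P -> computable A -> computable v -> computable a -> computable b ->
  computable_pred (fun x => num_violates (inp x) (P x) (A x) (v x) (a x) (b x)).
Proof. by move=> *; rewrite /num_violates; computability. Qed.
#[local] Hint Extern 0 (computable_pred (fun x => num_violates _ _ _ _ _ _)) =>
  refine (@computable_violates _ _ _ _ _ _ _ _ _ _ _); computability : computability.

Lemma computable_tree_check (c : context) (P A : c -> nat) :
  computable P -> computable A ->
  computable_pred (fun x => num_tree_check (inp x) (P x) (A x)).
Proof. by move=> *; rewrite /num_tree_check; computability. Qed.
#[local] Hint Extern 0 (computable_pred (fun x => num_tree_check _ _ _)) =>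
  refine (@computable_tree_check _ _ _ _ _); computability : computability.

Lemma computable_seen (c : context) (P Z A v d : c -> nat) :
  computable P -> computable Z -> computable A -> computable v -> computable d ->
  computable_pred (fun x => num_seen (inp x) (P x) (Z x) (A x) (v x) (d x)).
Proof. by move=> *; rewrite /num_seen; computability. Qed.
#[local] Hint Extern 0 (computable_pred (fun x => num_seen _ _ _ _ _ _)) =>
  refine (@computable_seen _ _ _ _ _ _ _ _ _ _ _); computability : computability.

Lemma computable_choice_ok (c : context) (P Z A v d : c -> nat) :
  computable P -> computable Z -> computable A -> computable v -> computable d ->
  computable_pred (fun x => num_choice_ok (inp x) (P x) (Z x) (A x) (v x) (d x)).
Proof. by move=> *; rewrite /num_choice_ok; computability. Qed.
#[local] Hint Extern 0 (computable_pred (fun x => num_choice_ok _ _ _ _ _ _)) =>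
  refine (@computable_choice_ok _ _ _ _ _ _ _ _ _ _ _); computability : computability.

Lemma computable_choice_weight (c : context) (P Z A v d : c -> nat) :
  computable P -> computable Z -> computable A -> computable v -> computable d ->
  computable (fun x => num_choice_weight (inp x) (P x) (Z x) (A x) (v x) (d x)).
Proof. by move=> *; rewrite /num_choice_weight; computability. Qed.
#[local] Hint Extern 0 (computable (fun x => num_choice_weight _ _ _ _ _ _)) =>
  refine (@computable_choice_weight _ _ _ _ _ _ _ _ _ _ _); computability : computability.

Lemma computable_choice_target (c : context) (P Z v d : c -> nat) :
  computable P -> computable Z -> computable v -> computable d ->
  computable (fun x => num_choice_target (inp x) (P x) (Z x) (v x) (d x)).
Proof. by move=> *; rewrite /num_choice_target; computability. Qed.
#[local] Hint Extern 0 (computable (fun x => num_choice_target _ _ _ _ _)) =>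
  refine (@computable_choice_target _ _ _ _ _ _ _ _ _); computability : computability.

Lemma computable_choice_colour (c : context) (P Z A v d : c -> nat) :
  computable P -> computable Z -> computable A -> computable v -> computable d ->
  computable_pred (fun x => num_choice_colour (inp x) (P x) (Z x) (A x) (v x) (d x)).
Proof. by move=> *; rewrite /num_choice_colour; computability. Qed.
#[local] Hint Extern 0 (computable_pred (fun x => num_choice_colour _ _ _ _ _ _)) =>
  refine (@computable_choice_colour _ _ _ _ _ _ _ _ _ _ _); computability : computability.

Lemma computable_base (c : context) : computable (fun x : c => num_base (inp x)).
Proof. by rewrite /num_base; computability. Qed.
#[local] Hint Extern 0 (computable (fun x => num_base _)) =>
  refine (@computable_base _); computability : computability.

Lemma computable_state (c : context) (k f U P Z A R : c -> nat) :
  computable k -> computable f -> computable U -> computable P -> computable Z -> computable A -> computable R ->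
  computable (fun x => num_state (inp x) (k x) (f x) (U x) (P x) (Z x) (A x) (R x)).
Proof. by move=> *; rewrite /num_state; computability. Qed.
#[local] Hint Extern 0 (computable (fun x => num_state _ _ _ _ _ _ _ _)) =>
  refine (@computable_state _ _ _ _ _ _ _ _ _ _ _ _ _ _ _); computability : computability.

Lemma computable_open (c : context) (k U d : c -> nat) :
  computable k -> computable U -> computable d ->
  computable (fun x => num_open (inp x) (k x) (U x) (d x)).
Proof. by move=> *; rewrite /num_open; computability. Qed.
#[local] Hint Extern 0 (computable (fun x => num_open _ _ _ _)) =>
  refine (@computable_open _ _ _ _ _ _ _); computability : computability.

Lemma computable_colour (c : context) (k f U P Z A v d : c -> nat) :
  computable k -> computable f -> computable U -> computable P -> computable Z -> computable A -> computable v -> computable d ->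
  computable (fun x => num_colour (inp x) (k x) (f x) (U x) (P x) (Z x) (A x) (v x) (d x)).
Proof. by move=> *; rewrite /num_colour; computability. Qed.
#[local] Hint Extern 0 (computable (fun x => num_colour _ _ _ _ _ _ _ _ _)) =>
  refine (@computable_colour _ _ _ _ _ _ _ _ _ _ _ _ _ _ _ _ _); computability : computability.

Lemma computable_close (c : context) (k f U P Z A V W : c -> nat) :
  computable k -> computable f -> computable U -> computable P -> computable Z -> computable A -> computable V -> computable W ->
  computable (fun x => num_close (inp x) (k x) (f x) (U x) (P x) (Z x) (A x) (V x) (W x)).
Proof. by move=> *; rewrite /num_close; computability. Qed.
#[local] Hint Extern 0 (computable (fun x => num_close _ _ _ _ _ _ _ _ _)) =>
  refine (@computable_close _ _ _ _ _ _ _ _ _ _ _ _ _ _ _ _ _); computability : computability.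

Lemma computable_join (c : context) (k U P Z A R V d : c -> nat) :
  computable k -> computable U -> computable P -> computable Z -> computable A -> computable R -> computable V -> computable d ->
  computable (fun x => num_join (inp x) (k x) (U x) (P x) (Z x) (A x) (R x) (V x) (d x)).
Proof. by move=> *; rewrite /num_join; computability. Qed.
#[local] Hint Extern 0 (computable (fun x => num_join _ _ _ _ _ _ _ _ _)) =>
  refine (@computable_join _ _ _ _ _ _ _ _ _ _ _ _ _ _ _ _ _); computability : computability.

Lemma computable_step (c : context) (k f U P Z A R d : c -> nat) :
  computable k -> computable f -> computable U -> computable P -> computable Z -> computable A -> computable R -> computable d ->
  computable (fun x => num_step (inp x) (k x) (f x) (U x) (P x) (Z x) (A x) (R x) (d x)).
Proof. by move=> *; rewrite /num_step; computability. Qed.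
#[local] Hint Extern 0 (computable (fun x => num_step _ _ _ _ _ _ _ _ _)) =>
  refine (@computable_step _ _ _ _ _ _ _ _ _ _ _ _ _ _ _ _ _); computability : computability.

Lemma computable_field (c : context) (v : c -> nat) i :
  computable v -> computable (fun x => num_field (inp x) (v x) i).
Proof.
move=> cv; have ci j : computable (fun x : c => iter j (divn^~ (num_base (inp x))) (v x)).
  by elim: j => [|j IH]; [exact: cv|exact: (computable_div IH (@computable_base c))].
exact: (computableB (ci i) (computableM (ci i.+1) (@computable_base c))).
Qed.
#[local] Hint Extern 0 (computable (fun x => num_field _ _ _)) =>
  refine (@computable_field _ _ _ _); computability : computability.

Lemma computable_next (c : context) (v d : c -> nat) :
  computable v -> computable d -> computable (fun x => num_next (inp x) (v x) (d x)).
Proof. by move=> *; rewrite /num_next; cbv zeta; computability. Qed.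

Lemma computable_goal (c : context) (v : c -> nat) :
  computable v -> computable_pred (fun x => num_goal (inp x) (v x)).
Proof. by move=> *; rewrite /num_goal; computability. Qed.

Lemma computable_start (c : context) : computable (fun x : c => num_start (inp x)).
Proof. by rewrite /num_start; computability. Qed.

(** * The number of states *)

Section Growth.
Local Open Scope ring_scope.
Import Order.TTheory GRing.Theory Num.Theory.
Variable F : realFieldType.

Lemma ratio_le (D S p q : nat) : (0 < D)%N -> (0 < q)%N -> (S * q <= p * D)%N ->
  S%:R / D%:R <= p%:R / q%:R :> F.
Proof.
move=> D0 q0 le; rewrite ler_pdivrMr ?ltr0n // mulrAC ler_pdivlMr ?ltr0n //.
by rewrite -!natrM ler_nat.
Qed.

Lemma expr_ratio (a b m i : nat) : (0 < a)%N -> (i <= m)%N ->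
  (b%:R / a%:R) ^+ i = (b ^ i * a ^ (m - i))%N%:R / (a ^ m)%N%:R :> F.
Proof.
move=> a0 le; have a0' : (a%:R : F) != 0 by rewrite pnatr_eq0 -lt0n.
rewrite expr_div_n natrM !natrX -{2}(subnKC le) exprD -mulf_div divff ?mulr1 //.
by rewrite expf_neq0.
Qed.

(* [z = 1.1041].  The last four bounds are the branching numbers at a vertex that
   sees both colours, or one colour and has one, two, or at least three uncoloured
   neighbours. *)
Lemma growth_rate : exists z : F, [/\ 1 <= z, 2%:R <= z ^+ 7, z ^+ 16 <= 488%:R / 100%:R &
  [/\ z^-1 ^+ 10 + z^-1 ^+ 10 <= 199%:R / 200%:R,
      z^-1 ^+ 10 + z^-1 ^+ 9 + z^-1 ^+ 16 <= 199%:R / 200%:R,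
      z^-1 ^+ 10 + z^-1 ^+ 18 + (z^-1 ^+ 16 + z^-1 ^+ 16) <= 199%:R / 200%:R
    & z^-1 ^+ 10 + z^-1 ^+ 6 + z^-1 ^+ 27 <= 199%:R / 200%:R]].
Proof.
have [a [b [a0 b0 [h1 h7 h16] [d1 d2 d3 d4]]]] : exists a b, [/\ 0 < a, 0 < b,
  [/\ b <= a, 2 * b ^ 7 <= a ^ 7 & a ^ 16 * 100 <= 488 * b ^ 16] &
  [/\ (b ^ 10 * a ^ 17 + b ^ 10 * a ^ 17) * 200 <= 199 * a ^ 27,
      (b ^ 10 * a ^ 17 + b ^ 9 * a ^ 18 + b ^ 16 * a ^ 11) * 200 <= 199 * a ^ 27,
      (b ^ 10 * a ^ 17 + b ^ 18 * a ^ 9 + (b ^ 16 * a ^ 11 + b ^ 16 * a ^ 11)) * 200 <= 199 * a ^ 27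
    & (b ^ 10 * a ^ 17 + b ^ 6 * a ^ 21 + b ^ 27 * a ^ 0) * 200 <= 199 * a ^ 27]]%N.
  exists (110 * 100 + 41)%N, (100 * 100)%N.
  split; [lia|lia|split; lia|split; lia].
exists (a%:R / b%:R).
have E m : (a%:R / b%:R) ^+ m = (a ^ m)%N%:R / (b ^ m)%N%:R :> F by rewrite expr_div_n !natrX.
rewrite invf_div !E; split.
- by rewrite ler_pdivlMr ?ltr0n // mul1r ler_nat.
- by rewrite ler_pdivlMr ?ltr0n ?expn_gt0 ?b0 // -natrM ler_nat.
- by apply: ratio_le; rewrite // expn_gt0 b0.
by split; rewrite !(@expr_ratio _ _ 27) // -!mulrDl -!natrD; apply: ratio_le; rewrite ?expn_gt0 ?a0.
Qed.

(** [R] marks the elements that are counted elsewhere. *)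
Lemma collect (T : eqType) (Q : nat -> T -> Prop) (R : T -> Prop) m (w : nat -> F) :
  (forall i, (i < m)%N -> exists l : seq T, (size l)%:R <= w i /\
    forall s, Q i s -> s \in l \/ R s) ->
  exists l : seq T, (size l)%:R <= \sum_(i < m) w i /\
    forall i s, (i < m)%N -> Q i s -> s \in l \/ R s.
Proof.
elim: m => [_|m IH h]; first by exists [::]; rewrite big_ord0.
have [i lt_i|l [ls lP]] := IH; first by apply: h; rewrite ltnS ltnW.
have [l' [ls' lP']] := h m (ltnSn m).
exists (l ++ l'); split; first by rewrite big_ord_recr size_cat natrD lerD.
move=> i s; rewrite ltnS leq_eqVlt => /orP[/eqP->|lt_i] Qis; rewrite mem_cat.
  by case: (lP' s Qis) => [->|]; [left; rewrite orbT|right].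
by case: (lP i s lt_i Qis) => [->|]; [left|right].
Qed.

End Growth.

Section Counting.
Local Open Scope ring_scope.
Import Order.TTheory GRing.Theory Num.Theory.
Variables (n : nat) (e : rel 'I_n).
Hypotheses (e_sym : symmetric e) (e_irr : irreflexive e).
Local Notation steps := (steps e).
Implicit Types (U P Z A Q R V W : {set 'I_n}) (s : state n).

Lemma stepsE s s' : steps s s' ->
  s' = s \/ exists c s1, [/\ (c < n + 3)%N, step e s c = Some s1 & steps s1 s'].
Proof. by case=> [|s1 c s2 s3 lt_c st h]; [left|right; exists c, s2]. Qed.

Variables (F : realFieldType) (z : F).
Hypotheses (z_ge1 : 1 <= z) (z7 : 2%:R <= z ^+ 7).
Local Notation u := (z^-1).
Hypothesis decay : [/\ u ^+ 10 + u ^+ 10 <= 199%:R / 200%:R,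
  u ^+ 10 + u ^+ 9 + u ^+ 16 <= 199%:R / 200%:R,
  u ^+ 10 + u ^+ 18 + (u ^+ 16 + u ^+ 16) <= 199%:R / 200%:R
  & u ^+ 10 + u ^+ 6 + u ^+ 27 <= 199%:R / 200%:R].

(** States from the next checkpoint on; [covered] leaves them to the count of the next part, as they
    would otherwise be counted once for each way of getting there. *)
Definition escapes k U s := exists2 k', (k' <= k)%N & steps (checkpoint k' U) s.
Definition covered k U s (B : F) := exists l, (size l)%:R <= B /\
  forall s', steps s s' -> s' \in l \/ escapes k U s'.

(** The summand 1 counts [s] itself. *)
Lemma covered_step k U s (w : nat -> F) B : (forall c, 0 <= w c) -> 1 + \sum_(c < n + 3) w c <= B ->
  (forall c s1, (c < n + 3)%N -> step e s c = Some s1 -> covered k U s1 (w c)) ->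
  covered k U s B.
Proof.
move=> w0 le h.
have [c lt_c|l [ls lP]] := @collect F _ (fun c s' => exists2 s1, step e s c = Some s1 & steps s1 s')
  (escapes k U) (n + 3) w.
  case E: (step e s c) => [s1|]; last by exists [::]; split=> // s' [].
  have [l [ls lP]] := h c s1 lt_c E; exists l; split=> // s' [_ [<-]]; exact: lP.
exists (s :: l); split.
  by apply: le_trans le; rewrite /= -addn1 natrD addrC lerD2l.
move=> s' /stepsE[->|[c [s1 [lt_c st h1]]]]; first by left; rewrite mem_head.
by case: (lP c s' lt_c) => [|sl|]; [exists s1|left; rewrite inE sl orbT|right].
Qed.

Lemma covered_checkpoint k k' U B : (k' <= k)%N -> 0 <= B -> covered k U (checkpoint k' U) B.
Proof. by move=> le B0; exists [::]; split=> // s' h; right; exists k'. Qed.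

Lemma z_gt0 : 0 < z. Proof. exact: lt_le_trans ltr01 z_ge1. Qed.

Lemma pow2_growth m f : (7 * m <= f)%N -> (2 ^ m)%:R <= z ^+ f.
Proof.
move=> le; apply: le_trans (_ : z ^+ (7 * m) <= _); last by rewrite ler_weXn2l.
by rewrite natrX exprM; apply: lerXn2r; rewrite // ?nnegrE ?exprn_ge0 ?ler0n // ltW ?z_gt0.
Qed.

(** In the last phase of a part only two things vary: the number of contractions left, and the set
    [R] between [Rt] and [Rep]. *)
Lemma joining_covered k k2 U P Z A R : P != set0 -> R != set0 -> (k2 <= k)%N ->
  block_leaders e P Z A \subset R -> R \subset coloured_leaders e P Z A ->
  covered k U (k2, 0%N, U, P, Z, A, R)
    ((k.+1 * 2 ^ (#|coloured_leaders e P Z A| - #|block_leaders e P Z A|))%N%:R).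
Proof.
set Rep := coloured_leaders _ _ _ _; set Rt := block_leaders _ _ _ _ => P0 R0 k2k RtR RRep.
pose l : seq (state n) := [seq ((k1, 0%N, U, P, Z, A, Rt :|: W) : state n) | k1 <- iota 0 k.+1,
  W <- enum (powerset (Rep :\: Rt))].
exists l; split.
  rewrite size_allpairs size_iota -cardE card_powerset ler_nat leq_mul // leq_exp2l //.
  by rewrite cardsD (setIidPr (Rt_Rep e P Z A)).
have inl k1 (R1 : {set 'I_n}) : (k1 <= k)%N -> Rt \subset R1 -> R1 \subset Rep -> ((k1, 0%N, U, P, Z, A, R1) : state n) \in l.
  move=> k1k RtR1 R1Rep; apply/allpairsP; exists (k1, R1 :\: Rt); split.
  - by rewrite mem_iota.
  - by rewrite mem_enum powersetE setSD.
  - by rewrite setUC setDE setUIl [~: _ :|: _]setUC setUCr setIT (setUidPl RtR1).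
move=> s' h; set s0 := (k2, _, _, _, _, _, _) in h.
have : exists k1 (R1 : {set 'I_n}), [/\ s0 = (k1, 0%N, U, P, Z, A, R1), (k1 <= k)%N, R1 != set0, Rt \subset R1 & R1 \subset Rep].
  by exists k2, R.
move: s0 h => s0 h; elim: h => {s0 s'} [s0|s0 c s1 s' lt_c st h IH] [k1 [R1 [E k1k R10 RtR1 R1Rep]]].
  by left; rewrite E; apply: inl.
move: st; rewrite E /step (negPf P0) (negPf R10); case: ifP => [_ [E1]|_].
  by right; exists k1; rewrite // E1.
case: insubP => // q _ _; case: ifP => // /and4P[_ _ _ _] [E1].
apply: IH; exists k1.-1, (R1 :|: [set r in Rep | hits e P Z A q r]); split=> //.
- exact: leq_trans (leq_pred _) k1k.
- by apply: contra R10; rewrite -!subset0 subUset => /andP[].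
- exact: subset_trans RtR1 (subsetUl _ _).
- rewrite subUset R1Rep; apply/subsetP => r; rewrite in_set => /andP[].
  by [].
Qed.

Definition choice_weight P Z A v c : F :=
  let: (ok, x, _, _) := choice e P Z A v c in if ok then u ^+ x else 0.

Lemma choice_weight_sum P Z A v : pending e P Z A v ->
  \sum_(c < n + 3) choice_weight P Z A v c <= 199%:R / 200%:R.
Proof.
case/andP=> /and3P[vP vZ nset] sab.
have u0 : 0 <= u by rewrite invr_ge0 ltW ?z_gt0.
have u1 : u <= 1 by rewrite invf_le1 ?z_gt0.
have [d1 d2 d3 d4] := decay.
rewrite addnC !big_ord_recl /= /bump /= !add1n.
set N := uncoloured e P Z v; set a := sees e P Z A v in sab *; set b := sees e P Z (~: A) v in sab *.
(* The choices that colour a neighbour along with [v] exist only if [v] sees one colour and has at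
   most two uncoloured neighbours; there is one for each of these. *)
have w3 : \sum_(i < n) choice_weight P Z A v i.+3 = if (a (+) b) && (#|N| <= 2)%N then u ^+ 16 *+ #|N| else 0.
  transitivity (\sum_(i < n) if [&& a (+) b, (#|N| <= 2)%N & i \in N] then u ^+ 16 else 0).
    apply: eq_bigr => i _; rewrite /choice_weight /choice /= subSS !subSS subn0 valK.
    by rewrite -/a -/b -/N.
  case: (a (+) b); last by rewrite big1.
  by case: (#|N| <= 2)%N; [rewrite -big_mkcond sumr_const|rewrite big1].
rewrite w3 /choice_weight /choice /= -/a -/b -/N.
have Nset : a (+) b -> (0 < #|N|)%N.
  by move: nset; rewrite /settled -/a -/b -/N lt0n => + ab; rewrite ab andbT.
move: sab Nset; case: (a); case: (b) => //= _ Nset; rewrite ?addr0.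
- exact: d1.
(* With one or two uncoloured neighbours, the leaf choice weighs 9 or 18. From three on it weighs at
   least 27, and the unseen colour is guessed at weight 6. *)
- case: (posnP #|N|) (Nset isT) => // N0 _; case: (leqP #|N| 2) => N2 /=.
    have /orP[/eqP->|/eqP->] : (#|N| == 1)%N || (#|N| == 2)%N by case: #|N| N0 N2 => [|[|[]]].
      by rewrite mulr1n; lra.
    by rewrite mulr2n; lra.
  have : u ^+ (9 * #|N|) <= u ^+ 27.
    by apply: ler_wiXn2l => //; rewrite (leq_mul2l 9 3).
  by lra.
- case: (posnP #|N|) (Nset isT) => // N0 _; case: (leqP #|N| 2) => N2 /=.
    have /orP[/eqP->|/eqP->] : (#|N| == 1)%N || (#|N| == 2)%N by case: #|N| N0 N2 => [|[|[]]].
      by rewrite mulr1n; lra.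
    by rewrite mulr2n; lra.
  have : u ^+ (9 * #|N|) <= u ^+ 27.
    by apply: ler_wiXn2l => //; rewrite (leq_mul2l 9 3).
  by lra.
Qed.

(** Positive weights make [f] decrease, which the count of states uses for its induction. *)
Lemma choice_gt0 P Z A v c : pending e P Z A v ->
  let: (ok, x, _, _) := choice e P Z A v c in ok -> (0 < x)%N.
Proof.
case/andP=> /and3P[vP vZ nset] sab; rewrite /choice.
case: ifP => _ /=; first by case: (if c == 0 then _ else _).
case: ifP => _; last by case: (insub _).
by move: nset; rewrite /settled => + h; rewrite h andbT => N0; rewrite muln_gt0 /= lt0n.
Qed.

(** The choices use up at most 199/200 of the bound; as the bound is at least 200, the remaining
    1/200 pays for the state itself. The factor [k.+2] accommodates the [k.+1] budgets of the last
    phase. *)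
Lemma colouring_covered k U P f Z A : P != set0 ->
  covered k U (k, f, U, P, Z, A, set0) ((200 * k.+2)%N%:R * z ^+ f).
Proof.
move=> P0; have zf m : 1 <= z ^+ m by apply: exprn_ege1.
have K1 : 200%:R <= (200 * k.+2)%N%:R :> F by rewrite ler_nat leq_pmulr.
have K0 : 0 <= (200 * k.+2)%N%:R :> F by apply: ler0n.
have [m] := ubnP f; elim: m => // m IH in f Z A *; rewrite ltnS => le_m.
have K1f : 200%:R <= (200 * k.+2)%N%:R * z ^+ f.
  by apply: le_trans K1 _; rewrite ler_peMr.
case E: (first_vertex (pending e P Z A)) => [v|].
  have pv := first_vertex_some E.
  pose w c := (200 * k.+2)%N%:R * z ^+ f * choice_weight P Z A v c.
  have cw0 c : 0 <= choice_weight P Z A v c.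
    rewrite /choice_weight; case: (choice _ _ _ _ _ _) => [[[[] x] V] col] //.
    by rewrite exprn_ge0 // invr_ge0 ltW ?z_gt0.
  apply: (covered_step (w := w)).
  - by move=> c; rewrite mulr_ge0 // mulr_ge0 // (le_trans _ (zf f)).
  - rewrite -mulr_sumr; have := choice_weight_sum pv; move: (\sum_(_ < _) _) K1f => S.
    by nra.
  - move=> c s1 lt_c; rewrite /step (negPf P0) eqxx E /w /choice_weight.
    have := choice_gt0 c pv.
    case: (choice _ _ _ _ _ _) => [[[ok x] V] col] /=; case: ok => //= /(_ isT) x0.
    case: (leqP x f) => // xf [<-].
    (* [z ^ f] times [u ^ x] is the power of [z] for the budget [f - x]. *)
    rewrite -mulrA exprVn -expfB_cond; last by rewrite (negPf (lt0r_neq0 z_gt0)).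
    by apply: IH; apply: leq_trans le_m; rewrite ltn_subrL x0 (leq_trans x0 xf).
case E1 : (step e (k, f, U, P, Z, A, set0) 0) => [s1|]; last first.
  apply: (covered_step (w := fun _ => 0)) => [//||c s1 _]; first by rewrite big1 //; lra.
  by move: E1; rewrite /step (negPf P0) eqxx E => ->.
pose B : F := (k.+1 * 2 ^ (#|coloured_leaders e P Z A| - #|block_leaders e P Z A|))%N%:R.
have cov c s2 : step e (k, f, U, P, Z, A, set0) c = Some s2 -> covered k U s2 B /\ B <= k.+1%:R * z ^+ f.
  rewrite /step (negPf P0) eqxx E; case: ifP => // /and5P[_ _ le _ R0] [<-]; split.
    by apply: joining_covered; rewrite ?leq_subr ?Rt_Rep.
  (* The step has tested [7 * (#|Rep| - #|Rt|) <= f], and [2 <= z ^ 7]. *)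
  by rewrite /B natrM ler_wpM2l ?ler0n // pow2_growth.
(* Closing the colouring ignores the choice, so all choices lead to the same state, which is counted
   once. *)
have step0 c : step e (k, f, U, P, Z, A, set0) c = step e (k, f, U, P, Z, A, set0) 0.
  by rewrite /step (negPf P0) eqxx E.
have [[l [ls lP]] BK] := cov _ _ E1.
exists ((k, f, U, P, Z, A, set0) :: l); split.
  have -> : (200 * k.+2)%N%:R = 200%:R * k.+1%:R + 200%:R :> F by rewrite mulnS addnC natrD natrM.
  have z1 := zf f; have k0 := ler0n F k.+1.
  have B0 : 0 <= k.+1%:R * z ^+ f by rewrite mulr_ge0 // (le_trans _ z1).
  have -> : (200%:R * k.+1%:R + 200%:R) * z ^+ f = 200%:R * (k.+1%:R * z ^+ f) + 200%:R * z ^+ f.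
    by rewrite mulrDl mulrA.
  by rewrite /= -addn1 natrD; lra.
move=> s' /stepsE[->|[c [s2 [lt_c st h]]]]; first by left; rewrite mem_head.
move: st; rewrite step0 E1 => -[s12]; rewrite -s12 in h.
by case: (lP s' h) => [sl|]; [left; rewrite inE sl orbT|right].
Qed.

Definition part_bound k : F := 1 + (n + 3)%:R * ((200 * k.+2)%N%:R * z ^+ (16 * k)).

Lemma part_bound_ge0 k : 0 <= part_bound k.
Proof. by rewrite /part_bound addr_ge0 // !mulr_ge0 ?exprn_ge0 // ltW ?z_gt0. Qed.

Lemma part_covered k k' U P U' : peel e U = Some (P, U') -> (k' <= k)%N ->
  covered k' U' (checkpoint k' U) (part_bound k).
Proof.
move=> E kk; have z0 := z_gt0.
have cst : 0 <= (200 * k.+2)%N%:R * z ^+ (16 * k) by rewrite mulr_ge0 // exprn_ge0 // ltW.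
apply: (covered_step (w := fun _ => (200 * k.+2)%N%:R * z ^+ (16 * k))) => //.
  by rewrite sumr_const card_ord /part_bound [in leRHS]mulr_natl.
move=> c s1 _; rewrite /step /= eqxx E; case: ifP => [_ [<-]|P2].
  exact: covered_checkpoint.
case: insubP => // r _ _; case: ifP => // _ [<-].
have P0 : P != set0 by apply/eqP => P0; rewrite P0 cards0 in P2.
have [l [ls lP]] := colouring_covered k' U' (16 * k' - 6) [set r] [set r] P0.
exists l; split=> //; apply: le_trans ls _; apply: ler_pM.
- exact: ler0n.
- by rewrite exprn_ge0 // ltW.
- by rewrite ler_nat leq_mul2l.
- by rewrite ler_weXn2l // (leq_trans (leq_subr _ _)) // leq_mul2l.
Qed.

(** Each part is entered with at most [k.+1] budgets, and what remains after it is the same for all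
    of them because [peel] is a function of [U] alone. *)
Lemma states_bound k U : exists l, (size l)%:R <= #|U|.+1%:R * (k.+1%:R * part_bound k) /\
  forall k' s, (k' <= k)%N -> steps (checkpoint k' U) s -> s \in l.
Proof.
have pb := part_bound_ge0 k; have k0 := ler0n F k.+1.
have [m] := ubnP #|U|; elim: m => // m IH in U *; rewrite ltnS => le_m.
case E: (peel e U) => [[P U']|]; last first.
  exists [seq checkpoint k' U | k' <- iota 0 k.+1]; split.
    rewrite size_map size_iota -[leLHS]mul1r ler_pM //; first by rewrite ler1n.
    by rewrite ler_peMr // /part_bound lerDl !mulr_ge0 ?exprn_ge0 // ltW ?z_gt0.
  move=> k' s k'k /stepsE[->|[c [s1 [_]]]]; last by rewrite /step /= eqxx E.
  by apply/mapP; exists k'; rewrite ?mem_iota.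
have [v [_ _ _ lt]] := peelP E.
have [l' [ls' lP']] := IH U' (leq_trans lt le_m).
have [k' k'k|l [ls lP]] := @collect F (state n) (fun k' s => steps (checkpoint k' U) s)
  (escapes k U') k.+1 (fun _ => part_bound k).
  have [l [ls lP]] := part_covered E (k'k : (k' <= k)%N); exists l; split=> // s h.
  case: (lP s h) => [|[k2 le2 h2]]; first by left.
  by right; exists k2 => //; apply: leq_trans le2 k'k.
exists (l ++ l'); split.
  rewrite size_cat natrD; apply: le_trans (lerD ls ls') _.
  rewrite sumr_const card_ord -[X in X + _]mulr_natl -{1}[k.+1%:R * _]mul1r -mulrDl.
  rewrite ler_wpM2r ?mulr_ge0 // addrC natr1 ler_nat ltnS.
  exact: lt.
move=> k' s k'k h; rewrite mem_cat; case: (lP k' s k'k h) => [->//|[k2 le2 h2]].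
by rewrite (lP' k2 s) ?orbT.
Qed.

End Counting.

(** * Correctness on encoded graphs *)

Section Transport.
Variables (T T' : finType) (e : rel T) (e' : rel T') (f : T -> T').
Hypotheses (bij_f : bijective f) (fE : forall x y, e' (f x) (f y) = e x y).

Lemma contracts_bij k : contracts e' setT k -> contracts e setT k.
Proof.
have [g fK gK] := bij_f; move=> [A [S [tr _ sep le]]].
have f_edge x y : e x y -> f x = f y \/ e' (f x) (f y) by rewrite fE; right.
have f_lift a b : e' a b -> exists x y, [/\ f x = a, f y = b & e x y].
  by move=> ab; exists (g a), (g b); rewrite -fE !gK.
have f_fibre x y : f x = f y -> linked e (f @^-1: [set f x]) set0 x y.
  by move/(can_inj fK)->; apply: linked0.
exists (f @^-1: A), (f @^-1: S); split.
- by apply/(tree_colouring_quotient f_edge f_lift f_fibre) => // a; exists (g a).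
- exact: subsetT.
- move=> x y; rewrite !inE => xS yS; rewrite (linked_quotientT f_edge f_lift f_fibre).
  by move/(sep _ _ xS yS)/(can_inj fK).
- rewrite on_card_preimset; last by apply: onW_bij.
  by move: le; rewrite !cardsT (bij_eq_card bij_f).
Qed.

Lemma connect_bij x y : connect e x y -> connect e' (f x) (f y).
Proof.
move=> xy; apply: (@connect_ind1 _ _ (fun y => connect e' (f x) (f y)) _ _ _ _ xy) => // a b xa ab.
by apply: connect_trans xa (connect1 _); rewrite fE.
Qed.

End Transport.

(** For the same colouring, the empty set of representatives witnesses [|T|] contractions; a larger
    parameter can thus be cut down to [n]. *)
Lemma contracts_minn (T : finType) (e : rel T) k :
  contracts e setT (minn k #|T|) <-> contracts e setT k.
Proof.
split; first by apply: contractsW; apply: geq_minl.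
move=> [A [S [tr sS sep le]]]; case: (leqP k #|T|) => kT; exists A; first by exists S.
exists set0; split; rewrite ?sub0set // ?cards0 ?cardsT // => x y.
by rewrite inE.
Qed.

Section Correct.
Variables (G : sgraph) (m : memory) (k : nat) (f : 'I_(m 0) -> G).
Hypotheses (bij_f : bijective f) (fE : forall v w, adj (f v) (f w) = edge m v w).
Hypothesis m1 : read m 1 = minn k (m 0).
Local Notation n := (m 0).
Local Notation e := (fun v w : 'I_n => edge m v w).
Local Notation start := (checkpoint (minn k n) [set: 'I_n]).

Lemma edge_sym : symmetric e. Proof. by move=> v w; rewrite /= -!fE adj_sym. Qed.
Lemma edge_irr : irreflexive e. Proof. by move=> v; rewrite /= -fE adj_irrefl. Qed.

Lemma order_card : #|G| = n. Proof. by rewrite -(bij_eq_card bij_f) card_ord. Qed.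

Lemma small_start : small start. Proof. by rewrite /= geq_minr. Qed.

Lemma reachable_state v : reachable (num_start m) (num_next m) (n + 3) v ->
  v = 0 \/ exists s : state n, [/\ small s, v = state_code s & steps e start s].
Proof.
elim=> [|{}v c lt_c _ [->|[s [sm -> st]]]].
- rewrite num_startE m1; case: ifP => _; last by left.
  by right; exists start; rewrite small_start; split=> //; apply: steps_refl.
- by left; rewrite /num_next eqxx.
- rewrite num_nextE //; case E: (step e s c) => [s'|]; last by left.
  right; exists s'; split=> //; first exact: small_step sm E.
  exact: steps_trans st (steps_next lt_c E (steps_refl _ _)).
Qed.

Lemma state_reachable (s s' : state n) : steps e s s' -> small s ->
  reachable (num_start m) (num_next m) (n + 3) (state_code s) ->
  small s' /\ reachable (num_start m) (num_next m) (n + 3) (state_code s').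
Proof.
elim=> // {}s c s1 s2 lt_c st _ IH sm rs; apply: IH; first exact: small_step sm st.
have -> : state_code s1 = num_next m (state_code s) c by rewrite num_nextE // st.
exact: reachable_next.
Qed.

Lemma search_correct :
  (exists2 v, reachable (num_start m) (num_next m) (n + 3) v & num_goal m v) <->
  tree_contractible G k.
Proof.
have [g fK gK] := bij_f.
have gE a b : edge m (g a) (g b) = adj a b by rewrite -fE !gK.
have bij_g : bijective g by exists f.
have contr : contracts e setT (minn k n) <-> contracts (@adj G) setT k.
  rewrite -[n in minn k n]card_ord; split.
    move/(contracts_minn e k); by apply: (contracts_bij bij_g) => a b; apply: gE.
  move=> h; apply/(contracts_minn e k).
  exact: (contracts_bij bij_f fE h).
have conn : [forall v : 'I_n, forall w : 'I_n, connect e v w] <-> forall u v : G, connect (@adj G) u v.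
  split=> [/forallP h u v|h].
    have /forallP/(_ (g v)) := h (g u); move/(connect_bij (f := f) (e' := @adj G) fE).
    by rewrite !gK.
  apply/forallP => v; apply/forallP => w; rewrite -[v]fK -[w]fK.
  by apply: (connect_bij (e := @adj G)); rewrite // => a b; apply: gE.
rewrite tree_contractibleP order_card; split=> [[v]|[n0 /conn cG /contr cU]].
  have start0 : num_start m = 0 -> reachable (num_start m) (num_next m) (n + 3) v -> ~~ num_goal m v.
    move=> s0 h; suff -> : v = 0 by rewrite /num_goal.
    by elim: h => [|{}v c _ _ ->] //; rewrite /num_next eqxx.
  move=> rv gv; case E: ((0 < n) && [forall v : 'I_n, forall w : 'I_n, connect e v w]); last first.
    by have := start0 _ rv; rewrite num_startE E gv => /(_ erefl).
  case/andP: E => n0 /conn cG; split=> //; apply/contr.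
  case: (reachable_state rv) => [v0|[s [sm vE st]]]; first by rewrite v0 in gv.
  have := sound_steps edge_sym st; rewrite /sound_state /= eqxx; apply.
  by rewrite -num_goalE // -vE.
have st : num_start m = state_code start by rewrite num_startE m1 n0 cG.
have [|s' steps' fin] := steps_complete edge_sym edge_irr _ cU.
  by rewrite -card_gt0 cardsT card_ord.
have [] := state_reachable steps' small_start.
  by rewrite -st; apply: reachable_start.
by move=> sm rs; exists (state_code s') => //; rewrite num_goalE.
Qed.

End Correct.

Lemma entry_small n (i j : 'I_n) : i * n + j < n * n.
Proof. by case: i j => i lt_i [j lt_j] /=; nia. Qed.

Section Encoding.
Variables (G : sgraph) (k : nat).
Local Notation n := #|G|.
Local Notation m := (update (encode G k) 1 (minn k n)).

Lemma encode_beyond a : base m <= a -> m a = 0.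
Proof.
rewrite /base /= => le; rewrite /update /encode; case: (a =P 1) => [a1|_]; first by rewrite a1 in le.
case: (a =P 0) => [a0|_]; first by rewrite a0 in le.
apply/eqP; rewrite eqb0; apply/existsP => -[i /existsP[j /andP[/eqP aE _]]].
by move: le; rewrite aE -addnA leq_add2l leqNgt entry_small.
Qed.

Lemma encode_bits a : bitlength (m a) <= n.+2.
Proof.
rewrite /update /encode; case: (a =P 1) => _.
  by apply: leq_trans (bitlength_leqS _) _; rewrite ltnS ltnW // ltnS geq_minr.
case: (a =P 0) => _; first by apply: leq_trans (bitlength_leqS _) _; rewrite ltnW.
by case: [exists _, _]; apply: leq_trans (bitlength_leqS _) _.
Qed.

Lemma encode_edge (v w : 'I_n) : edge m v w = adj (enum_val v) (enum_val w).
Proof.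
have small := entry_small v w.
have small' : 2 + v * n + w < base m by rewrite /base /= -addnA ltn_add2l.
rewrite /edge /read [m 0]/= small' /update /encode -addnA !addSn /=.
rewrite lt0b; apply/existsP/idP => [[i /existsP[j /andP[/eqP aE]]]|vw]; last first.
  by exists v; apply/existsP; exists w; rewrite vw -addnA eqxx.
have E : v * n + w = i * n + j by move: aE; rewrite -addnA !addSn !add0n => -[].
(* Row and column are recovered by Euclidean division by [n]. *)
have iv : i = v.
  have n0 : 0 < n by apply: leq_ltn_trans (ltn_ord v).
  by apply: val_inj; move: (congr1 (divn^~ n) E); rewrite /= !divnMDl // !divn_small // !addn0.
have jw : j = w by apply: val_inj; move: E; rewrite iv => /addnI.
by rewrite iv jw.
Qed.

End Encoding.

(** * Running time *)

Section Time.
Variable F : realFieldType.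
Local Open Scope ring_scope.
Import Order.TTheory GRing.Theory Num.Theory.
Local Notation q := (488%:R / 100%:R : F).

(** To be read with [S] the number of states, [X = n + 1], [Z = z ^ (16 k)], [Q] the power [k] of
    4.88, [K = k + 1], [N = n + 3] and [K' = 200 (k + 2)]. The constant is [3 * 400], plus 1 for a
    checkpoint, plus the 2 added to [S]. *)
Lemma state_count_bound (S Z Q X K N K' : F) : 0 <= Z -> 0 <= K -> 0 <= N -> 0 <= K' ->
  1 <= X -> 1 <= Q -> Z <= Q -> K <= X -> N <= 3%:R * X -> K' <= 400%:R * X ->
  S <= X * (K * (1 + N * (K' * Z))) -> S + 2%:R <= 1203%:R * Q * X ^+ 4.
Proof.
move=> Z0 K0 N0 K'0 X1 Q1 ZQ KX NX K'X le.
have X0 : 0 <= X by apply: le_trans X1; apply: ler01.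
have Q0 : 0 <= Q by apply: le_trans Q1; apply: ler01.
have X2 : 1 <= X ^+ 2 * Q by rewrite -[1]mulr1 ler_pM // exprn_ege1.
have X4 : 1 <= Q * X ^+ 4 by rewrite -[1]mulr1 ler_pM // exprn_ege1.
have b1 : N * (K' * Z) <= 3%:R * X * (400%:R * X * Q) by rewrite !ler_pM ?mulr_ge0.
have b2 : 1 + N * (K' * Z) <= 1201%:R * (X ^+ 2 * Q).
  move: b1; have -> : 3%:R * X * (400%:R * X * Q) = 1200%:R * (X ^+ 2 * Q) by ring.
  by move: X2; move: (X ^+ 2 * Q) (N * _); clear=> *; lra.
have b3 : S <= X * (X * (1201%:R * (X ^+ 2 * Q))).
  have s0 : 0 <= 1 + N * (K' * Z) by rewrite addr_ge0 ?mulr_ge0.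
  by apply: le_trans le _; rewrite ler_pM ?mulr_ge0 // ler_pM.
have -> : 1203%:R * Q * X ^+ 4 = X * (X * (1201%:R * (X ^+ 2 * Q))) + 2%:R * (Q * X ^+ 4) by ring.
by move: b3 X4; move: (X * _) (Q * _); clear=> *; lra.
Qed.

(** Of the two extra units, one is for the dead state, the other for the factor [N.+1] in the time
    of the search. *)
Lemma state_count n (e : rel 'I_n) k : (k <= n)%N -> exists l,
  ((size l).+2)%:R <= 1203%:R * q ^+ k * n.+1%:R ^+ 4 /\
  forall s, steps e (checkpoint k setT) s -> s \in l.
Proof.
move=> kn; have [z [z1 z7 z16 decay]] := growth_rate F.
have [l [ls lP]] := states_bound e z1 z7 decay k setT.
exists l; split; last by move=> s; apply: lP.
have zk : z ^+ (16 * k) <= q ^+ k.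
  by rewrite exprM; apply: lerXn2r; rewrite // nnegrE ?exprn_ge0 //; lra.
have q1 : 1 <= q ^+ k by apply: exprn_ege1; lra.
rewrite cardsT card_ord /part_bound in ls.
rewrite -[(size l).+2]addn2 natrD; apply: state_count_bound ls => //.
- by rewrite exprn_ge0 // (le_trans ler01).
- by rewrite ler1n.
- by rewrite ler_nat.
- by rewrite -natrM ler_nat; clear; lia.
- by rewrite -natrM ler_nat; move: kn; clear; lia.
Qed.

(** Queue indices must be short as well, and the number of states has only linearly many bits:
    [4.88 <= 8], [1203 <= 2 ^ 11] and [n + 1 <= 2 ^ n]. *)
Lemma expn_bound n k N : (k <= n)%N -> N%:R <= 1203%:R * q ^+ k * n.+1%:R ^+ 4 ->
  (bitlength N <= 7 * n + 60)%N.
Proof.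
move=> kn le; apply: bitlength_leq; first by rewrite addn_gt0 orbT.
have q5 : q ^+ k <= (8 ^ n)%N%:R.
  apply: le_trans (_ : 8%:R ^+ k <= _).
    by apply: lerXn2r; rewrite ?nnegrE //; lra.
  by rewrite -natrX ler_nat leq_exp2l.
have {le q5} : (N <= 1203 * 8 ^ n * n.+1 ^ 4)%N.
  rewrite -(ler_nat F); apply: le_trans le _; rewrite natrM (natrM _ 1203) (natrX _ n.+1 4).
  by rewrite ler_wpM2r ?exprn_ge0 // ler_wpM2l.
move=> le; apply: leq_ltn_trans le _.
have -> : (2 ^ (7 * n + 60) = 2 ^ 60 * 8 ^ n * (2 ^ n) ^ 4)%N.
  rewrite (_ : 8 = 2 ^ 3)%N // -!expnM -!expnD; congr (2 ^ _)%N; lia.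
apply: leq_trans (_ : (2 ^ 11 * 8 ^ n * n.+1 ^ 4 <= _)%N).
  have : (0 < 8 ^ n * n.+1 ^ 4)%N by rewrite muln_gt0 !expn_gt0.
  by rewrite -!mulnA; move: (8 ^ n * _)%N; clear=> *; lia.
apply: leq_mul; first by rewrite leq_mul2r leq_exp2l // orbT.
by rewrite leq_exp2r // ltn_expl.
Qed.

(** [k - (k - n)] is the minimum of [k] and [n]. It is taken first, so that the search handles only
    numbers whose length is polynomial in [n]. *)
Definition clamp := Store (Const 1)
  (Defs.Sub (Fetch (Const 1)) (Defs.Sub (Fetch (Const 1)) (Fetch (Const 0)))).

Lemma exec_clamp G k : exists2 t, exec clamp (encode G k) (update (encode G k) 1 (minn k #|G|)) t &
  (t <= 40 * (k.+1 * #|G|.+1))%N.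
Proof.
exists (eval_cost (encode G k) (Const 1) + eval_cost (encode G k)
  (Defs.Sub (Fetch (Const 1)) (Defs.Sub (Fetch (Const 1)) (Fetch (Const 0))))).+1.
  have -> : minn k #|G| = eval (encode G k) (Defs.Sub (Fetch (Const 1))
    (Defs.Sub (Fetch (Const 1)) (Fetch (Const 0)))) by rewrite /= /encode /= minnE.
  exact: exec_store.
have -> : eval_cost (encode G k) (Defs.Sub (Fetch (Const 1))
    (Defs.Sub (Fetch (Const 1)) (Fetch (Const 0)))) =
  (bitlength (k - (k - #|G|)) + (bitlength k + (bitlength 1 + 0) + (bitlength (k - #|G|) +
    (bitlength k + (bitlength 1 + 0) + (bitlength #|G| + (bitlength 0 + 0))))))%N by [].
have := bitlength_leqS (k - (k - #|G|)); have := bitlength_leqS k; have := bitlength_leqS (k - #|G|).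
have := bitlength_leqS #|G|; have := bitlength_leqS 0; have := bitlength_leqS 1.
rewrite /eval_cost /=; move: #|G| => n.
have : (k + n + 1 <= k.+1 * n.+1)%N by clear; nia.
move: (k.+1 * n.+1)%N (bitlength _) (bitlength _) (bitlength _) (bitlength _) (bitlength _) (bitlength _).
by clear=> *; lia.
Qed.

Lemma linear_time_bound e n : ((7 * n + 60) ^ e <= 60 ^ e * n.+1 ^ e)%N.
Proof. by rewrite -expnMn; case: e => // e; rewrite leq_exp2r //; lia. Qed.

(** To be read with [X = n + 1], [Y = X ^ d], and [Qn], [Qk] the powers of 4.88 with exponents
    [minn k n] and [k]. *)
Lemma time_bound (t0 t K N B Y X Qk Qn : F) : t0 <= 40%:R * (K * X) -> K <= Qk ->
  t <= N * (B * Y) -> N <= 1203%:R * Qn * X ^+ 4 -> Qn <= Qk -> 1 <= X -> 1 <= Y -> 0 <= B ->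
  0 <= K -> 0 <= Qn -> t0 + t <= (40%:R + 1203%:R * B) * Qk * (X ^+ 4 * Y).
Proof.
move=> le0 KQ le leN Qnk X1 Y1 B0 K0 Qn0.
have Q0 : 0 <= Qk by apply: le_trans KQ.
have X0 : 0 <= X by apply: le_trans X1; apply: ler01.
have Y0 : 0 <= Y by apply: le_trans Y1; apply: ler01.
have -> : (40%:R + 1203%:R * B) * Qk * (X ^+ 4 * Y) =
  40%:R * (Qk * (X ^+ 4 * Y)) + 1203%:R * Qk * X ^+ 4 * (B * Y) by ring.
apply: lerD.
  apply: le_trans le0 _; rewrite ler_wpM2l // ler_pM // -[X in X <= _]mulr1 ler_pM //.
  by rewrite exprS -[X in X <= _]mulr1 ler_wpM2l // exprn_ege1.
apply: le_trans le _; rewrite ler_wpM2r ?mulr_ge0 //; apply: le_trans leN _.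
by rewrite ler_wpM2r ?exprn_ge0 // ler_wpM2l.
Qed.

Theorem running_time : exists (p : program) (C d : nat), forall (G : sgraph) (k : nat),
  exists s t, [/\ exec p (encode G k) s t, accepting s <-> tree_contractible G k
    & t%:R <= C%:R * q ^+ k * #|G|.+1%:R ^+ d].
Proof.
have [p [T [[d Td] pP]]] := @search_program num_start num_goal num_next
  (@computable_start input_context) (computable_goal (@computable_snd _))
  (computable_next (computable_fst (@computable_snd _)) (@computable_snd _)).
exists (Seq clamp p), (40 + 1203 * 60 ^ d)%N, (4 + d)%N => G k.
have [t0 run0 le0] := exec_clamp G k.
set m := update (encode G k) 1 (minn k #|G|) in run0 *.
have edgeE : forall v w : 'I_(m 0), adj (enum_val v) (enum_val w) = edge m v w.
  by move=> v w; apply/esym/(encode_edge k).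
have m1 : read m 1 = minn k (m 0) by [].
have bij_val : bijective (enum_val : 'I_(m 0) -> G) by apply: enum_val_bij.
have [l [ls lP]] := @state_count (m 0) (fun v w => edge m v w) _ (geq_minr k (m 0)).
have [|||||||s [t [run acc le]]] := pP m (7 * #|G| + 60)%N (size l).+1.
- exact: encode_beyond.
- by rewrite addnC.
- by change (#|G| <= 7 * #|G| + 60)%N; lia.
- by move=> a _; apply: leq_trans (encode_bits G k a) _; lia.
- exact: (expn_bound (geq_minr k #|G|) ls).
- move=> v /(reachable_state m1)[->|[s [sm -> _]]].
    by apply: leq_trans (bitlength_leqS 0) _; lia.
  by apply: leq_trans (state_code_bitlength sm) _; rewrite leq_add2l.
(* Every reachable number is the dead state 0 or the code of a listed state. *)
- move=> Q uQ QR; have -> : (size l).+1 = size (0%N :: [seq state_code s | s <- l]).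
    by rewrite /= size_map.
  apply: uniq_leq_size uQ _ =>  v /QR/(reachable_state m1)[->|[s [_ -> st]]]; first by rewrite mem_head.
  by rewrite inE map_f ?orbT ?lP.
exists s, (t0 + t)%N; split.
- exact: exec_seq run0 run.
- by rewrite acc; apply: (search_correct bij_val edgeE m1).
have {le} le : (t <= (size l).+2 * (60 ^ d * #|G|.+1 ^ d))%N.
  apply: leq_trans le _; rewrite leq_mul2l; apply/orP; right.
  by apply: leq_trans (Td _ _) (linear_time_bound _ _); rewrite addnC.
have q2 : 2%:R <= q by lra.
have q1 : 1 <= q by lra.
(* The time of [clamp] is bounded by a multiple of [k.+1], which the exponential absorbs. *)
have k_le : k.+1%:R <= q ^+ k.
  apply: le_trans (_ : (2 ^ k)%:R <= _); first by rewrite ler_nat ltn_expl.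
  by rewrite natrX; apply: lerXn2r; rewrite ?nnegrE // (le_trans ler01).
have X1 : 1 <= #|G|.+1%:R :> F by rewrite ler1n.
have qk : q ^+ minn k #|G| <= q ^+ k by rewrite ler_weXn2l ?geq_minl.
have le0' : t0%:R <= 40%:R * (k.+1%:R * #|G|.+1%:R) :> F by rewrite -!natrM ler_nat.
have le' : t%:R <= (size l).+2%:R * ((60 ^ d)%N%:R * #|G|.+1%:R ^+ d) :> F.
  by rewrite -natrX -!natrM ler_nat.
rewrite (natrD _ t0 t) (natrD _ 40) (natrM _ 1203) exprD.
apply: (time_bound le0' k_le le' ls qk X1); rewrite ?ler0n ?exprn_ege1 //.
by rewrite exprn_ge0 // (le_trans ler01 q1).
Qed.
End Time.

Import Order.TTheory GRing.Theory Num.Theory.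
Local Open Scope ring_scope.

Theorem theorem7 :
  exists (p : program) (C d : nat),
    forall (G : sgraph) (k : nat),
      exists (s : memory) (t : nat),
        [/\ exec p (encode G k) s t,
            accepting s <-> tree_contractible G k
          & (t%:R : rat) <= C%:R * 4.88%Q ^+ k * (#|G|.+1)%:R ^+ d].
Proof.
have -> : 4.88%Q = 488%:R / 100%:R :> rat by apply/eqP; vm_compute.
exact: running_time.
Qed.
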